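(* Let $(E,(\cdot,\cdot),\mathcal H)$ be an extended affine Lie algebra of reduced type $X$ and of rank $>1$, with root system $R$ and core $E_c$. If $X=B_\ell$, assume further that $\mathrm{ind}(R)=0$. Let $\mathcal C=\{x_\alpha\mid\alpha\in R^\times\}$ and $\bar{\mathcal C}=\{\bar x_\alpha\mid\alpha\in R^\times\}$ be two Chevalley systems for $E_c$ (with respect to Chevalley involutions $\tau$ and $\bar\tau$ of $E_c$, respectively), and let $\mathcal B$ and $\bar{\mathcal B}$ be the corresponding integral structures on $E_c$, obtained from $\mathcal C$ and $\bar{\mathcal C}$ by the construction described in the context. Then $\mathrm{span}_{\mathbb Z}\mathcal B$ and $\mathrm{span}_{\mathbb Z}\bar{\mathcal B}$ are isomorphic as Lie algebras over $\mathbb Z$.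
   Context: All vector spaces are over $\mathbb C$. An extended affine Lie algebra is a triple $(E,(\cdot,\cdot),\mathcal H)$ such that: (A1) $E$ is a Lie algebra with a symmetric invariant non-degenerate bilinear form $(\cdot,\cdot)$; (A2) $\mathcal H$ is a non-trivial finite-dimensional subalgebra with $E=\sum_{\alpha\in\mathcal H^\star}E_\alpha$, $E_\alpha=\{x\in E\mid [h,x]=\alpha(h)x\ \forall h\in\mathcal H\}$, and $E_0=\mathcal H$; (A3) $\mathrm{ad}\,x$ is locally nilpotent for each $x\in E_\alpha$, $\alpha\in R^\times$; (A4) (tameness) the centralizer of $E_c$ in $E$ is contained in $E_c$; (A5) the $\mathbb Z$-span of $R$ in $\mathcal H^\star$ is a free abelian group of finite rank; (A6) if $R^\times=R_1\uplus R_2$ with $R_1,R_2\neq\emptyset$, then $R_1\not\perp R_2$. Here $R=\{\alpha\in\mathcal H^\star\mid E_\alpha\ne\{0\}\}$ is the root system; for $\alpha\in R$, $t_\alpha\in\mathcal H$ is the unique element with $\alpha(h)=(h,t_\alpha)$ for all $h\in\mathcal H$; $(\alpha,\beta):=(t_\alpha,t_\beta)$; $R^0=\{\alpha\in R\mid(\alpha,\alpha)=0\}$ (isotropic roots), $R^\times=R\setminus R^0$ (non-isotropic roots); the core $E_c$ is the subalgebra of $E$ generated by the root spaces $E_\alpha$, $\alpha\in R^\times$. For $\alpha\in R^\times$, $h_\alpha:=2t_\alpha/(\alpha,\alpha)$. With $\mathcal V=\mathrm{span}_{\mathbb R}R$ and $\mathcal V^0=\mathrm{span}_{\mathbb R}R^0$,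 the image of $R$ in $\mathcal V/\mathcal V^0$ is an irreducible finite root system; its type and rank are the type and rank of $E$. Reduced type means that this finite root system is reduced (type $BC$ excluded). Reflectable bases and index: write $\mathcal V=\dot{\mathcal V}\oplus\mathcal V^0$, where $\dot{\mathcal V}$ is the real span of a suitable finite root system $\dot R\subset\mathcal V$ mapping isomorphically onto the image of $R$ in $\mathcal V/\mathcal V^0$. Put $\tilde{\mathcal V}=\mathcal V\oplus(\mathcal V^0)^\star$ and extend the form by $(\gamma,\sigma)=\gamma(\sigma)$ for $\gamma\in(\mathcal V^0)^\star,\sigma\in\mathcal V^0$, and $(\dot{\mathcal V},(\mathcal V^0)^\star)=((\mathcal V^0)^\star,(\mathcal V^0)^\star)=\{0\}$. For $\alpha\in R^\times$, $w_\alpha\in GL(\tilde{\mathcal V})$ is the reflection sending $\alpha$ to $-\alpha$ and fixing pointwise the hyperplane orthogonal to $\alpha$. For $\Pi\subseteq R^\times$, $\mathcal W_\Pi$ is the group generated by the $w_\alpha$, $\alpha\in\Pi$. A reflectable base of $R$ is a subset $\Pi\subseteq R^\times$ with $\mathcal W_\Pi\Pi=R^\times$ such that no proper subset of $\Pi$ has this property; $\mathrm{refl}(R)$ is the minimum cardinality of a reflectable base, and $\mathrm{ind}(R)=\mathrm{refl}(R)-\dim\mathcal V$. A Chevalley involution for $E_c$ is a finite order automorphism $\tau$ of $E_c$ with $\tau(E_\alpha)=E_{-\alpha}$ for all $\alpha\in R^\times$. A Chevalley system for $(E_c,\tau)$ is a set $\{x_\alpha\in E_\alpha\mid\alpha\in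 R^\times\}$ such that $[x_\alpha,x_{-\alpha}]=h_\alpha$ and $\tau(x_\alpha)=-x_{-\alpha}$ for all $\alpha\in R^\times$. An integral structure for $(E_c,\tau)$ is a subset $\mathcal B\subseteq E_c$ such that: (C1) elements of $\mathcal B$ are root vectors of $E$; (C2) $\tau(\mathcal B)=-\mathcal B$; (C3) $\{\mathcal B\cap E_\alpha\mid\alpha\in R^\times\}$ is a Chevalley system for $(E_c,\tau)$; (C4) for $\sigma\in R^0$, $\mathrm{span}_{\mathbb Z}(\mathcal B\cap E_\sigma)=\sum_{\alpha\in R^\times}\mathbb Z[\mathcal B\cap E_{\alpha+\sigma},\mathcal B\cap E_{-\alpha}]$. Construction of the integral structure $\mathcal B$ from a Chevalley system $\mathcal C=\{x_\alpha\}$ for $(E_c,\tau)$: fix a reflectable base $\Pi$ of cardinality $\mathrm{refl}(R)$ and a decomposition $R^0\setminus\{0\}={R^0}^+\uplus{R^0}^-$ with ${R^0}^+=-{R^0}^-$. For $\sigma\in{R^0}^+$ let $\mathcal B_\sigma$ be a $\mathbb Z$-basis of the free abelian group $\mathrm{span}_{\mathbb Z}\{[x_{\alpha+\sigma},x_{-\alpha}]\mid\alpha\in\Pi,\ \alpha+\sigma\in R\}$ and put $\mathcal B_{-\sigma}=-\tau(\mathcal B_\sigma)$. Let $\mathcal B_0$ be a $\mathbb Z$-basis of $\mathrm{span}_{\mathbb Z}\{h_\alpha\mid\alpha\in\Pi\}$. Then $\mathcal B=\mathcal B_0\cup\mathcal C\cup\bigcup_{\sigma\in R^0\setminus\{0\}}\mathcal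 B_\sigma$, which is an integral structure for $(E_c,\tau)$. The set $\bar{\mathcal B}$ is obtained in the same way from $\bar{\mathcal C}$ and $\bar\tau$. *)

(* Defs.v *)
(* The complex numbers are R[i] for R : realType. *)
From HB Require Import structures.
From mathcomp Require Import all_boot all_order all_algebra sesquilinear.
From mathcomp Require Import mathcomp_extra boolp classical_sets functions.
From mathcomp Require Import cardinality reals.
From mathcomp Require Import complex.

Set Implicit Arguments.
Unset Strict Implicit.
Unset Printing Implicit Defensive.

Import Order.TTheory GRing.Theory Num.Theory.

Local Open Scope ring_scope.
Local Open Scope complex_scope.
Local Open Scope classical_set_scope.
Local Open Scope card_scope.

Section IntegralSpans.
Variable V : zmodType.
Implicit Types (A B S : set V).

Definition additive_subgroup S := S 0 /\ forall x y, S x -> S y -> S (x - y).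

Definition Zspan A : set V := smallest additive_subgroup A.

Definition Zindependent A := forall (s : seq V) (k : V -> int),
  uniq s -> (forall x, x \in s -> A x) ->
  \sum_(x <- s) x *~ k x = 0 -> forall x, x \in s -> k x = 0.

Definition Zbasis B S := Zindependent B /\ Zspan B = S.

Definition free_abelian_of_finite_rank S :=
  exists s : seq V, Zbasis [set` s] S.

End IntegralSpans.

(* A complex vector space W is regarded as a real one through r |-> r%:C. *)
Section RealSpans.
Variables (R : realType) (W : lmodType R[i]).
Implicit Types (A S U : set W).

Definition real_subspace S :=
  [/\ S 0, forall x y, S x -> S y -> S (x + y)
    & forall (r : R) x, S x -> S (r%:C *: x)].

Definition Rspan A : set W := smallest real_subspace A.

(* For real subspaces U `<=` S: the real vector space S / U has dimension n. *)
Definition dim_quotient S U (n : nat) := exists s : seq W,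
  [/\ size s = n, uniq s,
      forall k : W -> R, U (\sum_(x <- s) (k x)%:C *: x) ->
        forall x, x \in s -> k x = 0
    & Rspan ([set` s] `|` U) = S].

Definition dim_real S (n : nat) := dim_quotient S [set 0] n.

Definition real_linear_on (X : lmodType R) S (f : W -> X) :=
  forall (r : R) x y, S x -> S y -> f (r%:C *: x + y) = r *: f x + f y.

End RealSpans.

Definition std_root_system_B (R : realType) (l : nat) : set 'rV[R]_l :=
  [set v | (exists (a : bool) (i : 'I_l), v = (-1) ^+ a *: delta_mx 0 i) \/
           (exists (a b : bool) (i j : 'I_l), i != j /\
              v = (-1) ^+ a *: delta_mx 0 i + (-1) ^+ b *: delta_mx 0 j)].

(* The finite-dimensional subspace HH of E is given as the range of a linear map
   [cartan_incl] from a finite-dimensional space [cartan]; the map is required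
   to be injective in [eala_A2]. *)
Record eala_data (R : realType) := EalaData {
  carrier :> lmodType R[i];
  bracket : {bilinear carrier -> carrier -> carrier};
  bform : {bilinear carrier -> carrier -> R[i] | *%R & *%R};
  cartan : vectType R[i];
  cartan_incl : {linear cartan -> carrier}
}.

Section ExtendedAffineLieAlgebras.
Variables (R : realType) (E : eala_data R).

Notation "[< x , y >]" := (bracket E x y).

Definition HHdual := 'Hom(cartan E, R[i]^o).

Implicit Types (x y z : E) (a b s : HHdual) (S : set E).

Definition lie_axioms :=
  (forall x, [<x, x>] = 0) /\
  (forall x y z, [<x, [<y, z>]>] + [<y, [<z, x>]>] + [<z, [<x, y>]>] = 0).

Definition lie_subalgebra S :=
  [/\ S 0, forall x y, S x -> S y -> S (x + y),
      forall (c : R[i]) x, S x -> S (c *: x)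
    & forall x y, S x -> S y -> S [<x, y>]].

Definition root_space a : set E :=
  [set x | forall h : cartan E, [<cartan_incl E h, x>] = a h *: x].

Definition root_system : set HHdual :=
  [set a | exists x, x != 0 /\ root_space a x].

(* t_a; the representing vector exists and is unique under the axioms below. *)
Definition t_ a : cartan E :=
  xget 0 [set t | forall h, a h = bform E (cartan_incl E h) (cartan_incl E t)].

Definition dform a b : R[i] :=
  bform E (cartan_incl E (t_ a)) (cartan_incl E (t_ b)).

Definition iso_roots : set HHdual := [set a | root_system a /\ dform a a = 0].
Definition noniso_roots : set HHdual := root_system `\` iso_roots.

Definition core : set E :=
  smallest lie_subalgebra (\bigcup_(a in noniso_roots) root_space a).

Definition coroot a : E := cartan_incl E ((2 / dform a a) *: t_ a).

Definition eala_A1 :=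
  [/\ lie_axioms,
      forall x y, bform E x y = bform E y x,
      forall x y z, bform E [<x, y>] z = bform E x [<y, z>]
    & forall x, (forall y, bform E x y = 0) -> x = 0].

Definition eala_A2 :=
  [/\ injective (cartan_incl E),
      (exists h : cartan E, h != 0),
      lie_subalgebra (range (cartan_incl E)),
      (forall x, exists (r : seq HHdual) (f : HHdual -> E),
        (forall a, root_space a (f a)) /\ x = \sum_(a <- r) f a)
    & root_space 0 = range (cartan_incl E)].

Definition eala_A3 := forall a x, noniso_roots a -> root_space a x ->
  forall y, exists n, iter n (bracket E x) y = 0.

Definition eala_A4 :=
  [set x | forall y, core y -> [<x, y>] = 0] `<=` core.

Definition eala_A5 := free_abelian_of_finite_rank (Zspan root_system).

Definition eala_A6 := forall R1 R2 : set HHdual,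
  noniso_roots = R1 `|` R2 -> R1 `&` R2 = set0 -> R1 !=set0 -> R2 !=set0 ->
  exists a b, [/\ R1 a, R2 b & dform a b != 0].

Definition is_eala :=
  (eala_A1 /\ eala_A2 /\ eala_A3) /\ (eala_A4 /\ eala_A5 /\ eala_A6).

Definition realV : set HHdual := Rspan root_system.
Definition realV0 : set HHdual := Rspan iso_roots.

Definition eala_rank (l : nat) := dim_quotient realV realV0 l.

(* The image of R in V / V^0 is a reduced finite root system: proportional
   nonzero elements of the image are equal or opposite. *)
Definition reduced_type := forall a b (r : R),
  root_system a -> ~ realV0 a -> root_system b -> ~ realV0 b ->
  realV0 (b - r%:C *: a) -> r = 1 \/ r = -1.

(* The map f induces a linear isomorphism from V / V^0 to R^l that sends the
   image of R (in which 0 is included) to the root system of type B_l. *)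
Definition type_B (l : nat) := exists f : HHdual -> 'rV[R]_l,
  [/\ real_linear_on realV f,
      forall v, realV v -> (f v = 0 <-> realV0 v)
    & f @` root_system = 0 |` @std_root_system_B R l].

(* dotR spans the complement of V^0 in V and has the same image as R in
   V / V^0; as R does, it contains 0. *)
Definition finite_part (dotR : set HHdual) :=
  [/\ finite_set dotR,
      [set v + s | v in Rspan dotR & s in realV0] = realV,
      Rspan dotR `&` realV0 = [set 0]
    & [set a + s | a in root_system & s in realV0] =
      [set a + s | a in dotR & s in realV0]].

(* An element of (V^0)^*, given by a function of which only the values on V^0
   are relevant. *)
Record dualV0 := DualV0 {
  dualV0_fun :> HHdual -> R;
  dualV0_linear : @real_linear_on R HHdual R^o realV0 dualV0_fun
}.

Fact zero_dualV0_linear : @real_linear_on R HHdual R^o realV0 (fun=> 0).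
Proof. by move=> r x y _ _; rewrite scaler0 addr0. Qed.

Definition zero_dualV0 := DualV0 zero_dualV0_linear.

(* V + (V^0)^*, with V enlarged to the whole of HH^*: the reflections below stay
   in V + (V^0)^* only when the form is normalized to be real-valued on V. *)
Definition tildeV := (HHdual * dualV0)%type.

Definition in_tildeV (v : HHdual) : tildeV := (v, zero_dualV0).

Section Reflections.
Variable dotR : set HHdual.

(* The projection of V onto V^0 along the real span of dotR. *)
Definition projV0 (v : HHdual) : HHdual :=
  xget 0 [set s | realV0 s /\ Rspan dotR (v - s)].

Definition tilde_form (u v : tildeV) : R[i] :=
  dform u.1 v.1 + (u.2 (projV0 v.1))%:C + (v.2 (projV0 u.1))%:C.

Definition reflection a (u : tildeV) : tildeV :=
  (u.1 - (2 * tilde_form u (in_tildeV a) / dform a a) *: a, u.2).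

Definition group_of_maps (G : set (tildeV -> tildeV)) :=
  [/\ G id, forall f g, G f -> G g -> G (f \o g)
    & forall f g, G f -> cancel f g -> cancel g f -> G g].

Definition weyl_group (P : set HHdual) : set (tildeV -> tildeV) :=
  smallest group_of_maps (reflection @` P).

Definition generates_by_reflections (P : set HHdual) :=
  [set w (in_tildeV a) | w in weyl_group P & a in P] =
  in_tildeV @` noniso_roots.

Definition reflectable_base (P : set HHdual) :=
  [/\ P `<=` noniso_roots, generates_by_reflections P
    & forall Q : set HHdual,
        Q `<=` P -> Q <> P -> ~ generates_by_reflections Q].

Definition is_refl (n : nat) :=
  (exists2 P, reflectable_base P & P #= `I_n) /\
  (forall P, reflectable_base P -> `I_n #<= P).

Definition is_ind (k : int) := exists n d : nat,
  [/\ is_refl n, dim_real realV d & k = n%:Z - d%:Z].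

End Reflections.

(* Only the values of tau on the core are relevant. *)
Definition core_automorphism (tau : E -> E) :=
  [/\ set_bij core core tau,
      forall (c : R[i]) x y, core x -> core y ->
        tau (c *: x + y) = c *: tau x + tau y
    & forall x y, core x -> core y -> tau [<x, y>] = [<tau x, tau y>]].

Definition chevalley_involution (tau : E -> E) :=
  [/\ core_automorphism tau,
      exists2 n, (0 < n)%N & forall x, core x -> iter n tau x = x
    & forall a, noniso_roots a -> tau @` root_space a = root_space (- a)].

(* The family is indexed by HH^*; only its values on R^x are relevant. *)
Definition chevalley_system (tau : E -> E) (x_ : HHdual -> E) :=
  forall a, noniso_roots a ->
    [/\ root_space a (x_ a), [<x_ a, x_ (- a)>] = coroot a
      & tau (x_ a) = - x_ (- a)].

Definition iso_root_decomposition (Rp Rm : set HHdual) :=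
  [/\ iso_roots `\ 0 = Rp `|` Rm, Rp `&` Rm = set0 & Rp = -%R @` Rm].

(* B is an outcome of the construction applied to the Chevalley system x_ of
   (E_c, tau), for some choice of the auxiliary data (the reflectable base P,
   the decomposition Rp, Rm, and the Z-bases B_ s). *)
Definition constructed_from (dotR : set HHdual) (tau : E -> E)
    (x_ : HHdual -> E) (B : set E) :=
  exists (P Rp Rm : set HHdual) (n : nat) (B_ : HHdual -> set E),
    [/\ [/\ reflectable_base dotR P, is_refl dotR n & P #= `I_n],
        iso_root_decomposition Rp Rm,
        forall s, Rp s ->
          Zbasis (B_ s) (Zspan [set [<x_ (a + s), x_ (- a)>]
                               | a in [set a | P a /\ root_system (a + s)]]) /\
          B_ (- s) = [set - tau y | y in B_ s],
        Zbasis (B_ 0) (Zspan (coroot @` P))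
      & B = B_ 0 `|` x_ @` noniso_roots `|` \bigcup_(s in iso_roots `\ 0) B_ s].

Definition Z_lie_subalgebra S :=
  additive_subgroup S /\ forall x y, S x -> S y -> S [<x, y>].

Definition Z_lie_isomorphic (S T : set E) :=
  [/\ Z_lie_subalgebra S, Z_lie_subalgebra T
    & exists f : E -> E,
        [/\ set_bij S T f,
            forall x y, S x -> S y -> f (x + y) = f x + f y
          & forall x y, S x -> S y -> f [<x, y>] = [<f x, f y>]]].

End ExtendedAffineLieAlgebras.

(* Main.v *)
(* Write [xb_a = c_a x_a]. Comparing the two Chevalley systems along the a-string
   [b, b + a, b + 2a, ...] of roots gives [c_(b+ka) = ± c_a^k c_b], so [chi = c^2]
   is multiplicative on sums of roots and compatible with reflections. If [chi]
   extends to a homomorphism on the root lattice, which is free, it has a square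
   root [phi] there, and the automorphism of E acting on the root space of [a] by
   [phi a] carries [x_a] to [± xb_a]. It then carries the Z-span of the [x_a] and of
   the [[x_(b+s), x_(-b)]], s isotropic, onto its counterpart; by lifting reflections
   to automorphisms [exp exp exp], this span is the span of B whatever base and
   decomposition were used to build B.
   That [chi] respects the linear relations between roots is shown as follows. If
   two short roots span a system of type A2, a relation between short roots is
   shortened by adding two roots with a negative product, and every long root is a
   sum of short ones. Otherwise the short roots are orthogonal, the type is B, and
   [ind = 0] provides a reflectable base that is linearly independent. *)
From HB Require Import structures.
From mathcomp Require Import all_boot all_order all_algebra sesquilinear.
From mathcomp Require Import ring lra zify.
From mathcomp Require Import mathcomp_extra boolp classical_sets functions.
From mathcomp Require Import cardinality reals complex.
Require Import Defs.

Set Implicit Arguments.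
Unset Strict Implicit.
Unset Printing Implicit Defensive.

Import Order.TTheory GRing.Theory Num.Theory.

Local Open Scope ring_scope.
Local Open Scope complex_scope.
Local Open Scope classical_set_scope.

(** * Linear identities *)

(** Squares appear because a Chevalley system determines its structure constants along a string only
    up to sign: the form and tau give the square of a coefficient. The lost sign is harmless, as a
    Z-span does not see it. But [chi] is then known to behave well only under reflections, which
    does not by itself control a relation such as a + (s - a) = b + (s - b) with s isotropic: the
    root system is finite modulo V0, while its lattice has isotropic directions. Two nonorthogonal,
    nonparallel short roots make [chi a * chi (s - a)] independent of the short root a and
    multiplicative in s; with orthogonal short roots the values at different a cannot be compared in
    this way. Isotropic root spaces need not be lines, so no basis of E is used: the automorphism is
    built from a character and the invariant form, and the isotropic part of the lattice is handled
    through the vectors [x_(b+s), x_(-b)]. The combinatorics takes place in the root lattice,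
    identified with Z^n, with integer pairings, because the form on E is complex-valued and not
    normalized. *)

Inductive linexp (K : Type) : Type :=
| LVar of nat
| LZero
| LAdd of linexp K & linexp K
| LOpp of linexp K
| LScale of K & linexp K.

Arguments LVar {K}.
Arguments LZero {K}.

Section LinearExpressions.
Variables (K : nzRingType) (M : lmodType K).

Fixpoint linval (env : seq M) (t : linexp K) : M :=
  match t with
  | LVar i => env`_i
  | LZero => 0
  | LAdd t u => linval env t + linval env u
  | LOpp t => - linval env t
  | LScale c t => c *: linval env t
  end.

Fixpoint lincoef (i : nat) (t : linexp K) : K :=
  match t with
  | LVar j => if j == i then 1 else 0
  | LZero => 0
  | LAdd t u => lincoef i t + lincoef i u
  | LOpp t => - lincoef i t
  | LScale c t => c * lincoef i t
  end.

Lemma linvalE env t :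
  linval env t = \sum_(i < size env) lincoef i t *: env`_i.
Proof.
elim: t => [j||t IHt u IHu|t IHt|c t IHt] /=.
- case: (ltnP j (size env)) => [lt_j|le_j].
    rewrite (bigD1 (Ordinal lt_j)) //= eqxx scale1r big1 ?addr0 // => i.
    by rewrite -val_eqE /= eq_sym => /negPf ->; rewrite scale0r.
  rewrite nth_default // big1 // => i _.
  by rewrite gtn_eqF ?scale0r // (leq_trans (ltn_ord i)).
- by rewrite big1 // => i _; rewrite scale0r.
- by rewrite IHt IHu -big_split; apply: eq_bigr => i _; rewrite scalerDl.
- by rewrite IHt -sumrN; apply: eq_bigr => i _; rewrite scaleNr.
- by rewrite IHt scaler_sumr; apply: eq_bigr => i _; rewrite scalerA.
Qed.

(** The [foldr] over [iota] computes to a conjunction with one scalar equation per atom, so that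
    [repeat split] leaves goals for [ring] or [field]. *)
Lemma linval_eq env t u :
  foldr (fun i P => lincoef i t = lincoef i u /\ P) True (iota 0 (size env)) ->
  linval env t = linval env u.
Proof.
move=> H; rewrite !linvalE; apply: eq_bigr => i _; congr (_ *: _).
have : (i : nat) \in iota 0 (size env) by rewrite mem_iota add0n ltn_ord.
elim: (iota 0 (size env)) H => //= j s IHs [Hj Hs].
by rewrite inE => /orP[/eqP->//|]; apply: IHs.
Qed.

End LinearExpressions.

(** [match constr:(Set)] is a device for running the tactic [unify] inside an Ltac function that has
    to return a term; if [unify] fails, the next branch is taken. *)
Ltac lin_mem x env :=
  lazymatch env with
  | nil => constr:(false)
  | cons ?y ?env' => match constr:(Set) with
      | _ => let _ := match constr:(Set) with _ => unify x y end in constr:(true)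
      | _ => lin_mem x env'
      end
  end.

Ltac lin_atoms env t :=
  lazymatch t with
  | GRing.add ?a ?b => let env := lin_atoms env a in lin_atoms env b
  | GRing.opp ?a => lin_atoms env a
  | GRing.scale _ ?a => lin_atoms env a
  | GRing.natmul ?a _ => lin_atoms env a
  | GRing.zero => env
  | _ => match lin_mem t env with
         | true => env
         | false => constr:(cons t env)
         end
  end.

Ltac lin_index x env :=
  lazymatch env with
  | cons ?y ?env' => match constr:(Set) with
      | _ => let _ := match constr:(Set) with _ => unify x y end in constr:(0%N)
      | _ => let n := lin_index x env' in constr:(S n)
      end
  end.

Ltac lin_reify K env t :=
  lazymatch t with
  | GRing.add ?a ?b =>
      let a := lin_reify K env a in
      let b := lin_reify K env b in constr:(@LAdd K a b)
  | GRing.opp ?a => let a := lin_reify K env a in constr:(@LOpp K a)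
  | GRing.scale ?c ?a => let a := lin_reify K env a in constr:(@LScale K c a)
  | GRing.zero => constr:(@LZero K)
  | _ => let n := lin_index t env in constr:(@LVar K n)
  end.

Ltac lin_eq K :=
  rewrite -?scaler_nat;
  lazymatch goal with
  | |- @eq ?T ?a ?b =>
    let env := lin_atoms (@nil T) a in
    let env := lin_atoms env b in
    let ta := lin_reify K env a in
    let tb := lin_reify K env b in
    change (linval env ta = linval env tb);
    apply: linval_eq; rewrite /=; repeat split
  end.

(* The same for abelian groups, seen as modules over the integers. *)
Ltac zmod_atoms env t :=
  lazymatch t with
  | GRing.add ?a ?b => let env := zmod_atoms env a in zmod_atoms env b
  | GRing.opp ?a => zmod_atoms env a
  | intmul ?a _ => zmod_atoms env a
  | GRing.natmul ?a _ => zmod_atoms env a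
  | GRing.zero => env
  | _ => match lin_mem t env with
         | true => env
         | false => constr:(cons t env)
         end
  end.

Ltac zmod_reify env t :=
  lazymatch t with
  | GRing.add ?a ?b =>
      let a := zmod_reify env a in
      let b := zmod_reify env b in constr:(@LAdd int a b)
  | GRing.opp ?a => let a := zmod_reify env a in constr:(@LOpp int a)
  | intmul ?a ?c => let a := zmod_reify env a in constr:(@LScale int c a)
  | GRing.natmul ?a ?c =>
      let a := zmod_reify env a in constr:(@LScale int (Posz c) a)
  | GRing.zero => constr:(@LZero int)
  | _ => let n := lin_index t env in constr:(@LVar int n)
  end.

Ltac zmod_eq :=
  lazymatch goal with
  | |- @eq ?T ?a ?b =>
    let env := zmod_atoms (@nil T) a in
    let env := zmod_atoms env b in
    let ta := zmod_reify env a in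
    let tb := zmod_reify env b in
    change (@linval int (zmodule T) env ta = @linval int (zmodule T) env tb);
    apply: linval_eq; rewrite /=; repeat split
  end.

(** * Representations of sl2 *)

Section SL2.
Variables (K : numFieldType) (M : lmodType K) (e f : M -> M).
(** Read [wt l v] as h v = l v with h = [e, f]. The operator h is never formed: in the applications
    v lies in a root space and l is a Cartan number up to sign. *)
Variable wt : K -> M -> Prop.
Hypotheses (eZ : forall c v, e (c *: v) = c *: e v)
  (fZ : forall c v, f (c *: v) = c *: f v)
  (wt_f : forall l v, wt l v -> wt (l - 2) (f v))
  (wt_ef : forall l v, wt l v -> e (f v) = f (e v) + l *: v).

Lemma wt_iter_f l v k : wt l v -> wt (l - k%:R *+ 2) (iter k f v).
Proof.
move=> wv; elim: k => [|k IHk] /=; first by rewrite mul0rn subr0.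
by have /wt_f := IHk; congr wt; rewrite -natr1; ring.
Qed.

Lemma e_iter_f l v k : wt l v -> e v = 0 ->
  e (iter k.+1 f v) = (k.+1%:R * (l - k%:R)) *: iter k f v.
Proof.
move=> wv ev0; elim: k => [|k IHk].
  by rewrite /= (wt_ef wv) ev0 -[in f 0](scale0r v) fZ scale0r add0r mul1r subr0.
rewrite [iter k.+2 f v]iterS (wt_ef (wt_iter_f k.+1 wv)) IHk fZ -iterS -scalerDl.
by congr (_ *: _); rewrite -!natr1; ring.
Qed.

(** At the first vanishing iterate f^(m+1) v, [e_iter_f] reads 0 = (m+1) (l - m) f^m v with f^m v
    nonzero. *)
Lemma highest_weight_nat l v n : wt l v -> v != 0 -> e v = 0 ->
  iter n f v = 0 ->
  exists m : nat, l = m%:R /\ forall j, (j <= m)%N -> iter j f v != 0.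
Proof.
move=> wv v0 ev0 fn0.
have ex : exists n, iter n f v == 0 by exists n; rewrite fn0.
case: (ex_minnP ex) => [[|m] /eqP fm min]; first by rewrite -fm eqxx in v0.
exists m; split; last first.
  by move=> j le_jm; apply/negP => /min; rewrite leqNgt ltnS le_jm.
have fm0 : iter m f v != 0 by apply/negP => /min; rewrite ltnn.
have := e_iter_f m wv ev0; rewrite fm -[in e 0](scale0r v) eZ scale0r.
move/esym/eqP; rewrite scaler_eq0 (negPf fm0) orbF mulf_eq0 pnatr_eq0 /=.
by rewrite subr_eq0 => /eqP.
Qed.

End SL2.

(** * Root strings modulo isotropic roots *)

(* The root system modulo its isotropic directions V0: N and I are the sets of
   non-isotropic and isotropic roots, cf b a is the Cartan integer <b, a^vee>
   and sq a is the squared length (a, a). *)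
Record affine_roots (K : numFieldType) (X : zmodType) (N I V0 : set X)
    (cf : X -> X -> int) (sq : X -> K) : Prop := AffineRoots {
  ar_cfB : forall a b c, cf (b - c) a = cf b a - cf c a;
  ar_cfaa : forall a, N a -> cf a a = 2;
  ar_cfNr : forall a b, N a -> cf b (- a) = - cf b a;
  ar_NN : forall a, N a -> N (- a);
  ar_IN : forall a, I a -> I (- a);
  ar_V00 : V0 0;
  ar_V0B : forall s t, V0 s -> V0 t -> V0 (s - t);
  ar_V0div : forall s (n : int), n != 0 -> V0 (s *~ n) -> V0 s;
  ar_IV0 : forall s, I s -> V0 s;
  ar_V0cf : forall s a, V0 s -> N a -> cf s a = 0;
  ar_cf0 : forall a b, N a -> N b -> cf a b = 0 -> cf b a = 0;
  ar_string : forall a b (j : nat), N a -> N b \/ I b -> j%:Z <= cf b a ->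
    N (b - a *+ j) \/ I (b - a *+ j);
  ar_refl : forall a b, N a -> N b -> N (b - a *~ cf b a);
  ar_finite : forall r : nat -> X, (forall k, N (r k)) ->
    exists j k, (j < k)%N /\ V0 (r k - r j);
  ar_reduced : forall a b (m : int), N a -> N b -> V0 (a *+ 2 - b *~ m) ->
    m = 2 \/ m = -2;
  ar_sq0 : forall a, N a -> sq a != 0;
  ar_sq_cf : forall a b, N a -> N b ->
    sq b * (cf a b)%:~R = sq a * (cf b a)%:~R;
  ar_sqM : forall a b (k : int), N a -> N b ->
    sq (b + a *~ k) = sq b + k%:~R * (cf b a)%:~R * sq a + k%:~R ^+ 2 * sq a
}.

(** Irreducibility, in the form of an induction principle along nonorthogonal pairs, and rank
    greater than 1. *)
Record irreducible_roots (X : zmodType) (N V0 : set X) (cf : X -> X -> int) :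
    Prop := IrreducibleRoots {
  ir_connected : forall Q : set X, (exists2 a, N a & Q a) ->
    (forall a b, N a -> N b -> Q a -> cf a b <> 0 -> Q b) ->
    forall a, N a -> Q a;
  ir_rank2 : forall a, N a -> exists b, [/\ N b, ~ V0 (b - a) & ~ V0 (b + a)]
}.

Section RootCombinatorics.
Variables (K : numFieldType) (X : zmodType) (N I V0 : set X).
Variables (cf : X -> X -> int) (sq : X -> K).
Hypothesis H : affine_roots N I V0 cf sq.

(** Equality up to sign of the images in X / V0, which for a reduced type is the only
    proportionality between roots. *)
Definition parallel a b := V0 (b - a) \/ V0 (b + a).

Definition refl a b := b - a *~ cf b a.

Let Rt b := N b \/ I b.

Lemma cf0l a : cf 0 a = 0.
Proof. by rewrite -[in LHS](subrr 0) (ar_cfB H) subrr. Qed.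

Lemma cfNl a b : cf (- b) a = - cf b a.
Proof. by rewrite -[- b]sub0r (ar_cfB H) cf0l sub0r. Qed.

Lemma cfDl a b c : cf (b + c) a = cf b a + cf c a.
Proof. by rewrite -{1}[c]opprK (ar_cfB H) cfNl opprK. Qed.

Lemma cfMnl a b (n : nat) : cf (b *+ n) a = cf b a * n%:Z.
Proof.
elim: n => [|n IHn]; first by rewrite mulr0 cf0l.
by rewrite mulrS cfDl IHn intS mulrDr mulr1.
Qed.

Lemma cfMzl a b (n : int) : cf (b *~ n) a = cf b a * n.
Proof.
case: n => n; first by rewrite -pmulrn cfMnl.
by rewrite NegzE mulrNz -pmulrn cfNl cfMnl mulrN.
Qed.

Definition cfE := (ar_cfB H, cfDl, cfNl, cfMnl, cfMzl, cf0l).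

Lemma V0N s : V0 s -> V0 (- s).
Proof. by rewrite -sub0r => Vs; apply: (ar_V0B H) => //; apply: (ar_V00 H). Qed.

Lemma V0D s t : V0 s -> V0 t -> V0 (s + t).
Proof. by move=> Vs Vt; rewrite -[t]opprK; apply: (ar_V0B H) => //; apply: V0N. Qed.

Lemma V0_cf a s t : V0 (s - t) -> N a -> cf s a = cf t a.
Proof.
by move=> Vs Na; apply/eqP; rewrite -subr_eq0 -(ar_cfB H) (ar_V0cf H).
Qed.

Lemma NV0 a : N a -> ~ V0 a.
Proof. by move=> Na /(ar_V0cf H)/(_ Na); rewrite (ar_cfaa H). Qed.

Lemma RtN b : Rt b -> Rt (- b).
Proof. by case=> [/(ar_NN H)|/(ar_IN H)]; [left|right]. Qed.

Lemma Rt_notV0 b : Rt b -> ~ V0 b -> N b.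
Proof. by case=> // /(ar_IV0 H). Qed.

Lemma parallel_sym a b : parallel a b -> parallel b a.
Proof.
case=> [/V0N|V]; first by rewrite opprB; left.
by right; rewrite addrC.
Qed.

Lemma parallel_trans a b c : parallel a b -> parallel b c -> parallel a c.
Proof.
move=> [Vab|Vab] [Vbc|Vbc].
- by left; move: (V0D Vbc Vab); rewrite addrA subrK.
- by right; move: (ar_V0B H Vbc Vab); congr V0; zmod_eq; ring.
- by right; move: (V0D Vbc Vab); rewrite addrA subrK.
- by left; move: (ar_V0B H Vbc Vab); congr V0; zmod_eq; ring.
Qed.

Lemma parallelNr a b : parallel a (- b) <-> parallel a b.
Proof.
have D c : parallel a c -> parallel a (- c).
  by case=> /V0N; rewrite opprD ?opprK; [right|left].
by split=> /D; rewrite ?opprK.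
Qed.

Lemma parallelNl a b : parallel (- a) b <-> parallel a b.
Proof.
by split=> /parallel_sym/parallelNr/parallel_sym.
Qed.

Lemma parallel_V0 a b s : V0 s -> parallel a (b + s) <-> parallel a b.
Proof.
have D c t : V0 t -> parallel a c -> parallel a (c + t).
  by move=> Vt [V|V]; [left|right]; rewrite addrAC; apply: V0D.
move=> Vs; split=> [/(D _ _ (V0N Vs))|/(D _ _ Vs)//].
by rewrite addrK.
Qed.

Lemma cf_refl a b : N a -> cf (refl a b) a = - cf b a.
Proof. by move=> Na; rewrite /refl !cfE (ar_cfaa H) //; lia. Qed.

Lemma reflK a b : N a -> refl a (refl a b) = b.
Proof. by move=> Na; rewrite {1}/refl cf_refl // mulrNz opprK /refl subrK. Qed.

Lemma reflN a b : refl a (- b) = - refl a b.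
Proof. by rewrite /refl cfNl mulrNz opprK opprD opprK. Qed.

Lemma reflD a b c : refl a (b + c) = refl a b + refl a c.
Proof. by rewrite /refl cfDl mulrzDr opprD addrACA. Qed.

Lemma refl_V0 a s : N a -> V0 s -> refl a s = s.
Proof. by move=> Na Vs; rewrite /refl (ar_V0cf H) // mulr0z subr0. Qed.

Lemma refl_span a b (u v : int) : N a -> N b ->
  refl a (refl b (a *~ u + b *~ v)) =
  a *~ ((cf b a * cf a b - 1) * u + cf b a * v) + b *~ (- (cf a b * u) - v).
Proof.
move=> Na Nb; rewrite /refl !cfE !(ar_cfaa H) //.
set n := cf b a; set m := cf a b.
zmod_eq; ring.
Qed.

Lemma iter_refl_N a b c k : N a -> N b -> N c ->
  N (iter k (fun x => refl a (refl b x)) c).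
Proof.
by move=> Na Nb Nc; elim: k => //= k IHk; apply: (ar_refl H) => //; apply: (ar_refl H).
Qed.

(* If <b, a^vee><a, b^vee> is not in 0..4, then (w_a w_b)^k a takes infinitely many
   values modulo V0. *)
Lemma cf_growth a b (S : rel int) : N a -> N b -> S 1 2 ->
  (forall u p : int, S u p ->
    let t := cf b a * cf a b in
    S (p + (t - 3) * u) (p + (t - 4) * u) /\ `|p| < `|p + (t - 4) * u|) ->
  False.
Proof.
move=> Na Nb S0 Sstep.
(* With x k = u a + v b, the pair followed is (u, p), where p = <x k, a^vee>. Since p depends only
   on x k modulo V0, its strict growth contradicts [ar_finite]. *)
pose x k := iter k (fun x => refl a (refl b x)) a.
have xP k : exists u v : int, x k = a *~ u + b *~ v /\ S u (2 * u + cf b a * v).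
  elim: k => [|k [u [v [xk Suv]]]].
    by exists 1, 0; rewrite mulr0z addr0 mulr1 mulr0 addr0.
  exists ((cf b a * cf a b - 1) * u + cf b a * v), (- (cf a b * u) - v).
  rewrite /= -refl_span // -xk; split=> //.
  by have [+ _] := Sstep _ _ Suv; congr (is_true (S _ _)); ring.
have inc k : `|cf (x k) a| < `|cf (x k.+1) a|.
  have [u [v [xk Suv]]] := xP k; have [_] := Sstep _ _ Suv.
  rewrite {2}/x iterS -/(x k) xk refl_span // !cfE (ar_cfaa H) //.
  by congr (is_true (`|_| < `|_|)); ring.
have [j [k [lt_jk /V0_cf/(_ Na) eq_cf]]] :=
  ar_finite H (fun k => iter_refl_N k Na Nb Na).
have := homo_ltn (@lt_trans _ _) inc lt_jk.
by rewrite /x eq_cf ltxx.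
Qed.

Lemma cf_mul_range a b : N a -> N b -> 0 <= cf b a * cf a b <= 4.
Proof.
move=> Na Nb; apply/andP; split; rewrite leNgt; apply/negP => lt_t.
  (* For t < 0 the pair (u, p) stays in this double cone and changes sign at each step; for t > 4,
     treated next, both coordinates stay positive. *)
  apply: (cf_growth (S := fun u p => ((0 < p) && (p <= 2 * u)) || (2 * u <= p < 0)) Na Nb).
    by [].
  move: (_ * _) lt_t => t lt_t u p Sup /=; rewrite !mulrBl.
  case/orP: Sup => Sup.
    have : t * u <= - u by nia.
    by move: (t * u) => w; split; lia.
  have : t * u >= - u by nia.
  by move: (t * u) => w; split; lia.
apply: (cf_growth (S := fun u p => (0 < p) && (0 < u)) Na Nb) => //.
move: (_ * _) lt_t => t lt_t u p Sup /=; rewrite !mulrBl.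
have : t * u >= 5 * u by nia.
by move: (t * u) => w; split; lia.
Qed.

(** When the product is 4, each application of w_a w_b adds the same vector rho to the orbit of a.
    Finiteness modulo V0 puts a nonzero multiple of rho in V0, hence rho itself. *)
Lemma cf_mul4 a b : N a -> N b -> cf b a * cf a b = 4 ->
  V0 (a *+ 2 - b *~ cf a b).
Proof.
move=> Na Nb nm4; set rho := _ - _.
have iterE k : iter k (fun x => refl a (refl b x)) a = a + rho *+ k.
  elim: k => [|k IHk] /=; first by rewrite addr0.
  have E : a + rho *+ k = a *~ (1 + 2 * k%:Z) + b *~ (- (cf a b * k%:Z)).
    by rewrite /rho; zmod_eq; ring.
  by rewrite IHk E refl_span // nm4 /rho; zmod_eq; move: nm4; nia.
have [j [k [lt_jk]]] := ar_finite H (fun k => iter_refl_N k Na Nb Na).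
rewrite !iterE opprD addrACA subrr add0r -mulrnBr 1?ltnW // pmulrn.
by apply: (ar_V0div H); rewrite -lt0n subn_gt0.
Qed.

(** The Cartan pairs of two nonproportional roots of a finite root system: both 0, or of the same
    sign with product 1, 2 or 3. Bounds are used so that [lia] can split the cases. *)
Definition nonparallel_cf (n m : int) :=
  [|| (n == 0) && (m == 0),
      [&& (n == 1) || (m == 1), 1 <= n <= 3 & 1 <= m <= 3]
    | [&& (n == -1) || (m == -1), -3 <= n <= -1 & -3 <= m <= -1]].

Lemma parallel_cf a b : N a -> N b -> parallel a b ->
  (V0 (b - a) /\ cf b a = 2) \/ (V0 (b + a) /\ cf b a = -2).
Proof.
move=> Na Nb [V|V]; [left|right]; split=> //.
  by rewrite (V0_cf V Na) (ar_cfaa H).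
by rewrite -[a in V0 (_ + a)]opprK in V; rewrite (V0_cf V Na) cfNl (ar_cfaa H).
Qed.

Lemma cf_cases a b : N a -> N b ->
  parallel a b \/ nonparallel_cf (cf b a) (cf a b).
Proof.
move=> Na Nb; have [t0 t4] := andP (cf_mul_range Na Nb).
have [nm4|nm4] := eqVneq (cf b a * cf a b) 4.
  left; have V := cf_mul4 Na Nb nm4.
  case: (ar_reduced H Na Nb V) => m; rewrite m in V; [left|right].
    apply: (ar_V0div H (n := -2)) => //.
    by move: V; congr V0; zmod_eq; ring.
  apply: (ar_V0div H (n := 2)) => //.
  by move: V; congr V0; zmod_eq; ring.
right; rewrite /nonparallel_cf.
have [n0|n0] := eqVneq (cf b a) 0.
  by rewrite (ar_cf0 H Nb Na n0).
have m0 : cf a b != 0.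
  by apply: contra_neq n0 => m0; rewrite (ar_cf0 H Na Nb m0).
by move: (cf b a) (cf a b) n0 m0 t0 t4 nm4 => n m; nia.
Qed.

Lemma nonparallelP a b : N a -> N b -> ~ parallel a b ->
  nonparallel_cf (cf b a) (cf a b).
Proof. by move=> Na Nb np; have [] := cf_cases Na Nb. Qed.

Lemma cf_nonparallel a b : N a -> N b -> -1 <= cf b a <= 1 -> ~ parallel a b.
Proof. by move=> Na Nb le_cf /(parallel_cf Na Nb)[] [_]; lia. Qed.

Lemma cf_bound a b : N a -> Rt b -> -3 <= cf b a <= 3.
Proof.
move=> Na [Nb|Ib]; last by rewrite (ar_V0cf H (ar_IV0 H Ib) Na).
have [|] := cf_cases Na Nb; last by rewrite /nonparallel_cf; lia.
by case/(parallel_cf Na Nb) => [] [_ ->].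
Qed.

Lemma string_up a b (j : nat) : N a -> Rt b -> j%:Z <= - cf b a ->
  Rt (b + a *+ j).
Proof.
move=> Na Rb le_j; rewrite -[a]opprK mulNrn.
by apply: (ar_string H) => //; [apply: (ar_NN H) | rewrite (ar_cfNr H)].
Qed.

Lemma RtD a b : N a -> Rt b -> cf b a < 0 -> Rt (b + a).
Proof. by move=> Na Rb lt0; apply: (@string_up a b 1) => //; lia. Qed.

Lemma RtB a b : N a -> Rt b -> 0 < cf b a -> Rt (b - a).
Proof. by move=> Na Rb lt0; apply: (ar_string H (j := 1)) => //; lia. Qed.

(** If b + k a were in V0, then <b, a^vee> = -2 k; the bound 3 leaves k = 0, 1, -1, that is, b in V0
    or b parallel to a. *)
Lemma nonparallel_V0 a b (k : int) : N a -> N b -> ~ parallel a b ->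
  ~ V0 (b + a *~ k).
Proof.
move=> Na Nb np V; have := cf_bound Na (or_introl Nb).
have -> : cf b a = - (2 * k).
  apply/eqP; rewrite -addr_eq0; apply/eqP; rewrite -(ar_V0cf H V Na).
  by rewrite !cfE (ar_cfaa H) //; lia.
move=> bd; have : [|| k == 0, k == 1 | k == -1] by lia.
case/or3P => /eqP kE; rewrite kE in V.
- by apply: (NV0 Nb); move: V; rewrite mulr0z addr0.
- by apply: np; right.
- by apply: np; left; move: V; rewrite mulrNz.
Qed.

Lemma nonparallelD a b (k : int) : N a -> N b -> ~ parallel a b ->
  Rt (b + a *~ k) -> N (b + a *~ k) /\ ~ parallel a (b + a *~ k).
Proof.
move=> Na Nb np Rbk; split.
  by apply: Rt_notV0 => //; apply: nonparallel_V0.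
case=> V.
  apply: (nonparallel_V0 (k := k - 1) Na Nb np).
  by move: V; congr V0; zmod_eq; ring.
apply: (nonparallel_V0 (k := k + 1) Na Nb np).
by move: V; congr V0; zmod_eq; ring.
Qed.

(** Coordinates of c in its a-string: b is the bottom, c is r steps above it, and the reflection in
    a exchanges r and p - r. All comparisons of structure constants start from these data. *)
Lemma string_bottom a c : N a -> N c -> exists b (r p : nat),
  [/\ N b, ~ Rt (b - a) & cf b a = - p%:Z] /\
  [/\ c = b + a *+ r, (r <= p <= 3)%N & refl a c = b + a *+ (p - r)].
Proof.
move=> Na Nc.
have ex : exists r, `[< Rt (c - a *+ r) >].
  by exists 0; apply/asboolP; left; rewrite mulr0n subr0.
have bnd r : `[< Rt (c - a *+ r) >] -> (r <= 3)%N.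
  move=> /asboolP/(cf_bound Na); rewrite !cfE (ar_cfaa H) //.
  by have := cf_bound Na (or_introl Nc); lia.
case: (ex_maxnP ex bnd) => r /asboolP Rb max.
have notR j : (r < j)%N -> ~ Rt (c - a *+ j).
  by move=> lt_rj /asboolP/max; rewrite leqNgt lt_rj.
set b := c - a *+ r in Rb.
have cE : c = b + a *+ r by rewrite subrK.
have notRb : ~ Rt (b - a).
  by rewrite /b -addrA -opprD -mulrSr; apply: notR.
have le0 : cf b a <= 0.
  by rewrite leNgt; apply/negP => /(RtB Na Rb).
have cfb : cf b a = cf c a - r%:Z * 2 by rewrite /b !cfE (ar_cfaa H) //; lia.
have := cf_bound Na Rb; have Nrc := ar_refl H Na Nc.
have le_rp : r%:Z <= - cf b a.
  (* If r exceeded -<b, a^vee>, then <c, a^vee> > r and the reflected root w_a c would lie below the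
     bottom b. *)
  rewrite leNgt; apply/negP => lt; apply: (notR `|cf c a|%N); first by lia.
  left; move: Nrc; congr N; congr (_ - _); rewrite pmulrn; congr (_ *~ _); lia.
have Nb : N b.
  case: Rb => // Ib; have cfb0 := ar_V0cf H (ar_IV0 H Ib) Na.
  have r0 : r = 0%N by lia.
  by move: Nc; rewrite cE r0 addr0.
move=> bd; exists b, r, `|cf b a|%N; split; split=> //; try lia.
move: cfb le_rp; move: (cf b a) => q cfb le_rp; rewrite /refl /b; zmod_eq; lia.
Qed.

Lemma cf_parallel a b c : parallel a b -> N c ->
  cf b c = cf a c \/ cf b c = - cf a c.
Proof.
case=> V Nc; [left|right]; first exact: V0_cf.
by rewrite -cfNl; apply: V0_cf => //; rewrite opprK.
Qed.

(** If w_g a = a modulo V0, then g is in V0; if w_g a = -a, then 2 a = <a, g^vee> g modulo V0 and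
    the product of the two Cartan integers is 4. *)
Lemma parallel_refl a g : N a -> N g -> ~ parallel a g -> cf a g <> 0 ->
  ~ parallel a (refl g a).
Proof.
move=> Na Ng np n0 [V|V].
  apply: (NV0 Ng); apply: (ar_V0div H (n := - cf a g)); first by lia.
  by move: V; congr V0; rewrite /refl; zmod_eq; ring.
have := ar_V0cf H V Na; rewrite /refl !cfE (ar_cfaa H) //.
have := nonparallelP Na Ng np; rewrite /nonparallel_cf.
by move: (cf a g) (cf g a) n0 => n m; nia.
Qed.

Lemma sq_parallel a b : N a -> N b -> V0 (b - a) -> sq b = sq a.
Proof.
move=> Na Nb V; have := ar_sq_cf H Na Nb; rewrite (V0_cf V Na) (ar_cfaa H) //.
rewrite -(V0_cf V Nb) (ar_cfaa H) //.
by apply: mulIf; rewrite pnatr_eq0.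
Qed.

(** [cf] is additive in its first argument only; the second is exchanged with the first by
    [ar_sq_cf], and [sq] is constant on classes modulo V0. *)
Lemma cf_V0r a b s : N a -> N b -> V0 s -> N (b + s) -> cf a (b + s) = cf a b.
Proof.
move=> Na Nb Vs Nbs; have V : V0 (b + s - b) by rewrite addrC addKr.
have E := sq_parallel Nb Nbs V.
have := ar_sq_cf H Na Nbs; rewrite E (V0_cf V Na) -(ar_sq_cf H Na Nb).
by move/(mulfI (ar_sq0 H Nb))/intr_inj.
Qed.

Lemma sq_refl a b : N a -> N b -> sq (refl a b) = sq b.
Proof.
move=> Na Nb; rewrite /refl -mulrNz (ar_sqM H) // mulrNz.
ring.
Qed.

(** Again the second argument is reached through squared lengths, which reflections preserve; the
    equation is checked after multiplication by [sq b]. *)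
Lemma cf_refl2 g a b : N g -> N a -> N b -> cf (refl g a) (refl g b) = cf a b.
Proof.
move=> Ng Na Nb; have Nwb := ar_refl H Ng Nb.
have E1 := ar_sq_cf H Na Nwb; have E2 := ar_sq_cf H Ng Nwb.
have E3 := ar_sq_cf H Na Nb; have E4 := ar_sq_cf H Ng Na.
have E5 := ar_sq_cf H Ng Nb.
have := sq_refl Ng Nb; rewrite /refl in E1 E2 * => sqE.
rewrite sqE in E1 E2; apply: (@intr_inj K); apply: (mulfI (ar_sq0 H Nb)).
rewrite !cfE !(intrB, intrM) mulrBr E1 [sq b * (_ * _)]mulrA E2 E3.
rewrite !cfE !(intrB, intrM) (ar_cfaa H) //; apply/eqP; rewrite -subr_eq0.
have <- : (sq g * (cf a g)%:~R - sq a * (cf g a)%:~R) * (cf b g)%:~R = 0 :> K.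
  by rewrite E4 subrr mul0r.
by apply/eqP; ring.
Qed.

Hypothesis H2 : irreducible_roots N V0 cf.

(** Without such a g, parallelism to a would spread along nonorthogonal pairs to all roots, against
    rank greater than 1. *)
Lemma exists_partner a : N a -> exists g, [/\ N g, ~ parallel a g & cf a g <> 0].
Proof.
move=> Na; apply: contrapT => noP.
have all_par : forall b, N b -> parallel a b.
  apply: (ir_connected H2); first by exists a => //; left; rewrite subrr; apply: ar_V00 H.
  move=> b c Nb Nc par_ab n0; apply: contrapT => np; apply: noP.
  by exists c; split=> // a0; case: (cf_parallel par_ab Nc); rewrite a0 ?oppr0.
by have [b [Nb nb nb']] := ir_rank2 H2 Na; case: (all_par b Nb).
Qed.

End RootCombinatorics.

(** * Chevalley systems *)

(** The decomposition into root spaces enters as the induction [gl_rs_ind] that it permits. *)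
Record graded_lie (K : numFieldType) (X : zmodType) (Rt : set X)
    (L : lmodType K) (br : L -> L -> L) (form : L -> L -> K)
    (rs : X -> set L) : Prop := GradedLie {
  gl_brDl : forall x y z, br (x + y) z = br x z + br y z;
  gl_brDr : forall x y z, br x (y + z) = br x y + br x z;
  gl_brZl : forall c x y, br (c *: x) y = c *: br x y;
  gl_brZr : forall c x y, br x (c *: y) = c *: br x y;
  gl_brxx : forall x, br x x = 0;
  gl_jacobi : forall x y z, br x (br y z) = br (br x y) z + br y (br x z);
  gl_formZl : forall c x y, form (c *: x) y = c * form x y;
  gl_formZr : forall c x y, form x (c *: y) = c * form x y;
  gl_form_inv : forall x y z, form (br x y) z = form x (br y z);
  gl_rs_br : forall a b x y, rs a x -> rs b y -> rs (a + b) (br x y);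
  gl_rs_root : forall a x, rs a x -> ~ Rt a -> x = 0;
  gl_rs_ind : forall P : set L, P 0 -> (forall x y, P x -> P y -> P (x + y)) ->
    (forall a x, rs a x -> P x) -> forall x, P x
}.

(* A Chevalley system x of a Chevalley involution tau, extended by 0 outside of
   the non-isotropic roots; core is a subalgebra on which tau is defined. *)
Record chevalley_data (K : numFieldType) (X : zmodType) (N : set X)
    (cf : X -> X -> int) (sq : X -> K) (L : lmodType K) (br : L -> L -> L)
    (form : L -> L -> K) (rs : X -> set L) (core : set L) (tau : L -> L)
    (x : X -> L) : Prop := ChevalleyData {
  cd_rs : forall a, rs a (x a);
  cd_out : forall a, ~ N a -> x a = 0;
  cd_span : forall a y, N a -> rs a y -> exists c, y = c *: x a;
  cd_coroot : forall a b y, N a -> rs b y ->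
    br (br (x a) (x (- a))) y = (cf b a)%:~R *: y;
  cd_form : forall a, N a -> sq a * form (x a) (x (- a)) = 2;
  cd_core : forall a, core (x a);
  cd_core_br : forall y z, core y -> core z -> core (br y z);
  cd_tauZ : forall c y, core y -> tau (c *: y) = c *: tau y;
  cd_tau_br : forall y z, core y -> core z -> tau (br y z) = br (tau y) (tau z);
  cd_tau : forall a, tau (x a) = - x (- a)
}.

Section Chevalley.
Variables (K : numFieldType) (X : zmodType) (N I V0 : set X).
Variables (cf : X -> X -> int) (sq : X -> K).
Hypothesis H : affine_roots N I V0 cf sq.
Let Rt b := N b \/ I b.
Variables (L : lmodType K) (br : L -> L -> L) (form : L -> L -> K).
Variables (rs : X -> set L) (core : set L) (tau : L -> L) (x : X -> L).
Hypothesis G : graded_lie Rt br form rs.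
Hypothesis C : chevalley_data N cf sq br form rs core tau x.

Lemma br0l y : br 0 y = 0.
Proof. by rewrite -{1}(scale0r (0 : L)) (gl_brZl G) scale0r. Qed.

Lemma br0r y : br y 0 = 0.
Proof. by rewrite -{1}(scale0r (0 : L)) (gl_brZr G) scale0r. Qed.

Lemma brNl y z : br (- y) z = - br y z.
Proof. by rewrite -scaleN1r (gl_brZl G) scaleN1r. Qed.

Lemma brNr y z : br y (- z) = - br y z.
Proof. by rewrite -scaleN1r (gl_brZr G) scaleN1r. Qed.

Lemma br_anti y z : br y z = - br z y.
Proof.
apply/eqP; rewrite -addr_eq0; apply/eqP; have := gl_brxx G (y + z).
by rewrite (gl_brDl G) !(gl_brDr G) !(gl_brxx G) add0r addr0.
Qed.

Lemma x_neq0 a : N a -> x a != 0.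
Proof.
move=> Na; apply/negP => /eqP xa0; have := cd_form C Na.
rewrite xa0 -(scale0r (0 : L)) (gl_formZl G) mul0r mulr0 => /esym/eqP.
by rewrite pnatr_eq0.
Qed.

Lemma rs_sub a b y : rs a y -> a = b -> rs b y.
Proof. by move=> ? <-. Qed.

(** * Structure constants along a root string *)

Section String.
Variables (a b : X) (p : nat).
Hypotheses (Na : N a) (Nb : N b) (bottom : ~ Rt (b - a)) (cfb : cf b a = - p%:Z).

Let e := br (x a).
Let f := br (x (- a)).
Let v k := iter k e (x b).
Let u k := iter k f (x (- b)).

Lemma rs_v k : rs (b + a *+ k) (v k).
Proof.
elim: k => [|k IHk]; first by rewrite addr0; apply: (cd_rs C).
apply: rs_sub (gl_rs_br G (cd_rs C a) IHk) _; zmod_eq; lia.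
Qed.

Lemma ef_wt c y : rs c y -> e (f y) = f (e y) + (cf c a)%:~R *: y.
Proof.
by move=> rcy; rewrite /e (gl_jacobi G) (cd_coroot C Na rcy) addrC.
Qed.

(** This is [e_iter_f] with the two operators exchanged: x b is killed by ad x (-a) because b - a is
    not a root, and the weights change sign. *)
Lemma f_v k : f (v k.+1) = (k.+1%:R * (p%:R - k%:R)) *: v k.
Proof.
pose wt (l : K) y := exists2 c, rs c y & l = - (cf c a)%:~R.
have fZ z y : e (z *: y) = z *: e y by rewrite /e (gl_brZr G).
have wt_f l y : wt l y -> wt (l - 2) (e y).
  case=> c rcy ->; exists (a + c); first exact: (gl_rs_br G (cd_rs C a)).
  by rewrite (cfDl H) (ar_cfaa H) // intrD; ring.
have wt_ef l y : wt l y -> f (e y) = e (f y) + l *: y.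
  by case=> c rcy ->; rewrite (ef_wt rcy) scaleNr addrK.
apply: (e_iter_f fZ wt_f wt_ef _ _).
  by exists b; [apply: (cd_rs C) | rewrite cfb mulrNz opprK].
apply: (gl_rs_root G (gl_rs_br G (cd_rs C (- a)) (cd_rs C b))).
by rewrite addrC.
Qed.

Lemma e_u k : e (u k.+1) = (k.+1%:R * (p%:R - k%:R)) *: u k.
Proof.
pose wt (l : K) y := exists2 c, rs c y & l = (cf c a)%:~R.
have fZ z y : f (z *: y) = z *: f y by rewrite /f (gl_brZr G).
have wt_f l y : wt l y -> wt (l - 2) (f y).
  case=> c rcy ->; exists (- a + c); first exact: (gl_rs_br G (cd_rs C (- a))).
  by rewrite !(cfE H) (ar_cfaa H) // intrD; ring.
have wt_ef l y : wt l y -> e (f y) = f (e y) + l *: y.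
  by case=> c rcy ->; apply: ef_wt.
apply: (e_iter_f fZ wt_f wt_ef _ _).
  by exists (- b); [apply: (cd_rs C) | rewrite (cfNl H) cfb opprK].
apply: (gl_rs_root G (gl_rs_br G (cd_rs C a) (cd_rs C (- b)))).
by move=> /(RtN H); rewrite opprD opprK addrC.
Qed.

Lemma core_v k : core (v k).
Proof.
by elim: k => [|k IHk] /=; [apply: (cd_core C) | apply: (cd_core_br C (cd_core C a))].
Qed.

Lemma tau_v k : tau (v k) = (-1) ^+ k.+1 *: u k.
Proof.
elim: k => [|k IHk]; first by rewrite expr1 scaleN1r; apply: (cd_tau C).
rewrite [v k.+1]/(e (v k)) (cd_tau_br C (cd_core C a) (core_v k)) (cd_tau C) IHk.
by rewrite brNl (gl_brZr G) [in RHS]exprS -scaleN1r scalerA.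
Qed.

(** Invariance moves one ad x a across the form, at the cost of a sign, onto u (k+1), where [e_u]
    applies. *)
Lemma form_vu k : form (v k) (u k) =
  (-1) ^+ k * (\prod_(j < k) (j.+1%:R * (p%:R - j%:R))) * form (x b) (x (- b)).
Proof.
elim: k => [|k IHk]; first by rewrite big_ord0 !mul1r.
have -> : v k.+1 = - br (v k) (x a) by apply: br_anti.
rewrite -scaleN1r (gl_formZl G) (gl_form_inv G).
by rewrite -/(e (u k.+1)) e_u (gl_formZr G) IHk big_ord_recr exprS /=; ring.
Qed.

Lemma string_length k : (k <= p)%N -> N (b + a *+ k) ->
  \prod_(j < k) (j.+1%:R * (p%:R - j%:R)) * sq (b + a *+ k) =
  k`!%:R ^+ 2 * sq b.
Proof.
move=> le_kp Nc; rewrite pmulrn (ar_sqM H _ Na Nb) cfb.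
have p3 : (p <= 3)%N by have := cf_bound H Na (or_introl Nb); lia.
(* An interior root of the string forces p >= 2 and b not parallel to a, so the other Cartan integer
   is -1. *)
have sqb : (0 < k < p)%N -> sq b = p%:R * sq a.
  move=> kp; case: (cf_cases H Na Nb) => [par|].
    case: (parallel_cf H Na Nb par) => -[V cf2]; first by lia.
    have k1 : k = 1%N by lia.
    by case: (NV0 H Nc); rewrite k1.
  rewrite /nonparallel_cf cfb => cfs.
  have m1 : cf a b = -1 by lia.
  have := ar_sq_cf H Na Nb; rewrite m1 cfb !mulrNz mulrN1 => /eqP.
  by rewrite mulrN eqr_opp mulrC => /eqP.
move: sqb le_kp p3; case: (p) => [|[|[|[|//]]]]; case: (k) => [|[|[|[|//]]]] // sqb _ _;
  rewrite ?big_ord0 ?big_ord_recr ?big_ord_recr ?big_ord_recr ?big_ord0 /=;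
  try (rewrite sqb; last by []); rewrite ?factS ?fact0 /=; ring.
Qed.

(* The square of the coefficient is found by computing (v, tau v) in two ways. *)
Lemma string_sign k : (k <= p)%N -> N (b + a *+ k) ->
  exists s : bool, v k = ((-1) ^+ s * k`!%:R) *: x (b + a *+ k).
Proof.
move=> le_kp Nc; set c := b + a *+ k.
have [z vE] := cd_span C Nc (rs_v k).
have uE : u k = ((-1) ^+ k * z) *: x (- c).
  have := tau_v k; rewrite vE (cd_tauZ C _ (cd_core C _)) (cd_tau C) => E.
  rewrite -[LHS](signrZK k.+1) -E !scalerN scalerA exprS.
  by rewrite mulN1r mulNr scaleNr opprK.
have := form_vu k; rewrite vE uE (gl_formZl G) (gl_formZr G).
have := string_length le_kp Nc; have := cd_form C Nc; have := cd_form C Nb.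
have := ar_sq0 H Nb; have := ar_sq0 H Nc.
rewrite -/c; set P := \prod_(j < k) _.
move: (sq c) (sq b) (form _ _) (form _ _) P => sc sb Fc Fb P sc0 sb0 Fb2 Fc2 PE E.
have zz : z ^+ 2 = (k`!%:R) ^+ 2.
  have {}E : z ^+ 2 * Fc = P * Fb.
    by apply: (can_inj (signrMK k)); rewrite mulrA -E; ring.
  have two0 : 2 != 0 :> K by rewrite pnatr_eq0.
  apply: (mulfI sb0); apply: (mulIf two0).
  transitivity (z ^+ 2 * Fc * (sb * sc)); first by rewrite -Fc2; ring.
  rewrite E; transitivity (P * sc * (sb * Fb)); first ring.
  by rewrite PE Fb2; ring.
have /eqP := zz; rewrite eqf_sqr => /orP[]/eqP ->; [exists false|exists true].
  by rewrite mul1r.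
by rewrite mulN1r.
Qed.

End String.

(** The exponential series cut after degree 3. For ad x a with a in N it is the whole series, the
    fourth power being 0 by [ad4]. *)
Definition exp3 (D : L -> L) (y : L) :=
  y + D y + 2^-1 *: D (D y) + 6^-1 *: D (D (D y)).

Section Exponential.
Variable D : L -> L.
Hypotheses (D_D : forall y z, D (y + z) = D y + D z)
  (DZ : forall c y, D (c *: y) = c *: D y)
  (D_br : forall y z, D (br y z) = br (D y) z + br y (D z))
  (D4 : forall y, D (D (D (D y))) = 0).

Lemma exp3_br y z : exp3 D (br y z) = br (exp3 D y) (exp3 D z).
Proof.
have E u v : 4 *: br (D (D (D u))) (D v) + 6 *: br (D (D u)) (D (D v)) +
    4 *: br (D u) (D (D (D v))) = 0.
  have := D4 (br u v); rewrite !(D_br, D_D) !D4 br0l br0r.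
  move=> <-; lin_eq K; ring.
have E1 := E y z; have E2 := E (D y) z; have E3 := E y (D z).
have E4 := E (D y) (D z).
rewrite !D4 !br0l !br0r scaler0 ?add0r ?addr0 in E2 E3 E4.
(* The surplus terms of degree 4, 5 and 6 in the product are 1/24 E1, 1/120 (E2 + E3) and 1/216 E4,
   all of them 0 by the Leibniz expansion of D^4. *)
rewrite -[RHS]addr0 -[X in _ + X](scaler0 L (- 24^-1)) -E1.
rewrite -[RHS]addr0 -[X in _ + X](scaler0 L (- 120^-1)) -E2.
rewrite -[RHS]addr0 -[X in _ + X](scaler0 L (- 120^-1)) -E3.
rewrite -[RHS]addr0 -[X in _ + X](scaler0 L (- 216^-1)) -E4 /exp3.
rewrite !(gl_brDl G, gl_brDr G, gl_brZl G, gl_brZr G, D_br, D_D).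
by lin_eq K; field.
Qed.

Lemma exp3Z c y : exp3 D (c *: y) = c *: exp3 D y.
Proof. by rewrite /exp3 !DZ; lin_eq K; ring. Qed.

Lemma exp3D y z : exp3 D (y + z) = exp3 D y + exp3 D z.
Proof. by rewrite /exp3 !D_D; lin_eq K; ring. Qed.

End Exponential.

(** Four steps raise the pairing with a^vee by 8, while its values on roots lie between -3 and 3. *)
Lemma ad4 a y : N a -> br (x a) (br (x a) (br (x a) (br (x a) y))) = 0.
Proof.
move=> Na; move: y; apply: (gl_rs_ind G); first by rewrite !br0r.
  by move=> y z Ey Ez; rewrite !(gl_brDr G) Ey Ez addr0.
move=> b y rby; have [Rb|nRb] := pselect (Rt b); last first.
  by rewrite (gl_rs_root G rby nRb) !br0r.
have rs4 := gl_rs_br G (cd_rs C a) (gl_rs_br G (cd_rs C a)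
  (gl_rs_br G (cd_rs C a) (gl_rs_br G (cd_rs C a) rby))).
apply: (gl_rs_root G rs4) => /(cf_bound H Na).
by have := cf_bound H Na Rb; rewrite !(cfDl H) (ar_cfaa H) //; lia.
Qed.

(* The action of the simple reflection [0, 1; -1, 0] of SL2. *)
Definition weyl_lift a (y : L) :=
  exp3 (br (x a)) (exp3 (br (- x (- a))) (exp3 (br (x a)) y)).

Lemma weyl_liftZ a c y : weyl_lift a (c *: y) = c *: weyl_lift a y.
Proof.
by rewrite /weyl_lift !exp3Z // => d z; rewrite (gl_brZr G).
Qed.

Lemma weyl_lift_br a y z : N a ->
  weyl_lift a (br y z) = br (weyl_lift a y) (weyl_lift a z).
Proof.
move=> Na; rewrite /weyl_lift !exp3_br //.
- exact: (gl_brDr G).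
- exact: (gl_jacobi G).
- by move=> u; apply: ad4.
- exact: (gl_brDr G).
- exact: (gl_jacobi G).
- by move=> u; rewrite !brNl !brNr !opprK ad4 //; apply: (ar_NN H).
- exact: (gl_brDr G).
- exact: (gl_jacobi G).
- by move=> u; apply: ad4.
Qed.

(** The weight 0 part splits into the trivial and the adjoint components for the sl2 of a. There f e
    acts by 0 and 2, and the lift by 1 and -1, so the lift is 1 - f e. *)
Lemma weyl_lift_iso a s y : N a -> V0 s -> rs s y ->
  weyl_lift a y = y - br (x (- a)) (br (x a) y).
Proof.
move=> Na Vs rsy; set e := br (x a); set f := br (x (- a)).
have ey := gl_rs_br G (cd_rs C a) rsy; have fy := gl_rs_br G (cd_rs C (- a)) rsy.
have eey : e (e y) = 0.
  apply: (gl_rs_root G (gl_rs_br G (cd_rs C a) ey)) => /(cf_bound H Na).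
  by rewrite !(cfE H) (ar_cfaa H) // (ar_V0cf H Vs Na).
have ffy : f (f y) = 0.
  apply: (gl_rs_root G (gl_rs_br G (cd_rs C (- a)) fy)) => /(cf_bound H Na).
  by rewrite !(cfE H) (ar_cfaa H) // (ar_V0cf H Vs Na).
have efy : e (f y) = f (e y).
  by rewrite /e /f (ef_wt Na rsy) (ar_V0cf H) // scale0r addr0.
have e0 : e 0 = 0 by apply: br0r.
have f0 : f 0 = 0 by apply: br0r.
have efey : e (f (e y)) = 2 *: e y.
  rewrite /e /f (ef_wt Na ey) -/e -/f eey f0 add0r.
  by rewrite !(cfE H) (ar_cfaa H) // (ar_V0cf H Vs Na).
have ffey : f (f (e y)) = 2 *: f y.
  have := ef_wt Na fy; rewrite -/e -/f -/(f y) ffy e0 efy.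
  rewrite !(cfE H) (ar_cfaa H) // (ar_V0cf H Vs Na) => E.
  by rewrite -[RHS]add0r E; lin_eq K; ring.
have fD u v : br (- x (- a)) (u + v) = - f u - f v.
  by rewrite brNl (gl_brDr G) opprD.
have eD u v : e (u + v) = e u + e v by apply: (gl_brDr G).
have eZ c u : e (c *: u) = c *: e u by apply: (gl_brZr G).
have fZ c u : f (c *: u) = c *: f u by apply: (gl_brZr G).
have fN u : f (- u) = - f u by apply: brNr.
have eN u : e (- u) = - e u by apply: brNr.
have -> : weyl_lift a y = exp3 e (exp3 (br (- x (- a))) (y + e y)).
  rewrite /weyl_lift; congr (exp3 _ (exp3 _ _)).
  by rewrite /exp3 -/e eey e0 !scaler0 !addr0.
have -> : exp3 (br (- x (- a))) (y + e y) = y + e y - f (e y).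
  rewrite /exp3 !(fD, fN, ffy, ffey, fZ, f0).
  by lin_eq K; field.
rewrite /exp3 !(eD, eN, eey, efey, eZ, e0).
by lin_eq K; field.
Qed.

(** A root b + (p+1) a would pair to p + 2 with a^vee, and descending p + 2 steps would make b - a a
    root. *)
Lemma string_top a b (p k : nat) : N a -> N b -> ~ Rt (b - a) ->
  cf b a = - p%:Z -> (p < k)%N -> iter k (br (x a)) (x b) = 0.
Proof.
move=> Na Nb bottom cfb; elim: k => // k IHk; rewrite ltnS leq_eqVlt.
case/orP => [/eqP <-|/IHk /= ->]; last exact: br0r.
apply: (gl_rs_root G (rs_v a b p.+1)) => Rb; apply: bottom.
have := ar_string H (j := p.+2) Na Rb; rewrite !(cfE H) (ar_cfaa H) // cfb.
have -> : b + a *+ p.+1 - a *+ p.+2 = b - a by zmod_eq; lia.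
by apply; lia.
Qed.

(** Action of the Weyl element of SL2 on the irreducible module of dimension p + 1: v_r / r! goes to
    (-1)^r v_(p-r) / (p-r)!. Since p <= 3, finitely many cases are computed. *)
Lemma weyl_lift_string a b (p r : nat) : N a -> N b -> ~ Rt (b - a) ->
  cf b a = - p%:Z -> (r <= p <= 3)%N ->
  weyl_lift a (iter r (br (x a)) (x b)) =
    ((-1) ^+ r * (r`!%:R / (p - r)`!%:R)) *: iter (p - r) (br (x a)) (x b).
Proof.
move=> Na Nb bottom cfb rp3.
pose v k := iter k (br (x a)) (x b); set f := br (- x (- a)).
have eD y z : br (x a) (y + z) = br (x a) y + br (x a) z by apply: (gl_brDr G).
have fD y z : f (y + z) = f y + f z by apply: (gl_brDr G).
have eZ c y : br (x a) (c *: y) = c *: br (x a) y by apply: (gl_brZr G).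
have fZ c y : f (c *: y) = c *: f y by apply: (gl_brZr G).
have e0 : br (x a) 0 = 0 by apply: br0r.
have f0 : f 0 = 0 by apply: br0r.
have ev k : br (x a) (v k) = v k.+1 by [].
have fv k : f (v k.+1) = - (k.+1%:R * (p%:R - k%:R)) *: v k.
  by rewrite /f brNl (f_v Na bottom cfb) scaleNr.
have fv0 : f (v 0%N) = 0.
  rewrite /f brNl (gl_rs_root G (gl_rs_br G (cd_rs C (- a)) (cd_rs C b))) ?oppr0 //.
  by rewrite addrC.
have vp : v p.+1 = 0 by apply: (string_top Na Nb bottom cfb).
have expeD := exp3D eD; have expeZ := exp3Z eZ.
have expfD := exp3D fD; have expfZ := exp3Z fZ.
have expe k : exp3 (br (x a)) (v k) =
    v k + v k.+1 + 2^-1 *: v k.+2 + 6^-1 *: v k.+3 by [].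
have expf0 : exp3 f (v 0%N) = v 0%N.
  by rewrite /exp3 !fv0 !f0 !scaler0 !addr0.
have expf1 : exp3 f (v 1%N) = v 1%N + (- p%:R) *: v 0%N.
  by rewrite /exp3 !(fv, fZ, fv0, f0); lin_eq K; ring.
have expf2 : exp3 f (v 2%N) = v 2%N + (- (2 * (p%:R - 1))) *: v 1%N +
    (p%:R * (p%:R - 1)) *: v 0%N.
  by rewrite /exp3 !(fv, fZ, fv0, f0); lin_eq K; field.
have expf3 : exp3 f (v 3%N) = v 3%N + (- (3 * (p%:R - 2))) *: v 2%N +
    (3 * (p%:R - 1) * (p%:R - 2)) *: v 1%N +
    (- (p%:R * (p%:R - 1) * (p%:R - 2))) *: v 0%N.
  by rewrite /exp3 !(fv, fZ, fv0, f0); lin_eq K; field.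
have vS k : v k = 0 -> v k.+1 = 0 by rewrite -ev => ->.
rewrite -!/(v _) /weyl_lift -/f; move: vp rp3 expf1 expf2 expf3 {cfb fv}.
move: v fv0 ev expe expf0 vS => v fv0 ev expe expf0 vS.
case: p => [|[|[|[|p]]]]; case: r => [|[|[|[|r]]]] vp; rewrite ?andbF // => _ expf1 expf2 expf3;
  have vp1 := vS _ vp; have vp2 := vS _ vp1; have vp3 := vS _ vp2;
  have [vp4 vp5] := (vS _ vp3, vS _ (vS _ vp3));
  rewrite expe ?(vp, vp1, vp2, vp3, vp4, vp5) ?(addr0, scaler0)
    ?(expfD, expfZ) ?expf0 ?expf1 ?expf2 ?expf3 ?(expeD, expeZ) !expe
    ?(vp, vp1, vp2, vp3, vp4, vp5) ?(addr0, scaler0);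
  by rewrite /= ?factS ?fact0; lin_eq K; field.
Qed.

(** The divided powers v_r / r! are the vectors ± x (b + r a) by [string_sign], so the factorials of
    [weyl_lift_string] cancel. *)
Lemma weyl_lift_x a c : N a -> N c ->
  exists s : bool, weyl_lift a (x c) = (-1) ^+ s *: x (refl cf a c).
Proof.
move=> Na Nc; have [b [r [p [[Nb bottom cfb] [cE rp3 wc]]]]] := string_bottom H Na Nc.
have Nw := ar_refl H Na Nc; rewrite -/(refl cf a c) wc in Nw *.
rewrite {}cE in Nc *.
have [|s sE] := string_sign Na Nb bottom cfb _ Nc; first by case/andP: rp3.
have [|t tE] := string_sign Na Nb bottom cfb _ Nw; first exact: leq_subr.
have := weyl_lift_string Na Nb bottom cfb rp3; rewrite sE tE weyl_liftZ.
move=> E; exists (odd r (+) s (+) t).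
have fact0 (n : nat) : n`!%:R != 0 :> K by rewrite pnatr_eq0 -lt0n fact_gt0.
rewrite !signr_addb signr_odd.
have c0 : (-1) ^+ s * r`!%:R != 0 :> K by rewrite mulf_neq0 ?signr_eq0.
apply: (scalerI c0); rewrite E !scalerA; congr (_ *: _).
have -> : (-1) ^+ s * r`!%:R * ((-1) ^+ r * (-1) ^+ s * (-1) ^+ t) =
    ((-1) ^+ s * (-1) ^+ s) * (r`!%:R * ((-1) ^+ r * (-1) ^+ t)) :> K by ring.
by rewrite -signr_addb addbb mul1r; field.
Qed.

End Chevalley.

(** * The lattice spanned by a Chevalley system *)

Section ZspanTheory.
Variable V : zmodType.
Implicit Types (A S : set V) (u v : V).

Lemma Zspan_incl A : A `<=` Zspan A.
Proof. exact: sub_gen_smallest. Qed.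

Lemma Zspan_min A S : additive_subgroup S -> A `<=` S -> Zspan A `<=` S.
Proof. by move=> HS AS; apply: smallest_sub. Qed.

Lemma Zspan_subgroup A : additive_subgroup (Zspan A).
Proof.
split=> [S [[S0 _] _]//|u v Au Av S HS].
by have [[_ SB] _] := HS; apply: SB; [apply: Au | apply: Av].
Qed.

Lemma subgroup0 S : additive_subgroup S -> S 0. Proof. by case. Qed.

Lemma subgroupN S u : additive_subgroup S -> S u -> S (- u).
Proof. by case=> S0 SB Su; rewrite -sub0r; apply: SB. Qed.

Lemma subgroupD S u v : additive_subgroup S -> S u -> S v -> S (u + v).
Proof.
by move=> HS Su Sv; rewrite -[v]opprK; apply: HS.2 => //; apply: subgroupN.
Qed.

Lemma subgroupMn S u n : additive_subgroup S -> S u -> S (u *+ n).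
Proof.
move=> HS Su; elim: n => [|n IHn]; first exact: subgroup0.
by rewrite mulrS; apply: subgroupD.
Qed.

Lemma subgroupMz S u (n : int) : additive_subgroup S -> S u -> S (u *~ n).
Proof.
move=> HS Su; case: n => n; first by rewrite -pmulrn; apply: subgroupMn.
by rewrite NegzE mulrNz -pmulrn; apply: subgroupN => //; apply: subgroupMn.
Qed.

Lemma subgroup_sum S (J : Type) (r : seq J) (P : pred J) (F : J -> V) :
  additive_subgroup S -> (forall i, P i -> S (F i)) ->
  S (\sum_(i <- r | P i) F i).
Proof.
by move=> HS SF; elim/big_ind: _ => // [|u v]; [apply: subgroup0 | apply: subgroupD].
Qed.

End ZspanTheory.

Section Lattice.
Variables (K : numFieldType) (X : zmodType) (N I V0 : set X).
Variables (cf : X -> X -> int) (sq : X -> K).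
Hypothesis H : affine_roots N I V0 cf sq.
Hypothesis H2 : irreducible_roots N V0 cf.
Let Rt b := N b \/ I b.
Variables (L : lmodType K) (br : L -> L -> L) (form : L -> L -> K).
Variables (rs : X -> set L) (core : set L) (tau : L -> L) (x : X -> L).
Hypothesis G : graded_lie Rt br form rs.
Hypothesis C : chevalley_data N cf sq br form rs core tau x.

Local Notation par := (parallel V0).
Local Notation w := (refl cf).

Lemma brMzl y z (n : int) : br (y *~ n) z = br y z *~ n.
Proof. by rewrite -!scaler_int (gl_brZl G). Qed.

Lemma brMzr y z (n : int) : br y (z *~ n) = br y z *~ n.
Proof. by rewrite -!scaler_int (gl_brZr G). Qed.

Lemma signZ_int (s : bool) (y : L) : (-1) ^+ s *: y = y *~ (-1) ^+ s.
Proof. by rewrite -scaler_int rmorph_sign. Qed.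

(** By [string_sign] at steps r and r + 1 of the string, the constant is ± (r+1)! / r! = ± (r + 1),
    or 0 at the top. *)
Lemma br_x_int a c : N a -> N c -> ~ par a c ->
  exists n : int, br (x a) (x c) = x (a + c) *~ n.
Proof.
move=> Na Nc np; have [b [r [p [[Nb bottom cfb] [cE rp3 _]]]]] := string_bottom H Na Nc.
have [||s sE] := string_sign H G C Na Nb bottom cfb (k := r) _ _.
  by case/andP: rp3.
  by rewrite -cE.
have fact0 (n : nat) : n`!%:R != 0 :> K by rewrite pnatr_eq0 -lt0n fact_gt0.
have c0 : (-1) ^+ s * r`!%:R != 0 :> K by rewrite mulf_neq0 ?signr_eq0.
rewrite -cE in sE.
have vS : iter r.+1 (br (x a)) (x b) = ((-1) ^+ s * r`!%:R) *: br (x a) (x c).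
  by rewrite iterS sE (gl_brZr G).
have [lt_rp|le_pr] := ltnP r p; last first.
  exists 0; rewrite mulr0z; apply: (scalerI c0); rewrite -vS scaler0.
  exact: (string_top H G C Na Nb bottom cfb).
have [||t tE] := string_sign H G C Na Nb bottom cfb (k := r.+1) _ _ => //.
  have -> : b + a *+ r.+1 = c + a *~ 1 by rewrite cE; zmod_eq; lia.
  apply: (nonparallelD H Na Nc np _).1.
  have -> : c + a *~ 1 = b + a *+ r.+1 by rewrite cE; zmod_eq; lia.
  by apply: (string_up H Na); [left | rewrite cfb opprK].
exists ((-1) ^+ (s (+) t) * r.+1%:Z); apply: (scalerI c0); rewrite -vS tE.
have -> : b + a *+ r.+1 = a + c by rewrite cE; zmod_eq; lia.
rewrite -scaler_int scalerA intrM rmorph_sign; congr (_ *: _).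
rewrite signr_addb factS natrM -pmulrn.
have : (-1) ^+ s * (-1) ^+ s = 1 :> K by rewrite -signr_addb addbb.
by move: ((-1) ^+ s) => e ee; rewrite -[LHS]mul1r -ee; ring.
Qed.

(** For s = 0 and b in N this acts as the coroot of b. As x is 0 outside of N, the vector is 0 when
    b + s is not in N, and b can range over all of N. *)
Definition yvec b s := br (x (b + s)) (x (- b)).

Lemma rs_yvec b s : rs s (yvec b s).
Proof.
by apply: rs_sub (gl_rs_br G (cd_rs C _) (cd_rs C _)) _; zmod_eq; ring.
Qed.

Lemma br_br_int a b c : N a -> N b -> N c -> ~ par a b -> V0 (b + c) ->
  exists n : int, br (br (x a) (x b)) (x c) = x (a + b + c) *~ n.
Proof.
move=> Na Nb Nc np V; have [n ->] := br_x_int Na Nb np; rewrite brMzl.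
have [Nab|nNab] := pselect (N (a + b)); last first.
  by exists 0; rewrite (cd_out C nNab) (br0l G) mul0rz.
have [|m ->] := br_x_int Nab Nc; last by exists (m * n); rewrite mulrzA.
have [||_ npb] := nonparallelD H Nb Na (k := 1) _ _.
- by move/(parallel_sym H).
- by left; rewrite mulr1z.
have -> : c = - b + (b + c) by rewrite addKr.
move/(parallel_V0 H _ _ V)/(parallelNr H)/(parallel_sym H).
by rewrite -[a + b]/(a + b *~ 1).
Qed.

Lemma ad_yvec_nonparallel a b s : N a -> N b -> ~ par a b -> V0 s ->
  exists n : int, br (x a) (yvec b s) = x (a + s) *~ n.
Proof.
move=> Na Nb np Vs; rewrite /yvec (gl_jacobi G).
have [Nbs|nNbs] := pselect (N (b + s)); last first.
  by exists 0; rewrite (cd_out C nNbs) (br0r G) !(br0l G) addr0 mulr0z.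
have Nb' := ar_NN H Nb.
have [||n1 ->] := br_br_int Na Nbs Nb' _ _.
- by move/(parallel_V0 H _ _ Vs).
- by rewrite addrAC subrr add0r.
have [||n2 E] := br_br_int Na Nb' Nbs _ _.
- by move/(parallelNr H).
- by rewrite addrA addNr add0r.
exists (n1 - n2); rewrite (br_anti G) E mulrzBr; congr (x _ *~ _ - x _ *~ _).
  by zmod_eq; ring.
by zmod_eq; ring.
Qed.

Lemma weyl_lift_yvec a b s : N a -> N b -> V0 s ->
  exists e : bool, weyl_lift br x a (yvec b s) = (-1) ^+ e *: yvec (w a b) s.
Proof.
move=> Na Nb Vs; rewrite /yvec (weyl_lift_br H G C) //.
have [e2 ->] := weyl_lift_x H G C Na (ar_NN H Nb); rewrite (reflN H).
have -> : w a b + s = w a (b + s) by rewrite (reflD H) (refl_V0 H Na Vs).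
have [Nbs|nNbs] := pselect (N (b + s)).
  have [e1 ->] := weyl_lift_x H G C Na Nbs; exists (e1 (+) e2).
  by rewrite (gl_brZl G) (gl_brZr G) scalerA signr_addb.
exists false; rewrite (cd_out C nNbs).
have -> : weyl_lift br x a 0 = 0.
  by rewrite -{1}(scale0r (0 : L)) (weyl_liftZ _ G) scale0r.
rewrite (cd_out C (a := w a (b + s))) ?(br0l G) ?scaler0 //.
by move=> /(ar_refl H Na); rewrite -/(refl cf a _) (reflK H).
Qed.

(** [weyl_lift a] is evaluated twice on the same vector: as 1 - f e, and by its action on root
    vectors. *)
Lemma yvec_refl a b s (n : int) : N a -> N b -> V0 s ->
  br (x a) (yvec b s) = x (a + s) *~ n ->
  exists e : bool, yvec b s + yvec a s *~ n = (-1) ^+ e *: yvec (w a b) s.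
Proof.
move=> Na Nb Vs E; have [e Ee] := weyl_lift_yvec Na Nb Vs; exists e; rewrite -Ee.
rewrite (weyl_lift_iso H G C Na Vs (rs_yvec b s)) E brMzr (br_anti G).
by rewrite mulNrz opprK.
Qed.

(* For b parallel to a, reflect b in a root g that is neither parallel nor
   orthogonal to b: y_b = ± y_(w_g b) - m y_g, where w_g b and g are not parallel
   to a. *)
Lemma ad_yvec a b s : N a -> N b -> V0 s ->
  exists n : int, br (x a) (yvec b s) = x (a + s) *~ n.
Proof.
move=> Na Nb Vs; have [pab|np] := pselect (par a b); last exact: ad_yvec_nonparallel.
have [g [Ng npbg n0]] := exists_partner H H2 Nb.
have npag : ~ par a g by move/(parallel_trans H (parallel_sym H pab)).
have npaw : ~ par a (w g b).
  move/(parallel_trans H (parallel_sym H pab)).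
  exact: (parallel_refl H Nb Ng npbg n0).
have [m Em] : exists m : int, br (x g) (yvec b s) = x (g + s) *~ m.
  by apply: ad_yvec_nonparallel => // /(parallel_sym H).
have [e Ee] := yvec_refl Ng Nb Vs Em.
have [m1 Em1] := ad_yvec_nonparallel Na Ng npag Vs.
have [m2 Em2] := ad_yvec_nonparallel Na (ar_refl H Ng Nb) npaw Vs.
exists ((-1) ^+ e * m2 - m1 * m).
have -> : yvec b s = yvec (w g b) s *~ (-1) ^+ e - yvec g s *~ m.
  by rewrite -signZ_int -Ee addrK.
rewrite (gl_brDr G) (brNr G) !brMzr Em1 Em2.
by zmod_eq; ring.
Qed.

(** By [yvec_refl], passing from b to w a b changes [yvec b s] by a sign and an integer multiple of
    [yvec a s], so it is enough to know M on a set P whose reflections generate N. *)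
Lemma yvec_generated (P : set X) (M : set L) s : P `<=` N -> V0 s ->
  (forall Q : set X, P `<=` Q ->
    (forall a b, P a -> N b -> Q b -> Q (w a b)) -> N `<=` Q) ->
  additive_subgroup M -> (forall a, P a -> M (yvec a s)) ->
  forall b, N b -> M (yvec b s).
Proof.
move=> PN Vs gen HM MP; apply: gen => // a b Pa Nb Mb.
have Na := PN a Pa; have [n E] := ad_yvec Na Nb Vs.
have [e Ee] := yvec_refl Na Nb Vs E.
have -> : yvec (w a b) s = (-1) ^+ e *: (yvec b s + yvec a s *~ n).
  by rewrite Ee signrZK.
rewrite signZ_int; apply: subgroupMz => //; apply: subgroupD => //.
by apply: subgroupMz => //; apply: MP.
Qed.

Definition lattice_gens : set L :=
  [set u | (exists2 a, N a & u = x a) \/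
           exists b s, [/\ N b, V0 s & u = yvec b s]].

Lemma lattice_br u v : Zspan lattice_gens u -> Zspan lattice_gens v ->
  Zspan lattice_gens (br u v).
Proof.
set Lam := Zspan _; have HLam : additive_subgroup Lam by apply: Zspan_subgroup.
have Lx a : Lam (x a).
  have [Na|nNa] := pselect (N a); last by rewrite (cd_out C nNa); apply: subgroup0.
  by apply: Zspan_incl; left; exists a.
have Ly b s : N b -> V0 s -> Lam (yvec b s).
  by move=> Nb Vs; apply: Zspan_incl; right; exists b, s.
have Lxx a c : N a -> N c -> Lam (br (x a) (x c)).
  move=> Na Nc; have [[V|V]|np] := pselect (par a c).
  (* a + c pairs to 4 with a^vee, so it is not a root. *)
  - have := gl_rs_root G (gl_rs_br G (cd_rs C a) (cd_rs C c)).
    move=> ->; first exact: subgroup0.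
    move=> /(cf_bound H Na); rewrite !(cfE H) (ar_cfaa H) // (V0_cf H V Na).
    by rewrite (ar_cfaa H).
  - have -> : br (x a) (x c) = yvec (- c) (c + a).
      by rewrite /yvec opprK addKr.
    by apply: Ly => //; apply: (ar_NN H).
  - by have [n ->] := br_x_int Na Nc np; exact: (subgroupMz _ HLam).
have Lxy a b s : N a -> N b -> V0 s -> Lam (br (x a) (yvec b s)).
  by move=> Na Nb Vs; have [n ->] := ad_yvec Na Nb Vs; exact: (subgroupMz _ HLam).
(* The Jacobi identity and [ad_yvec] reduce this to brackets of root vectors. *)
have Lyy b s c t : N b -> V0 s -> N c -> V0 t -> Lam (br (yvec b s) (yvec c t)).
  move=> Nb Vs Nc Vt; have Nb' := ar_NN H Nb.
  have [Nbs|nNbs] := pselect (N (b + s)); last first.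
    by rewrite /yvec (cd_out C nNbs) !(br0l G); apply: subgroup0.
  have [n1 E1] := ad_yvec Nbs Nc Vt; have [n2 E2] := ad_yvec Nb' Nc Vt.
  have := gl_jacobi G (x (b + s)) (x (- b)) (yvec c t).
  rewrite E1 E2 !brMzr -/(yvec b s) => E.
  have Lx2 a d : Lam (br (x a) (x d)).
    have [Na|nNa] := pselect (N a); last first.
      by rewrite (cd_out C nNa) (br0l G); apply: subgroup0.
    have [Nd|nNd] := pselect (N d); first exact: Lxx.
    by rewrite (cd_out C nNd) (br0r G); apply: subgroup0.
  have -> : br (yvec b s) (yvec c t) =
      br (x (b + s)) (x (- b + t)) *~ n2 - br (x (- b)) (x (b + s + t)) *~ n1.
    by rewrite E addrK.
  by apply: HLam.2; apply: (subgroupMz _ HLam).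
have Lg u' v' : lattice_gens u' -> lattice_gens v' -> Lam (br u' v').
  case=> [[a Na ->]|[b [s [Nb Vs ->]]]] [[c Nc ->]|[c [t [Nc Vt ->]]]].
  - exact: Lxx.
  - exact: Lxy.
  - by rewrite (br_anti G); apply: (subgroupN HLam); apply: Lxy.
  - exact: Lyy.
move=> Lu; move: v; apply: Zspan_min.
  split=> [|v v' Lv Lv']; first by rewrite /= (br0r G); apply: subgroup0.
  by rewrite /= (gl_brDr G) (brNr G); apply: HLam.2.
move=> v gv; move: u Lu; apply: Zspan_min.
  split=> [|u u' Lu Lu']; first by rewrite /= (br0l G); apply: subgroup0.
  by rewrite /= (gl_brDl G) (brNl G); apply: HLam.2.
by move=> u gu; apply: Lg.
Qed.

End Lattice.

(** * Characters of the root lattice *)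

(** What comparing two Chevalley systems yields directly. Whether chi also respects arbitrary linear
    relations between roots is settled separately, by two different arguments. *)
Record root_character (K : numFieldType) (X : zmodType) (N : set X)
    (cf : X -> X -> int) (chi : X -> K) : Prop := RootCharacter {
  rc_neq0 : forall a, N a -> chi a != 0;
  rc_opp : forall a, N a -> chi (- a) = (chi a)^-1;
  rc_refl : forall a b, N a -> N b ->
    chi (refl cf a b) = chi b * chi a ^ (- cf b a)
}.

Section CompareChevalley.
Variables (K : numFieldType) (X : zmodType) (N I V0 : set X).
Variables (cf : X -> X -> int) (sq : X -> K).
Hypothesis H : affine_roots N I V0 cf sq.
Let Rt b := N b \/ I b.
Variables (L : lmodType K) (br : L -> L -> L) (form : L -> L -> K).
Variables (rs : X -> set L) (core : set L).
Hypothesis G : graded_lie Rt br form rs.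
Variables (tau tau' : L -> L) (x x' : X -> L).
Hypothesis C : chevalley_data N cf sq br form rs core tau x.
Hypothesis C' : chevalley_data N cf sq br form rs core tau' x'.

Lemma chevalley_ratio : exists c : X -> K,
  (forall a, N a -> x' a = c a *: x a) /\ root_character N cf (fun a => c a ^+ 2).
Proof.
have ex a : exists c, N a -> x' a = c *: x a.
  have [Na|nNa] := pselect (N a); last by exists 0.
  by have [c cE] := cd_span C Na (cd_rs C' a); exists c.
pose c a := projT1 (cid (ex a)).
have cE a : N a -> x' a = c a *: x a by rewrite /c; case: cid.
exists c; split=> //.
have c0 a : N a -> c a != 0.
  move=> Na; apply/eqP => ca0; have := x_neq0 G C' Na.
  by rewrite cE // ca0 scale0r eqxx.
have cN a : N a -> c a * c (- a) = 1.
  move=> Na; have Na' := ar_NN H Na.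
  have := cd_form C' Na; rewrite !cE // (gl_formZl G) (gl_formZr G) => E.
  apply: (mulIf (_ : 2 != 0 :> K)); rewrite ?pnatr_eq0 // mul1r -[RHS]E.
  by rewrite -(cd_form C Na); ring.
(* Both systems have the coefficient k! up to sign, so c a ^ k * c b = ± c (b + k a); squaring
   removes the sign. *)
have cstr a b (p k : nat) : N a -> N b -> ~ Rt (b - a) -> cf b a = - p%:Z ->
    (k <= p)%N -> N (b + a *+ k) -> c (b + a *+ k) ^+ 2 = c a ^+ 2 ^+ k * c b ^+ 2.
  move=> Na Nb bottom cfb le_kp Nc.
  have [s sE] := string_sign H G C Na Nb bottom cfb le_kp Nc.
  have [t tE] := string_sign H G C' Na Nb bottom cfb le_kp Nc.
  have itE j : iter j (br (x' a)) (x' b) = (c a ^+ j * c b) *: iter j (br (x a)) (x b).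
    elim: j => [|j IHj]; first by rewrite expr0 mul1r /= cE.
    by rewrite !iterS IHj cE // (gl_brZl G) (gl_brZr G) scalerA exprS mulrA.
  move: tE; rewrite itE sE cE // !scalerA => /eqP.
  rewrite -subr_eq0 -scalerBl scaler_eq0 (negPf (x_neq0 G C Nc)) orbF subr_eq0.
  move=> /eqP E.
  have fact0 : k`!%:R != 0 :> K by rewrite pnatr_eq0 -lt0n fact_gt0.
  have {}E : c a ^+ k * c b * (-1) ^+ s = (-1) ^+ t * c (b + a *+ k).
    apply: (mulIf fact0).
    by transitivity (c a ^+ k * c b * ((-1) ^+ s * k`!%:R)); [ring | rewrite E; ring].
  have := congr1 (fun z => z ^+ 2) E; rewrite !exprMn !sqrr_sign mulr1 mul1r.
  by move=> <-; rewrite expr2.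
split=> [a Na|a Na|a d Na Nd]; first by rewrite expf_neq0 ?c0.
  by apply: (mulfI (expf_neq0 2 (c0 a Na))); rewrite -exprMn cN // expr1n divff ?expf_neq0 ?c0.
have [b [r [p [[Nb bottom cfb] [dE rp3 wd]]]]] := string_bottom H Na Nd.
have Nw := ar_refl H Na Nd; rewrite -/(refl cf a d) wd in Nw *.
have -> : - cf d a = p%:Z - 2 * r%:Z.
  by rewrite dE !(cfE H) (ar_cfaa H) // cfb; lia.
rewrite (cstr a b p) ?leq_subr // dE (cstr a b p) -?dE //; last by lia.
rewrite [RHS]mulrAC; congr (_ * _); set z := c a ^+ 2.
have z0 : z != 0 by rewrite expf_neq0 ?c0.
have -> : z ^+ (p - r) = z ^ (r%:Z + (p%:Z - 2 * r%:Z)).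
  by rewrite exprnP; congr (_ ^ _); lia.
by rewrite expfzDr.
Qed.

End CompareChevalley.

Section CharacterRelations.
Variables (K : numFieldType) (X : zmodType) (N I V0 : set X).
Variables (cf : X -> X -> int) (sq : X -> K).
Hypothesis H : affine_roots N I V0 cf sq.
Hypothesis H2 : irreducible_roots N V0 cf.
Let Rt b := N b \/ I b.
Variable chi : X -> K.
Hypothesis R : root_character N cf chi.

Local Notation par := (parallel V0).
Local Notation w := (refl cf).

(** Reflections change b and chi b in parallel, so both are expressed through p by the same
    exponents. Independence of p makes these exponents sum to 0 along a relation. *)
Lemma chi_relation_independent (p : seq X) : uniq p ->
  (forall a, a \in p -> N a) ->
  (forall k : X -> int, \sum_(a <- p) a *~ k a = 0 -> forall a, a \in p -> k a = 0) ->
  (forall Q : set X, (forall a, a \in p -> Q a) ->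
    (forall a b, a \in p -> N b -> Q b -> Q (w a b)) -> N `<=` Q) ->
  forall l : seq X, (forall a, a \in l -> N a) -> \sum_(a <- l) a = 0 ->
  \prod_(a <- l) chi a = 1.
Proof.
move=> Up pN free gen.
have chi0 a : a \in p -> chi a != 0 by move=> /pN; apply: (rc_neq0 R).
have coords : forall b, N b -> exists k : X -> int,
    b = \sum_(a <- p) a *~ k a /\ chi b = \prod_(a <- p) chi a ^ k a.
  apply: gen => [a pa|a b pa Nb [k [bE chiE]]].
    exists (fun b => (b == a)%:R); split.
      rewrite (bigD1_seq a) //= eqxx mulr1z big1 ?addr0 // => b /negPf ->.
      by rewrite mulr0z.
    rewrite (bigD1_seq a) //= eqxx expr1z big1 ?mulr1 // => b /negPf ->.
    by rewrite expr0z.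
  exists (fun d => k d - if d == a then cf b a else 0); split.
    rewrite (eq_bigr (fun d => d *~ k d - d *~ (if d == a then cf b a else 0))).
      rewrite sumrB -bE; congr (_ - _); rewrite (bigD1_seq a) //= eqxx big1 ?addr0 //.
      by move=> d /negPf ->; rewrite mulr0z.
    by move=> d _; rewrite mulrzBr.
  rewrite (rc_refl R (pN a pa) Nb) chiE (bigD1_seq a) //= [RHS](bigD1_seq a) //= eqxx.
  rewrite expfzDr ?chi0 // mulrAC; congr (_ * _).
  by apply: eq_bigr => d /negPf ->; rewrite subr0.
move=> l lN suml.
pose k b := if pselect (N b) is left Nb then projT1 (cid (coords b Nb)) else fun=> 0.
have kP b : N b -> b = \sum_(a <- p) a *~ k b a /\ chi b = \prod_(a <- p) chi a ^ k b a.
  by move=> Nb; rewrite /k; case: pselect => // Nb'; case: cid.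
have sum_k a : a \in p -> \sum_(b <- l) k b a = 0.
  apply: (free (fun a => \sum_(b <- l) k b a)); rewrite -[RHS]suml.
  under eq_bigr do rewrite mulrz_sumr.
  rewrite exchange_big /=; apply: eq_big_seq => b /lN Nb.
  by rewrite -(kP b Nb).1.
rewrite (eq_big_seq (fun b => \prod_(a <- p) chi a ^ k b a)); last first.
  by move=> b /lN /kP[].
rewrite exchange_big /= big1_seq // => a /= pa.
rewrite -[RHS](expr0z (chi a)) -(sum_k a pa).
elim: (l) => [|b s IHs]; first by rewrite !big_nil expr0z.
by rewrite !big_cons IHs expfzDr ?chi0.
Qed.

End CharacterRelations.

(** * Short roots and the relations between them *)

Section ShortRoots.
Variables (K : numFieldType) (X : zmodType) (N I V0 : set X).
Variables (cf : X -> X -> int) (sq : X -> K).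
Hypothesis H : affine_roots N I V0 cf sq.
Hypothesis H2 : irreducible_roots N V0 cf.
Let Rt b := N b \/ I b.

Local Notation par := (parallel V0).
Local Notation w := (refl cf).

(* No root that is not orthogonal to a is shorter than a. *)
Definition short_root a :=
  N a /\ forall b, N b -> ~ par a b -> -1 <= cf a b <= 1.

Let Nw a b : N a -> N b -> N (w a b). Proof. exact: (ar_refl H). Qed.

Lemma shortN a : short_root a -> short_root (- a).
Proof.
case=> Na Sa; split=> [|b Nb np]; first exact: (ar_NN H).
have /Sa : ~ par a b by move=> /(parallelNl H).
by move=> /(_ Nb); rewrite (cfNl H); lia.
Qed.

Lemma short_par a b : short_root a -> N b -> par a b -> short_root b.
Proof.
case=> Na Sa Nb pab; split=> // c Nc npbc.
have npac : ~ par a c by move=> pac; apply/npbc/(parallel_trans H (parallel_sym H pab)).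
by have := Sa c Nc npac; case: (cf_parallel H pab Nc) => ->; lia.
Qed.

Lemma refl_par g a b : N g -> par a b -> par (w g a) (w g b).
Proof.
move=> Ng [V|V]; [left|right].
  by rewrite -(reflN H) -(reflD H) (refl_V0 H Ng V).
by rewrite -(reflD H) (refl_V0 H Ng V).
Qed.

Lemma short_refl g a : N g -> short_root a -> short_root (w g a).
Proof.
move=> Ng [Na Sa]; split=> [|b Nb np]; first exact: Nw.
have Nwb := Nw Ng Nb.
rewrite -[b](reflK H b Ng) (cf_refl2 H Ng Na Nwb); apply: Sa => //.
by move=> /(refl_par Ng); rewrite (reflK H).
Qed.

Lemma short_cf a b : short_root a -> short_root b -> ~ par a b ->
  cf a b = cf b a /\ -1 <= cf b a <= 1.
Proof.
case=> [Na Sa] [Nb Sb] np; have np' : ~ par b a by move/(parallel_sym H).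
have := nonparallelP H Na Nb np; rewrite /nonparallel_cf.
by have := Sa b Nb np; have := Sb a Na np'; lia.
Qed.

Section Characters.
Variable chi : X -> K.
Hypothesis R : root_character N cf chi.

Lemma chi_refl1 a b : N a -> N b -> cf b a = -1 ->
  chi (b + a) = chi b * chi a /\ N (b + a).
Proof.
move=> Na Nb cf1; have := rc_refl R Na Nb; have := Nw Na Nb.
by rewrite /refl cf1 mulrN1z !opprK expr1z.
Qed.

(* For a short root a and s in V0, chi a * chi (s - a) does not depend on a. *)
Let S a : set X := [set s | V0 s /\ N (s - a)].
Let g a s := chi a * chi (s - a).
Let eqg a b := forall s, (S a s <-> S b s) /\ (S a s -> g a s = g b s).

Let eqg_sym a b : eqg a b -> eqg b a.
Proof. by move=> E s; have [E1 E2] := E s; split=> [|/E1/E2]; first by split=> /E1. Qed.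

Let eqg_trans a b c : eqg a b -> eqg b c -> eqg a c.
Proof.
move=> E F s; have [E1 E2] := E s; have [F1 F2] := F s; split.
  by rewrite E1.
by move=> Sa; rewrite E2 // F2 //; apply/E1.
Qed.

(** With the root d = c - a one has chi c = chi d * chi a and chi (s - a) = chi (s - c) * chi d, so
    the factor chi d passes from one side to the other. *)
Let eqg1 a c : short_root a -> short_root c -> ~ par a c -> cf c a = 1 -> eqg a c.
Proof.
move=> Sa Sc np cf1; have [cfE1 _] := short_cf Sa Sc np.
have [Na Nc] := (Sa.1, Sc.1); rewrite cf1 in cfE1.
have Nd : N (c - a) by have := Nw Na Nc; rewrite /refl cf1 mulr1z.
have cf_da : cf (c - a) a = -1 by rewrite (ar_cfB H) cf1 (ar_cfaa H).
have cf_dc : cf (c - a) c = 1 by rewrite (ar_cfB H) cfE1 (ar_cfaa H).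
have npad : ~ par a (c - a) by apply: (cf_nonparallel H Na Nd); rewrite cf_da.
have npcd : ~ par c (c - a) by apply: (cf_nonparallel H Nc Nd); rewrite cf_dc.
have cf_ad : cf a (c - a) = -1.
  have := nonparallelP H Na Nd npad; have := Sa.2 _ Nd npad.
  by rewrite /nonparallel_cf cf_da; lia.
have cf_cd : cf c (c - a) = 1.
  have := nonparallelP H Nc Nd npcd; have := Sc.2 _ Nd npcd.
  by rewrite /nonparallel_cf cf_dc; lia.
have [chi_c _] := chi_refl1 Nd Na cf_ad; rewrite subrKC in chi_c.
have step s : S c s -> S a s /\ g a s = g c s.
  case=> Vs Ns; have cf_sd : cf (s - c) (c - a) = -1.
    by rewrite (ar_cfB H) (ar_V0cf H Vs Nd) cf_cd.
  have [] := chi_refl1 Nd Ns cf_sd; rewrite addrA subrK => chi_s Nsa.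
  by split=> //; rewrite /g chi_s chi_c; ring.
have back s : S a s -> S c s.
  case=> Vs Ns; split=> //.
  have cf_sd : cf (s - a) (- (c - a)) = -1.
    by rewrite (ar_cfNr H _ Nd) (ar_cfB H) (ar_V0cf H Vs Nd) cf_ad.
  have [_] := chi_refl1 (ar_NN H Nd) Ns cf_sd; congr N; zmod_eq; ring.
by move=> s; split=> [|/back/step[]//]; split=> [/back|/step[]].
Qed.

(** When the pairing is -1, the comparison goes through c + a, which pairs to 1 with both. *)
Let eqg_short a c : short_root a -> short_root c -> ~ par a c -> cf a c <> 0 ->
  eqg a c.
Proof.
move=> Sa Sc np n0; have [cfE bd] := short_cf Sa Sc np.
have [Na Nc] := (Sa.1, Sc.1).
have [cf1|cf1] : cf c a = 1 \/ cf c a = -1 by lia.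
  exact: eqg1.
have Se : short_root (c + a).
  by have := short_refl Na Sc; rewrite /refl cf1 mulrN1z opprK.
have cfa : cf (c + a) a = 1 by rewrite (cfDl H) cf1 (ar_cfaa H).
have cfc : cf (c + a) c = 1 by rewrite (cfDl H) cfE cf1 (ar_cfaa H).
apply: (eqg_trans (b := c + a)); last apply: eqg_sym.
  by apply: eqg1 => //; apply: (cf_nonparallel H Na Se.1); rewrite cfa.
by apply: eqg1 => //; apply: (cf_nonparallel H Nc Se.1); rewrite cfc.
Qed.

Let partner a := exists c, [/\ short_root c, ~ par a c & cf a c <> 0].

(** A partner gives a = b + c with b, c short and pairing to -1. As g a = g b = g c, the identity (s
    - b) + (t - c) = s + t - a gives multiplicativity. *)
Let g_hom a s t : short_root a -> partner a -> S a s -> S a t ->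
  S a (s + t) /\ g a (s + t) = g a s * g a t.
Proof.
move=> Sa [c0 [Sc0 np0 n0]] Ss St.
have [c [Sc np cf1]] : exists c, [/\ short_root c, ~ par a c & cf c a = 1].
  have [cfE bd] := short_cf Sa Sc0 np0.
  have [cf1|cf1] : cf c0 a = 1 \/ cf c0 a = -1 by lia.
    by exists c0.
  exists (- c0); split; first exact: shortN.
    by move/(parallelNr H).
  by rewrite (cfNl H) cf1.
have [cfE _] := short_cf Sa Sc np; have [Na Nc] := (Sa.1, Sc.1).
pose b := a - c.
have Sb : short_root b.
  by have := short_refl Nc Sa; rewrite /refl cfE cf1 mulr1z.
have cfb : cf b a = 1 by rewrite /b (ar_cfB H) cf1 (ar_cfaa H).
have npb : ~ par a b by apply: (cf_nonparallel H Na Sb.1); rewrite cfb.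
have cfbc : cf b c = -1 by rewrite /b (ar_cfB H) cfE cf1 (ar_cfaa H).
have [/(_ s)[eb1 eb2] /(_ t)[ec1 ec2]] := (eqg1 Sa Sb npb cfb, eqg1 Sa Sc np cf1).
have [Vs Nsb] := eb1.1 Ss; have [Vt Ntc] := ec1.1 St.
have [chi_a _] := chi_refl1 Nc Sb.1 cfbc; rewrite subrK in chi_a.
have cf_st : cf (s - b) (t - c) = -1.
  have Ntc' : N (- c + t) by rewrite addrC.
  rewrite [t - c]addrC (cf_V0r H Nsb (ar_NN H Nc) Vt Ntc').
  by rewrite (ar_cfNr H _ Nc) (ar_cfB H) (ar_V0cf H Vs Nc) cfbc.
have [] := chi_refl1 Ntc Nsb cf_st.
have -> : s - b + (t - c) = s + t - a by rewrite /b; zmod_eq; ring.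
move=> chi_st Nst; split; first by split=> //; apply: (V0D H).
by rewrite (eb2 Ss) (ec2 St) /g chi_st chi_a; ring.
Qed.

Section Connected.
Variables a0 b0 : X.
Hypotheses (Sa0 : short_root a0) (Sb0 : short_root b0).
Hypotheses (np0 : ~ par a0 b0) (cf0 : cf a0 b0 <> 0).

(** The short roots already compared with a0; by irreducibility [Cc_short] finds all short roots in
    this class. *)
Let Cc a := [/\ short_root a, partner a & eqg a0 a].

Let Cc_closed a c : Cc a -> short_root c -> cf a c <> 0 -> Cc c.
Proof.
move=> [Sa [e [Se npe n0e]] Ea] Sc n0.
have [[Na Nc] Ne] := ((Sa.1, Sc.1), Se.1).
have [pac|npac] := pselect (par a c); last first.
  split=> //; last by apply: (eqg_trans Ea _); apply: eqg_short.
  exists a; split=> //; first by move/(parallel_sym H).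
  by move/(ar_cf0 H Nc Na).
(* If c is parallel to a, both are compared with the partner e of a. *)
have npce : ~ par c e by move/(parallel_trans H pac).
have n0ce : cf c e <> 0 by case: (cf_parallel H pac Ne); lia.
split=> //; first by exists e.
apply: (eqg_trans Ea _); apply: (eqg_trans (b := e)); first exact: eqg_short.
by apply: eqg_sym; apply: eqg_short.
Qed.

Let Cc_refl a h : Cc a -> N h -> Cc (w h a).
Proof.
move=> Ca Nh; have [Sa [b [Sb np n0]] Ea] := Ca.
have [Na Nb] := (Sa.1, Sb.1).
have Cb : Cc b by apply: (Cc_closed Ca _ _).
have [Swa Swb] := (short_refl Nh Sa, short_refl Nh Sb).
have Cof c d : Cc c -> short_root d -> cf d c <> 0 -> Cc d.
  move=> Cc1 Sd n1; apply: (Cc_closed Cc1 Sd _); have [[Nc _] _ _] := Cc1.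
  by move/(ar_cf0 H Nc Sd.1).
have [z1|n1] := pselect (cf (w h a) a = 0); last exact: (Cof _ _ Ca Swa n1).
have [z2|n2] := pselect (cf (w h a) b = 0); last exact: (Cof _ _ Cb Swa n2).
have fromwb : Cc (w h b) -> Cc (w h a).
  by move=> Cwb; apply: (Cof _ _ Cwb Swa); rewrite (cf_refl2 H).
have [z3|n3] := pselect (cf (w h b) a = 0); last by apply: fromwb; apply: (Cof _ _ Ca Swb n3).
have [z4|n4] := pselect (cf (w h b) b = 0); last by apply: fromwb; apply: (Cof _ _ Cb Swb n4).
(* If w_h a and w_h b are both orthogonal to a and b, the pairings of a and b with each other factor
   through h, and 2 * 2 = e * e with |e| <= 1. *)
exfalso; have [cf_ab bd] := short_cf Sa Sb np.
move: z1 z2 z3 z4; rewrite /refl !(cfE H) !(ar_cfaa H) // cf_ab.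
rewrite cf_ab in n0.
move: (cf b a) (cf a h) (cf b h) (cf h a) (cf h b) bd n0 => e n m p q bd n0.
move=> E1 E2 E3 E4.
have e1 : p * n = 2 by lia.
have e2 : q * n = e by lia.
have e3 : p * m = e by lia.
have e4 : q * m = 2 by lia.
have : (p * n) * (q * m) = (q * n) * (p * m) by ring.
by rewrite e1 e2 e3 e4; nia.
Qed.

Let Cc_all h : N h -> exists2 a, Cc a & cf a h <> 0.
Proof.
have Ca0 : Cc a0 by split; [| exists b0 | move=> s].

apply: (ir_connected H2 (Q := fun h => exists2 a, Cc a & cf a h <> 0)).
  exists a0; first exact: Sa0.1.
  by exists a0 => //; rewrite (ar_cfaa H) ?Sa0.1 //; apply: Sa0.1.
move=> c d Nc Nd [a Ca n0] n1.
have [z|n2] := pselect (cf a d = 0); last by exists a.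
(* w_c a is a minus a nonzero multiple of c; as a is orthogonal to d and c is not, it is not
   orthogonal to d. *)
exists (w c a); first exact: Cc_refl.
rewrite /refl !(cfE H) z sub0r => /eqP; rewrite oppr_eq0 mulf_eq0.
by move=> /orP[]/eqP.
Qed.

Let Cc_short a : short_root a -> Cc a.
Proof.
move=> Sa; have [c Cc1 n0] := Cc_all Sa.1.
exact: (Cc_closed Cc1 Sa n0).
Qed.

(* Induction on the length: two roots with a negative product are replaced by
   their sum, or removed if they are opposite modulo V0. *)
Lemma chi_short_sum (l : seq X) : (forall a, a \in l -> short_root a) ->
  V0 (\sum_(a <- l) a) ->
  S a0 (\sum_(a <- l) a) /\ \prod_(a <- l) chi a = g a0 (\sum_(a <- l) a).
Proof.
have Na0 := Sa0.1.
have [n sz] := ubnP (size l); elim: n => // n IHn in l sz *.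
case: l sz => [|a l] sz Sl Vl.
  rewrite !big_nil; split; first by split; [apply: ar_V00 H | rewrite sub0r; apply: (ar_NN H)].
  by rewrite /g sub0r (rc_opp R) // divff // (rc_neq0 R).
have Sa : short_root a by apply: Sl; rewrite inE eqxx.
have [Na _] := Sa.
(* The total sum lies in V0 and pairs to 0 with a^vee, while a itself contributes 2. *)
have [b lb neg] : exists2 b, b \in l & cf b a < 0.
  apply: contrapT => nob.
  have : 0 <= \sum_(b <- l) cf b a.
    rewrite big_seq; apply: sumr_ge0 => b lb.
    by rewrite leNgt; apply/negP => neg; apply: nob; exists b.
  have := ar_V0cf H Vl Na; rewrite big_cons (cfDl H) (ar_cfaa H) //.
  suff -> : cf (\sum_(b <- l) b) a = \sum_(b <- l) cf b a by lia.
  by elim: (l) => [|c s IHs]; rewrite ?big_nil ?(cf0l H) // !big_cons (cfDl H) IHs.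
have Sb : short_root b by apply: Sl; rewrite inE lb orbT.
have [Nb _] := Sb.
have pe := perm_to_rem lb; set l' := rem b l in pe.
have Sl' c : c \in l' -> short_root c.
  by move=> /mem_rem lc; apply: Sl; rewrite inE lc orbT.
have szl : size l = (size l').+1 by rewrite (perm_size pe).
rewrite !big_cons !(perm_big _ pe) /= !big_cons !addrA !mulrA in Vl *.
have [pab|npab] := pselect (par a b); last first.
  have cf1 : cf b a = -1 by have := (short_cf Sa Sb npab).2; lia.
  have [chi_ba Nba] := chi_refl1 Na Nb cf1.
  have Sba : short_root (b + a).
    by have := short_refl Na Sb; rewrite /refl cf1 mulrN1z opprK.
  have := IHn (b + a :: l'); rewrite !big_cons chi_ba.
  rewrite [b + a]addrC [chi b * _]mulrC; apply=> //.
    by rewrite /= -szl; move: sz; rewrite /= ltnS.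
  by move=> c; rewrite inE => /orP[/eqP ->|/Sl'//]; rewrite addrC.
(* The pair contributes chi a * chi b = g a (a + b), equal to g a0 (a + b), which [g_hom] joins to
   the value of the remaining list. *)
have Vab : V0 (a + b).
  by case: (parallel_cf H Na Nb pab) => -[V cfab]; [lia | rewrite addrC].
have Vl' : V0 (\sum_(c <- l') c).
  by have := ar_V0B H Vl Vab; congr V0; zmod_eq; ring.
have [|Sl1 ->] := IHn l' _ Sl' Vl'.
  by apply: ltnW; move: sz; rewrite /= szl ltnS.
have [_ _ Ea] := Cc_short Sa; have [E1 E2] := Ea (a + b).
have Sab : S a (a + b) by split=> //; rewrite addrC addKr.
have pa0 : partner a0 by exists b0.
have [Sw gw] := g_hom Sa0 pa0 (E1.2 Sab) Sl1.
by split=> //; rewrite gw (E2 (E1.2 Sab)) /(g a _) [a + b]addrC addrK.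
Qed.

(** For h not short there is a short a with <a, h^vee> = 1. Then h = a - w_h a is a sum of two short
    roots, and [rc_refl] gives the value of chi. *)
Let chi_decomp h : N h -> exists l : seq X,
  [/\ forall a, a \in l -> short_root a, \sum_(a <- l) a = h &
      \prod_(a <- l) chi a = chi h].
Proof.
move=> Nh; have [Sh|nSh] := pselect (short_root h).
  by exists [:: h]; split; rewrite ?big_seq1 // => a; rewrite inE => /eqP ->.
have [a1 [Sa1 _ _] n0] := Cc_all Nh; have [Na1 _] := Sa1.
have np1 : ~ par a1 h by move/(short_par Sa1 Nh).
have [a [Sa cf1]] : exists a, short_root a /\ cf a h = 1.
  have bd := Sa1.2 h Nh np1.
  have [cf1|cf1] : cf a1 h = 1 \/ cf a1 h = -1 by lia.
    by exists a1.
  by exists (- a1); split; [apply: shortN | rewrite (cfNl H) cf1].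
have [Na _] := Sa; have wE : w h a = a - h by rewrite /refl cf1.
have := rc_refl R Nh Na; rewrite wE cf1 => chiE.
have Sc : short_root (- (a - h)) by apply: shortN; rewrite -wE; apply: short_refl.
exists [:: a; - (a - h)]; split.
- by move=> c; rewrite !inE => /orP[] /eqP ->.
- by rewrite !big_cons big_nil addr0 opprB addrC subrK.
have Nah : N (a - h) by rewrite -wE; apply: Nw.
rewrite !big_cons big_nil mulr1 (rc_opp R Nah) chiE.
have := rc_neq0 R Na; have := rc_neq0 R Nh; rewrite exprN1.
by move: (chi a) (chi h) => z t z0 t0; field; rewrite z0.
Qed.

Lemma chi_relation_short (l : seq X) : (forall a, a \in l -> N a) ->
  \sum_(a <- l) a = 0 -> \prod_(a <- l) chi a = 1.
Proof.
move=> lN suml.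
have [m [Sm sm pm]] : exists m : seq X, [/\ forall a, a \in m -> short_root a,
    \sum_(a <- m) a = \sum_(a <- l) a & \prod_(a <- m) chi a = \prod_(a <- l) chi a].
  elim: l lN {suml} => [|h l IHl] lN; first by exists [::].
  have [|m [Sm sm pm]] := IHl; first by move=> a la; apply: lN; rewrite inE la orbT.
  have [|m1 [Sm1 sm1 pm1]] := chi_decomp (h := h); first by apply: lN; rewrite inE eqxx.
  exists (m1 ++ m); split.
  - by move=> a; rewrite mem_cat => /orP[/Sm1|/Sm].
  - by rewrite big_cat big_cons sm1 sm.
  - by rewrite big_cat big_cons pm1 pm.
have [|_] := chi_short_sum Sm; first by rewrite sm suml; apply: ar_V00 H.
have Na0 := Sa0.1.
by rewrite pm sm suml /g sub0r (rc_opp R) // divff // (rc_neq0 R).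
Qed.

End Connected.

End Characters.

Lemma longer_ratio a b : N a -> N b -> ~ par a b -> ~ (-1 <= cf a b <= 1) ->
  exists2 k : int, 2 <= k <= 3 & sq a = k%:~R * sq b.
Proof.
move=> Na Nb np long; have := nonparallelP H Na Nb np; rewrite /nonparallel_cf.
have E := ar_sq_cf H Na Nb => cfs.
have [m1|m1] : cf b a = 1 \/ cf b a = -1 by lia.
  by exists (cf a b); [lia | move: E; rewrite m1 mulr1 mulrC].
exists (- cf a b); first by lia.
by rewrite m1 mulrN1z mulrN1 in E; rewrite mulrNz mulNr mulrC E opprK.
Qed.

(** At most two lengths occur: a still shorter c0 would give (a, a) = k k' (c0, c0) with k k' >= 4.
    Replacing c0 by a reflected root c not orthogonal to a, <a, c^vee> would be at least 4 in
    absolute value. *)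
Lemma shorter_is_short a b : N a -> N b -> ~ par a b -> ~ (-1 <= cf a b <= 1) ->
  short_root b.
Proof.
move=> Na Nb npab long; split=> // c0 Nc0 np0; apply: contrapT => long0.
have [k k23 sqa] := longer_ratio Na Nb npab long.
have [k' k'23 sqb] := longer_ratio Nb Nc0 np0 long0.
have cfba : cf b a <> 0 by move=> /(ar_cf0 H Nb Na); lia.
have cfc0b : cf c0 b <> 0 by move=> /(ar_cf0 H Nc0 Nb); lia.
have [c [Nc sqc cfac]] : exists c, [/\ N c, sq c = sq c0 & cf a c <> 0].
  have [z|n0] := pselect (cf a c0 = 0); last by exists c0.
  exists (w b c0); split; [exact: Nw | exact: (sq_refl H Nb Nc0)|].
  move=> /(ar_cf0 H Na (Nw Nb Nc0)); rewrite /refl !(cfE H) (ar_cf0 H Na Nc0 z).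
  by move/eqP; rewrite sub0r oppr_eq0 mulf_eq0 => /orP[]/eqP.
have E : cf a c = k * k' * cf c a.
  apply: (@intr_inj K); apply: (mulfI (ar_sq0 H Nc)).
  by rewrite (ar_sq_cf H Na Nc) sqa sqb sqc !intrM; ring.
have cfca : cf c a <> 0 by move=> /(ar_cf0 H Nc Na).
have kk : 4 <= k * k' by nia.
by have := cf_bound H Nc (or_introl Na); rewrite E; nia.
Qed.

(** * Orthogonal short roots *)

Section TypeB.
Hypothesis orth : forall a b, short_root a -> short_root b -> par a b \/ cf a b = 0.

(** For a not short, a short b with <b, a^vee> = 1 yields the short root b - a, and a = b - (b - a).
    The value <a, b^vee> = 3, that of G2, is excluded: b and b - a would be neither parallel nor
    orthogonal. *)
Lemma short_or_sum a : N a -> short_root a \/ exists b c,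
  [/\ short_root b, short_root c, ~ par b c & a = b + c].
Proof.
move=> Na; have [|nSa] := pselect (short_root a); first by left.
right; have [b0 [Nb0 np0 long0]] : exists b, [/\ N b, ~ par a b & ~ (-1 <= cf a b <= 1)].
  apply: contrapT => nob; apply: nSa; split=> // b Nb np.
  by apply: contrapT => long; apply: nob; exists b.
have [b [Sb npab cf2 cf1]] : exists b, [/\ short_root b, ~ par a b, 2 <= cf a b & cf b a = 1].
  have Sb0 := shorter_is_short Na Nb0 np0 long0.
  have := nonparallelP H Na Nb0 np0; rewrite /nonparallel_cf => cfs.
  have [cf1|cf1] : cf b0 a = 1 \/ cf b0 a = -1 by lia.
    by exists b0; split=> //; lia.
  exists (- b0); split; rewrite ?(cfNl H) ?(ar_cfNr H) //; try lia.
    exact: shortN.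
  by move/(parallelNr H).
have [Nb _] := Sb.
have wE : w a b = b - a by rewrite /refl cf1.
have Sw : short_root (b - a) by rewrite -wE; apply: short_refl.
have cfw : cf (b - a) b = 2 - cf a b by rewrite (ar_cfB H) (ar_cfaa H).
have cfab : cf a b = 2.
  have bd := cf_bound H Nb (or_introl Na).
  have [//|cf3] : cf a b = 2 \/ cf a b = 3 by lia.
  have np : ~ par b (b - a) by apply: (cf_nonparallel H Nb Sw.1); rewrite cfw cf3.
  by case: (orth Sw Sb) => [/(parallel_sym H)//|]; rewrite cfw cf3.
exists b, (- (b - a)); split=> //; first exact: shortN.
  move/(parallelNr H); apply: (cf_nonparallel H Nb Sw.1).
  by rewrite cfw cfab.
by rewrite opprB subrKC.
Qed.

(** Irreducibility spreads the predicate [D]: c is parallel to e, or e + c is a root modulo V0. A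
    root that is not short is a sum b + d of short ones, and [Dsum] carries [D] from one summand to
    the other. *)
Lemma sum_root e e' : short_root e -> short_root e' -> ~ par e e' ->
  exists2 a, N a & V0 (a - (e + e')).
Proof.
move=> Se; have [Ne _] := Se.
pose E e' := exists2 a, N a & V0 (a - (e + e')).
have orth0 a b : short_root a -> short_root b -> ~ par a b -> cf a b = 0.
  by move=> Sa Sb np; case: (orth Sa Sb).
have EN c : short_root c -> ~ par e c -> E c -> E (- c).
  move=> Sc np [a Na V]; have [Nc _] := Sc.
  exists (w c a); first exact: Nw.
  have cfac : cf a c = 2.
    by rewrite (V0_cf H V Nc) (cfDl H) (ar_cfaa H) // orth0.
  by move: V; rewrite /refl cfac; congr V0; zmod_eq; ring.
pose D c := short_root c /\ (par e c \/ E c).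
have Dpar c d : D c -> short_root d -> par c d -> D d.
  move=> [Sc Dc] Sd pcd; split=> //.
  have [pec|npec] := pselect (par e c); first by left; apply: (parallel_trans H pec pcd).
  case: Dc => // Ec; right; case: pcd => V.
    by have [a Na V'] := Ec; exists a => //; move: (ar_V0B H V' V); congr V0; zmod_eq; ring.
  have [a Na V'] := EN c Sc npec Ec; exists a => //.
  by move: (ar_V0B H V' V); congr V0; zmod_eq; ring.
have Dsum c d : short_root c -> short_root d -> ~ par c d -> N (c + d) -> D c -> D d.
  move=> Sc Sd npcd Nh [_ Dc]; split=> //.
  have [ped|nped] := pselect (par e d); first by left.
  right; have [[Nc _] [Nd _]] := (Sc, Sd).
  have cfcd : cf c d = 0 by apply: orth0.
  have cfdc : cf d c = 0 by apply: (ar_cf0 H Nc Nd cfcd).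
  have Nh' : N (d - c).
    have := Nw Nc Nh; rewrite /refl (cfDl H) (ar_cfaa H) // cfdc.
    by congr N; zmod_eq; ring.
  have [pec|npec] := pselect (par e c).
    case: pec => V.
      by exists (c + d) => //; move: V; congr V0; zmod_eq; ring.
    by exists (d - c) => //; move: (V0N H V); congr V0; zmod_eq; ring.
  case: Dc => // -[a Na V].
  have cfac : cf a c = 2.
    by rewrite (V0_cf H V Nc) (cfDl H) (ar_cfaa H) // orth0.
  have cfad : cf a d = 0.
    by rewrite (V0_cf H V Nd) (cfDl H) orth0 // add0r.
  have npca : ~ par c a \/ par c a by have [|] := pselect (par c a); [right|left].
  have pos : 0 < cf c a.
    have [/(parallel_cf H Nc Na)|np] := pselect (par c a).
      case=> -[V1 cf2]; last by lia.
      by rewrite -(V0_cf H V1 Na) (ar_cfaa H).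
    by have := nonparallelP H Nc Na np; rewrite /nonparallel_cf cfac; lia.
  have neg : cf (d - c) a < 0.
    by rewrite (ar_cfB H) (ar_cf0 H Na Nd cfad); lia.
  have Vad : V0 (d - c + a - (e + d)).
    by move: V; congr V0; zmod_eq; ring.
  (* Modulo V0, e + d = (d - c) + (e + c), where a represents e + c and pairs negatively with d -
     c. *)
  exists (d - c + a) => //.
  apply: (Rt_notV0 H); first by apply: (RtD H Na _ neg); left.
  move=> V2; have := ar_V0cf H V2 Nd.
  by rewrite (V0_cf H Vad Nd) (cfDl H) orth0 // (ar_cfaa H).
have Dall : forall h, N h -> exists2 c, D c & cf c h <> 0.
  apply: (ir_connected H2 (Q := fun h => exists2 c, D c & cf c h <> 0)).
    exists e => //; exists e; last by rewrite (ar_cfaa H).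
    by split=> //; left; left; rewrite subrr; apply: ar_V00 H.
  move=> h k Nh Nk [c Dc n0] n1; have [[Nc _] _] := Dc.
  case: (short_or_sum Nh) => [Sh|[b [d [Sb Sd npbd hE]]]].
    have pch : par c h by case: (orth Dc.1 Sh).
    exists c => // z; apply: n1; case: (cf_parallel H pch Nk); rewrite z ?oppr0 //.
  have [[Nb _] [Nd _]] := (Sb, Sd).
  have [Db Dd] : D b /\ D d.
    have nhc : cf h c <> 0 by move=> /(ar_cf0 H Nh Nc).
    have [pbc|npbc] := pselect (par b c).
      have Db : D b by apply: (Dpar c) => //; apply: (parallel_sym H pbc).
      by split=> //; apply: (Dsum b d) => //; rewrite -hE.
    have pdc : par d c.
      have [//|z] := orth Sd Dc.1.
      by case: nhc; rewrite hE (cfDl H) z (orth0 _ _ Sb Dc.1 npbc).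
    have Dd : D d by apply: (Dpar c) => //; apply: (parallel_sym H pdc).
    split=> //; apply: (Dsum d b) => //; last by rewrite addrC -hE.
    by move=> /(parallel_sym H).
  have [z|n2] := pselect (cf b k = 0); last by exists b.
  exists d => // z'; apply: n1.
  by rewrite hE (cfDl H) z z'.
move=> Se' np; have [c Dc n0] := Dall e' Se'.1.
have pce' : par c e' by case: (orth Dc.1 Se').
by case: (Dpar c e' Dc Se' pce') => _ [|].
Qed.

End TypeB.

End ShortRoots.

(** The relations make the product of chi over a list depend only on its sum, so chi extends to a
    homomorphism of Z^n. Choosing square roots of its values on the standard basis gives phi. *)
Lemma character_sqrt (K : numClosedFieldType) (n : nat) (N : set 'rV[int]_n)
    (chi : 'rV[int]_n -> K) :
  (forall a, N a -> [/\ N (- a), chi a != 0 & chi (- a) = (chi a)^-1]) ->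
  (forall v, exists2 l : seq 'rV[int]_n,
     forall a, a \in l -> N a & \sum_(a <- l) a = v) ->
  (forall l : seq 'rV[int]_n, (forall a, a \in l -> N a) ->
     \sum_(a <- l) a = 0 -> \prod_(a <- l) chi a = 1) ->
  exists phi : 'rV[int]_n -> K, [/\ forall a, phi a != 0,
    forall a b, phi (a + b) = phi a * phi b & forall a, N a -> phi a ^+ 2 = chi a].
Proof.
move=> HN span rel.
pose l v := projT1 (cid2 (span v)).
have lN v a : a \in l v -> N a by rewrite /l; case: cid2 => /= s sN _; apply: sN.
have lS v : \sum_(a <- l v) a = v by rewrite /l; case: cid2.
have uniq_prod l1 l2 : (forall a, a \in l1 -> N a) -> (forall a, a \in l2 -> N a) ->
    \sum_(a <- l1) a = \sum_(a <- l2) a -> \prod_(a <- l1) chi a = \prod_(a <- l2) chi a.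
  move=> l1N l2N eq_sum.
  have := rel (l1 ++ map -%R l2); rewrite !big_cat /= !big_map sumrN eq_sum subrr.
  rewrite [X in _ * X](eq_big_seq (fun a => (chi a)^-1)); last first.
    by move=> a /l2N /HN[].
  have p0 : \prod_(a <- l2) chi a != 0.
    by rewrite prodf_seq_neq0; apply/allP => a /l2N /HN[].
  rewrite prodfV => E; apply: (mulIf (invr_neq0 p0)); rewrite divff // E //.
  move=> a; rewrite mem_cat => /orP[/l1N//|/mapP[b /l2N Nb ->]].
  by have [] := HN b Nb.
pose chih v := \prod_(a <- l v) chi a.
have chihD u v : chih (u + v) = chih u * chih v.
  rewrite /chih -big_cat; apply: uniq_prod; first exact: lN.
    by move=> a; rewrite mem_cat => /orP[] /lN.
  by rewrite big_cat /= !lS.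
have chih_neq0 v : chih v != 0.
  by rewrite /chih prodf_seq_neq0; apply/allP => a /lN /HN[].
have chih0 : chih 0 = 1.
  by apply: (mulfI (chih_neq0 0)); rewrite -chihD addr0 mulr1.
have chihM v (k : nat) : chih (v *+ k) = chih v ^+ k.
  by elim: k => [|k IHk]; rewrite ?chih0 // mulrS chihD IHk exprS.
have chihZ v (k : int) : chih (v *~ k) = chih v ^ k.
  case: k => k; first by rewrite -pmulrn chihM.
  rewrite NegzE mulrNz -pmulrn -invr_expz; apply: (mulIf (chih_neq0 (v *+ k.+1))).
  by rewrite -chihD addNr chih0 chihM -exprnP mulVf // expf_neq0.
have chihN a : N a -> chih a = chi a.
  move=> Na; rewrite /chih (uniq_prod _ [:: a]) ?big_seq1 //; first exact: lN.
  by move=> b; rewrite inE => /eqP ->.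
pose r j := sqrtC (chih (delta_mx 0 j)).
have r0 j : r j != 0 by rewrite sqrtC_eq0.
exists (fun v => \prod_(j < n) r j ^ v 0 j); split=> [v|u v|a Na].
- by apply/prodf_neq0 => j _; rewrite expfz_neq0.
- by rewrite -big_split; apply: eq_bigr => j _; rewrite mxE expfzDr.
rewrite -chihN // [in RHS](row_sum_delta a) -prodrXl.
rewrite (big_morph chih chihD chih0); apply: eq_bigr => j _.
rewrite -[in RHS](intz (a 0 j)) scaler_int chihZ -[in RHS](sqrtCK (chih _)) -/(r j).
by rewrite !exprnP !exprz_exp mulrC.
Qed.

(** * Extended affine Lie algebras *)

Section EalaBasics.
Variables (R : realType) (E : eala_data R).
Hypothesis HE : is_eala E.

Notation "[< x , y >]" := (bracket E x y).
Notation "( x ; y )" := (bform E x y) (at level 0).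
Notation incl := (cartan_incl E).
Notation rs := (@root_space R E).
Notation ecore := (@core R E).
Notation K := (R[i]).
Implicit Types (a b s : HHdual E) (x y z : E).

Let A1 : eala_A1 E. Proof. by case: HE => -[]. Qed.
Let A2 : eala_A2 E. Proof. by case: HE => -[_ []]. Qed.
Let A3 : eala_A3 E. Proof. by case: HE => -[_ []]. Qed.
Let A4 : eala_A4 E. Proof. by case: HE => _ []. Qed.
Let A5 : eala_A5 E. Proof. by case: HE => _ [_ []]. Qed.
Let A6 : eala_A6 E. Proof. by case: HE => _ [_ []]. Qed.

Lemma ebrxx x : [<x, x>] = 0.
Proof. by have [[brxx _] _ _ _] := A1. Qed.

Lemma ebr_anti x y : [<x, y>] = - [<y, x>].
Proof.
apply/eqP; rewrite -addr_eq0; apply/eqP; have := ebrxx (x + y).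
by rewrite linearDl !linearDr !ebrxx add0r addr0.
Qed.

Lemma ejacobi x y z : [<x, [<y, z>]>] = [<[<x, y>], z>] + [<y, [<x, z>]>].
Proof.
have [[_ jac] _ _ _] := A1; have := jac x y z.
rewrite [ [<z, [<x, y>]>] ]ebr_anti [ [<z, x>] ]ebr_anti linearNr.
move/(canRL (subrK _)); rewrite add0r => /(canRL (subrK _)) ->.
by [].
Qed.

Lemma eform_sym x y : (x; y) = (y; x).
Proof. by have [_ -> _ _] := A1. Qed.

Lemma eform_inv x y z : ([<x, y>]; z) = (x; [<y, z>]).
Proof. by have [_ _ -> _] := A1. Qed.

Lemma ebrZl c x y : [<c *: x, y>] = c *: [<x, y>].
Proof. by rewrite linearZl_LR. Qed.

Lemma ebrZr c x y : [<x, c *: y>] = c *: [<x, y>].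
Proof. by rewrite linearZr_LR. Qed.

Lemma eformZl c x y : (c *: x; y) = c * (x; y).
Proof. by rewrite linearZl_LR. Qed.

Lemma eformZr c x y : (x; c *: y) = c * (x; y).
Proof. by rewrite linearZr_LR. Qed.

Lemma rs0 a : rs a 0.
Proof. by move=> h; rewrite linear0r scaler0. Qed.

Lemma rsD a x y : rs a x -> rs a y -> rs a (x + y).
Proof. by move=> ax ay h; rewrite linearDr ax ay scalerDr. Qed.

Lemma rsZ a c x : rs a x -> rs a (c *: x).
Proof. by move=> ax h; rewrite linearZr_LR ax !scalerA mulrC. Qed.

Lemma rsN a x : rs a x -> rs a (- x).
Proof. by move=> ax; rewrite -scaleN1r; apply: rsZ. Qed.

Lemma rs_br a b x y : rs a x -> rs b y -> rs (a + b) [<x, y>].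
Proof.
move=> ax bx h; rewrite ejacobi ax bx linearZl_LR linearZr_LR -scalerDl.
by rewrite lfunE.
Qed.

Lemma incl0 h : rs 0 (incl h).
Proof. by have [_ _ _ _ ->] := A2; exists h. Qed.

Lemma rs0E x : rs 0 x -> exists h, x = incl h.
Proof. by have [_ _ _ _ ->] := A2; case=> h _ <-; exists h. Qed.

Lemma lfun_neq0 a : a != 0 -> exists h, a h != 0.
Proof.
move=> a0; apply: contrapT => noh; move/eqP: a0; apply.
by apply/lfunP => h; rewrite lfunE /=; apply/eqP/negPn/negP => ah; apply: noh; exists h.
Qed.

Lemma form_orth a b x y : rs a x -> rs b y -> a + b != 0 -> (x; y) = 0.
Proof.
move=> ax bx /lfun_neq0[h]; rewrite lfunE /= => hab.
have : (a h + b h) * (x; y) = 0.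
  rewrite mulrDl -eformZl -ax -eformZr -bx -eform_inv.
  by rewrite ebr_anti linearNl addNr.
by move/eqP; rewrite mulf_eq0 (negPf hab) => /eqP.
Qed.

Lemma form_rs_nondeg a x : rs a x -> x != 0 ->
  exists y, rs (- a) y /\ (x; y) != 0.
Proof.
move=> ax x0; apply: contrapT => noy; move/eqP: x0; apply.
have [_ _ _ nd] := A1; apply: nd => y.
have [_ _ _ dec _] := A2; have [r [f [fP ->]]] := dec y.
rewrite linear_sumr big1_seq // => b _.
have [ab|ab] := eqVneq (a + b) 0; last exact: (form_orth ax (fP b)).
apply/eqP/negPn/negP => n0; apply: noy; exists (f b); split=> //.
by have -> : - a = b; [apply/eqP; rewrite eq_sym -addr_eq0 addrC ab | apply: fP].
Qed.

Lemma cartan_nondeg h : (forall h', (incl h; incl h') = 0) -> h = 0.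
Proof.
move=> hh'; have [inj _ _ _ _] := A2; apply: inj; rewrite linear0.
apply/eqP/negPn/negP => n0; have [y []] := form_rs_nondeg (incl0 h) n0.
by rewrite oppr0 => /rs0E[h' ->]; rewrite hh' eqxx.
Qed.

(** The form is nondegenerate on the Cartan subalgebra, which is the root space of 0 and is
    orthogonal to the others. Hence the map t |-> (., t) to the dual is injective, and surjective by
    dimension. *)
Lemma t_P a h : a h = (incl h; incl (t_ a)).
Proof.
have lin t : linear (fun h => (incl h; incl t) : K^o).
  by move=> c u v; rewrite linearP linearDl eformZl.
pose F t : {linear cartan E -> K^o} :=
  HB.pack (fun h => (incl h; incl t) : K^o) (GRing.isLinear.Build _ _ _ _ _ (lin t)).
have linF : linear (fun t => linfun (F t)).
  move=> c u v; apply/lfunP => h'; rewrite add_lfunE scale_lfunE !lfunE /=.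
  by rewrite linearP linearDr eformZr.
pose Phi := linfun (HB.pack (fun t => linfun (F t))
  (GRing.isLinear.Build _ _ _ _ _ linF) : {linear cartan E -> HHdual E}).
have PhiE t : Phi t = linfun (F t) by rewrite lfunE.
have ker0 : lker Phi == 0%VS.
  apply/lker0P => u v; rewrite !PhiE => /lfunP eq_uv; apply/eqP.
  rewrite -subr_eq0; apply/eqP/cartan_nondeg => h'; rewrite eform_sym.
  have := eq_uv h'; rewrite !lfunE /= => E1.
  by rewrite linearB linearBr E1 subrr.
have img : limg Phi = fullv.
  apply/eqP; rewrite eqEdim subvf /= limg_dim_eq; last first.
    by move/eqP: ker0 => ->; rewrite capv0.
  by rewrite !dimvf /dim /= muln1.
have : a \in limg Phi by rewrite img memvf.
case/memv_imgP => t _ aE; move: h.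
apply: (xgetPex 0 (P := [set t | forall h, a h = (incl h; incl t)])).
by exists t => h; rewrite aE PhiE lfunE.
Qed.

Lemma dformE a b : dform a b = b (t_ a).
Proof. by rewrite t_P. Qed.

Lemma dform_sym a b : dform a b = dform b a.
Proof. exact: eform_sym. Qed.

Lemma dformDr a b c : dform a (b + c) = dform a b + dform a c.
Proof. by rewrite !dformE add_lfunE. Qed.

Lemma dformZr c a b : dform a (c *: b) = c * dform a b.
Proof. by rewrite !dformE scale_lfunE. Qed.

Lemma dformDl a b c : dform (a + b) c = dform a c + dform b c.
Proof. by rewrite dform_sym dformDr !(dform_sym c). Qed.

Lemma dformZl c a b : dform (c *: a) b = c * dform a b.
Proof. by rewrite dform_sym dformZr dform_sym. Qed.

Lemma dformNr a b : dform a (- b) = - dform a b.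
Proof. by rewrite -scaleN1r dformZr mulN1r. Qed.

Lemma dformNl a b : dform (- a) b = - dform a b.
Proof. by rewrite -scaleN1r dformZl mulN1r. Qed.

Lemma dformBl a b c : dform (a - b) c = dform a c - dform b c.
Proof. by rewrite dformDl dformNl. Qed.

Lemma dformBr a b c : dform c (a - b) = dform c a - dform c b.
Proof. by rewrite dformDr dformNr. Qed.

Lemma dformMzr a b (n : int) : dform a (b *~ n) = n%:~R * dform a b.
Proof. by rewrite -scaler_int dformZr. Qed.

Lemma dformMzl a b (n : int) : dform (a *~ n) b = n%:~R * dform a b.
Proof. by rewrite -scaler_int dformZl. Qed.

Lemma dformMnr a b n : dform a (b *+ n) = n%:R * dform a b.
Proof. by rewrite -scaler_nat dformZr. Qed.

Lemma dformMnl a b n : dform (a *+ n) b = n%:R * dform a b.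
Proof. by rewrite -scaler_nat dformZl. Qed.

Lemma dform0l a : dform 0 a = 0.
Proof. by rewrite -(scale0r a) dformZl mul0r. Qed.

Lemma br_rs_opp a x y : rs a x -> rs (- a) y -> [<x, y>] = (x; y) *: incl (t_ a).
Proof.
move=> ax ay; have := rs_br ax ay; rewrite subrr => /rs0E[k kE].
rewrite kE; suff -> : k = (x; y) *: t_ a by rewrite linearZ.
apply/eqP; rewrite -subr_eq0; apply/eqP/cartan_nondeg => h.
rewrite eform_sym linearB linearBr linearZ eformZr -t_P -kE.
by rewrite -eform_inv (ax h) eformZl mulrC subrr.
Qed.

Lemma root_N a : root_system a -> root_system (- a).
Proof.
case=> x [x0 ax]; have [y [ay xy]] := form_rs_nondeg ax x0.
by exists y; split=> //; apply: contra_neq xy => ->; rewrite linear0r.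
Qed.

Lemma noniso_N a : noniso_roots a -> noniso_roots (- a).
Proof.
case=> Ra na; split; first exact: root_N.
by case=> _; rewrite dformNl dformNr opprK => d0; apply: na.
Qed.

Lemma noniso_neq0 a : noniso_roots a -> dform a a != 0.
Proof. by case=> Ra na; apply/eqP => d0; apply: na. Qed.

Lemma nonisoP a : root_system a -> dform a a != 0 -> noniso_roots a.
Proof. by move=> Ra d0; split=> // -[_ /eqP]; rewrite (negPf d0). Qed.

Definition ip b a : K := 2 * dform b a / dform a a.

Lemma ipDl a b c : ip (b + c) a = ip b a + ip c a.
Proof. by rewrite /ip dformDl mulrDr mulrDl. Qed.

Lemma ipZl a b c : ip (c *: b) a = c * ip b a.
Proof. by rewrite /ip dformZl; ring. Qed.

Lemma ipNl a b : ip (- b) a = - ip b a.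
Proof. by rewrite -scaleN1r ipZl mulN1r. Qed.

Lemma ipNr a b : ip b (- a) = - ip b a.
Proof. by rewrite /ip dformNl !dformNr opprK; ring. Qed.

Lemma ip_id a : noniso_roots a -> ip a a = 2.
Proof. by move=> /noniso_neq0 d0; rewrite /ip mulfK. Qed.

Lemma coroot_br a b y : rs b y -> [<coroot a, y>] = ip b a *: y.
Proof.
move=> by_; rewrite by_; congr (_ *: _).
by rewrite linearZ /= -dformE dform_sym; apply: mulrAC.
Qed.

Lemma sl2_opp a x : noniso_roots a -> rs a x -> x != 0 ->
  exists y, rs (- a) y /\ [<x, y>] = coroot a.
Proof.
move=> Na ax x0; have [y [ay xy]] := form_rs_nondeg ax x0.
exists ((2 / dform a a / (x; y)) *: y); split; first exact: rsZ.
by rewrite (br_rs_opp ax (rsZ _ ay)) eformZr divfK // /coroot linearZ.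
Qed.

(** Local nilpotency of ad e gives a last nonzero e^k v, a highest weight vector whose weight m is a
    natural number; the iterates of f on it supply the roots. *)
Lemma weight_string a b v : noniso_roots a -> rs b v -> v != 0 ->
  exists k m : nat, ip b a = m%:R - k%:R *+ 2 /\
    forall j, (j <= m)%N -> root_system (b + a *+ k - a *+ j).
Proof.
move=> Na bv v0; have [[e [e0 ae]] _] := Na.
have [f [af ef]] := sl2_opp Na ae e0.
have ex : exists n, iter n (bracket E e) v == 0.
  by have [n en] := A3 Na ae v; exists n; rewrite en.
case: (ex_minnP ex) => [[|k]] /eqP ek min; first by rewrite -ek eqxx in v0.
pose u := iter k (bracket E e) v.
have u0 : u != 0 by apply/negP => /min; rewrite ltnn.
have rs_iter c z y j : rs c z -> rs b y -> rs (b + c *+ j) (iter j (bracket E z) y).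
  move=> cz by_; elim: j => [|j IHj]; first by rewrite addr0.
  by rewrite mulrS addrCA iterS; apply: rs_br.
have rsu : rs (b + a *+ k) u by apply: rs_iter.
pose wt (l : K) y := exists2 c, rs c y & l = ip c a.
have brZ z c y : bracket E z (c *: y) = c *: bracket E z y by apply: ebrZr.
have wt_f l y : wt l y -> wt (l - 2) (bracket E f y).
  case=> c cy ->; exists (- a + c); first exact: rs_br.
  by rewrite ipDl ipNl ip_id // addrC.
have wt_ef l y : wt l y -> bracket E e (bracket E f y) = bracket E f (bracket E e y) + l *: y.
  by case=> c cy ->; rewrite ejacobi ef (coroot_br a cy) addrC.
have wtu : wt (ip (b + a *+ k) a) u by exists (b + a *+ k).
have [n' fn'] := A3 (noniso_N Na) af u.
have [m [lm nz]] := highest_weight_nat (brZ e) (brZ f) wt_f wt_ef wtu u0 ek fn'.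
exists k, m; split.
  rewrite -lm ipDl -scaler_nat ipZl ip_id //; ring.
move=> j le_jm; exists (iter j (bracket E f) u); split; first exact: nz.
elim: {le_jm} j => [|j IHj]; first by rewrite subr0.
by rewrite mulrS opprD addrCA iterS; apply: rs_br.
Qed.

Lemma ip_int a b : noniso_roots a -> root_system b -> exists n : int, ip b a = n%:~R.
Proof.
move=> Na [v [v0 bv]]; have [k [m [-> _]]] := weight_string Na bv v0.
by exists (m%:Z - k%:Z *+ 2); rewrite intrB -mulrz_nat; congr (_ - _); rewrite rmorphMn.
Qed.

Lemma root_string a b (n : int) (j : nat) : noniso_roots a -> root_system b ->
  ip b a = n%:~R -> j%:Z <= n -> root_system (b - a *+ j).
Proof.
move=> Na [v [v0 bv]] ipE le_jn; have [k [m [ipE' Rj]]] := weight_string Na bv v0.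
have nE : n = m%:Z - k%:Z * 2.
  by apply: (@intr_inj K); rewrite -ipE ipE' intrB intrM; ring.
have -> : b - a *+ j = b + a *+ k - a *+ (j + k) by zmod_eq; lia.
by apply: Rj; lia.
Qed.

Lemma noniso_refl a b (n : int) : noniso_roots a -> noniso_roots b ->
  ip b a = n%:~R -> noniso_roots (b - a *~ n).
Proof.
move=> Na Nb ipE; have Rb := Nb.1; apply: nonisoP.
  have [n0|n0] := lerP 0 n.
    have -> : b - a *~ n = b - a *+ `|n|%N by zmod_eq; lia.
    by apply: (root_string Na Rb ipE); lia.
  have -> : b - a *~ n = b - (- a) *+ `|n|%N by zmod_eq; lia.
  have ipE' : ip b (- a) = (- n)%:~R by rewrite ipNr ipE mulrNz.
  by apply: (root_string (noniso_N Na) Rb ipE'); lia.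
have d0 := noniso_neq0 Na.
have dE : dform b a = n%:~R * dform a a / 2.
  by rewrite -ipE /ip divfK // mulrC mulKf // pnatr_eq0.
have -> : dform (b - a *~ n) (b - a *~ n) = dform b b.
  rewrite dformBl !dformBr !dformMzl !dformMzr (dform_sym a b) dE.
  by field.
exact: noniso_neq0.
Qed.

(** Subtract from y the multiple of x with the same pairing against f. The difference is killed by f
    and has weight 2, but a nonzero lowest weight vector has weight at most 0. *)
Lemma root_space_line a x y : noniso_roots a -> rs a x -> x != 0 -> rs a y ->
  exists c, y = c *: x.
Proof.
move=> Na ax x0 ay; have [f [af xf]] := sl2_opp Na ax x0.
have d0 := noniso_neq0 Na.
have xf0 : (x; f) != 0.
  have : [<coroot a, x>] != 0.
    by rewrite (coroot_br a ax) ip_id // scaler_eq0 pnatr_eq0.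
  rewrite -xf (br_rs_opp ax af); apply: contra_neq => ->.
  by rewrite scale0r linear0l.
exists ((y; f) / (x; f)); apply/eqP; rewrite -subr_eq0; set z := _ - _.
have az : rs a z by apply: rsD => //; apply: rsN; apply: rsZ.
have zf : [<f, z>] = 0.
  rewrite ebr_anti (br_rs_opp az af) /z linearBl eformZl divfK // subrr.
  by rewrite scale0r oppr0.
apply/negPn/negP => z0.
pose wt (l : K) v := exists2 c, rs c v & l = - ip c a.
have brZ u c v : bracket E u (c *: v) = c *: bracket E u v by apply: ebrZr.
have wt_f l v : wt l v -> wt (l - 2) (bracket E x v).
  case=> c cv ->; exists (a + c); first exact: rs_br.
  by rewrite ipDl ip_id //; ring.
have wt_ef l v : wt l v -> bracket E f (bracket E x v) = bracket E x (bracket E f v) + l *: v.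
  case=> c cv ->; rewrite [in RHS]ejacobi xf (coroot_br a cv) scaleNr.
  by rewrite addrAC subrr add0r.
have wtz : wt (- 2) z by exists a; rewrite ?ip_id.
have [n xn] := A3 Na ax z.
have [m [E2 _]] := highest_weight_nat (brZ f) (brZ x) wt_f wt_ef wtz z0 zf xn.
have : (0 : K) <= - 2 by rewrite E2 ler0n.
by rewrite oppr_ge0 lern0.
Qed.

(* The Heisenberg algebra spanned by x, y and t_s has no finite-dimensional
   module on which t_s is invertible. *)
Lemma heisenberg_string b s x y v : dform s s = 0 -> dform s b != 0 ->
  rs s x -> rs (- s) y -> (x; y) != 0 -> rs b v -> v != 0 ->
  (forall k, root_system (b + (- s) *+ k)) \/
  exists k0, forall k, root_system (b - s *+ k0 + s *+ k).
Proof.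
move=> ss0 sb0 sx sy xy bv v0.
have [yv0|] := pselect (forall k, iter k (bracket E y) v != 0).
  left=> k; exists (iter k (bracket E y) v); split; first exact: yv0.
  elim: k => [|k IHk]; first by rewrite addr0.
  by rewrite mulrS addrCA iterS; apply: rs_br.
move=> /existsNP[k1 /negP/negPn k1P]; right.
have ex : exists k, iter k (bracket E y) v == 0 by exists k1.
case: (ex_minnP ex) => [[|k]] /eqP yk min; first by rewrite -yk eqxx in v0.
pose u := iter k (bracket E y) v.
have u0 : u != 0 by apply/negP => /min; rewrite ltnn.
have rsu : rs (b - s *+ k) u.
  rewrite /u -mulNrn; elim: (k) => [|j IHj]; first by rewrite addr0.
  by rewrite mulrS addrCA iterS; apply: rs_br.
have rsxu j : rs (b - s *+ k + s *+ j) (iter j (bracket E x) u).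
  elim: j => [|j IHj]; first by rewrite addr0.
  by rewrite mulrS addrCA iterS; apply: rs_br.
exists k => j; exists (iter j (bracket E x) u); split=> //.
pose c := - ((x; y) * dform s b).
have c0 : c != 0 by rewrite oppr_eq0 mulf_neq0.
have yx i z : rs (b - s *+ k + s *+ i) z -> [<y, [<x, z>]>] = [<x, [<y, z>]>] + c *: z.
  move=> bz; rewrite ejacobi addrC; congr (_ + _).
  rewrite [X in bracket E X _]ebr_anti linearNl (br_rs_opp sx sy) ebrZl bz -dformE.
  rewrite dformDr dformBr !dformMnr ss0 !mulr0 subr0 addr0.
  by rewrite scalerA -scaleNr.
have yxu i : [<y, iter i.+1 (bracket E x) u>] = (i.+1%:R * c) *: iter i (bracket E x) u.
  elim: i => [|i IHi].
    have yu : [<y, u>] = 0 by exact: yk.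
    by rewrite /= (yx 0%N) ?addr0 // yu linear0r add0r mul1r.
  rewrite [iter i.+2 _ _]iterS (yx i.+1) // IHi ebrZr -iterS -scalerDl.
  by congr (_ *: _); rewrite -[in RHS]natr1; ring.
elim: j => [//|j IHj]; apply: contra_neq IHj => xj0.
have := yxu j; rewrite xj0 linear0r => /esym/eqP.
by rewrite scaler_eq0 mulf_eq0 pnatr_eq0 (negPf c0) => /eqP.
Qed.

(** Otherwise [heisenberg_string] gives an infinite string of roots b + k t with (t, t) = 0 and (t,
    b) nonzero. Its squared length q k is affine in k, against the integrality of 2 (t, b) / q k. *)
Lemma iso_orth a s : noniso_roots a -> iso_roots s -> dform s a = 0.
Proof.
move=> Na [Rs ss0]; apply/eqP/negPn/negP => sa0.
have [x [x0 sx]] := Rs; have [y [sy xy]] := form_rs_nondeg sx x0.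
have [[v [v0 av]] _] := Na.
have [b [t [Rbt tt0 tb0 Rt]]] : exists b t, [/\ forall k : nat, root_system (b + t *+ k),
    dform t t = 0, dform t b != 0 & root_system t].
  case: (heisenberg_string ss0 sa0 sx sy xy av v0) => [str|[k0 str]].
    exists a, (- s); split=> //; rewrite ?dformNl ?dformNr ?ss0 ?oppr0 ?oppr_eq0 //.
    exact: root_N.
  exists (a - s *+ k0), s; split=> //.
  by rewrite dformBr dformMnr ss0 mulr0 subr0.
pose q k := dform b b + 2 * k%:R * dform t b.
have qE k : dform (b + t *+ k) (b + t *+ k) = q k.
  rewrite dformDl !dformDr !dformMnr !dformMnl (dform_sym b t) tt0 /q; ring.
have nP k : q k != 0 -> exists2 n : int, n != 0 & n%:~R * q k = 2 * dform t b.
  move=> qk0; have Nb : noniso_roots (b + t *+ k) by apply: nonisoP; rewrite ?qE.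
  have [n] := ip_int Nb Rt.
  rewrite /ip qE dformDr dformMnr tt0 mulr0 addr0 => nE.
  exists n; last by rewrite -nE divfK.
  have : 2 * dform t b / q k != 0 by rewrite !mulf_neq0 ?invr_neq0 ?pnatr_eq0.
  by rewrite nE intr_eq0.
(* q vanishes at most once, so one of the pairs (0, 3), (1, 4) works. The gap 3 leads to n' (1 + 3
   n) = n, impossible for n nonzero; gaps 1 and 2 would admit n = -2 and n = -1. *)
have [k qk qk3] : exists2 k, q k != 0 & q (k + 3)%N != 0.
  have qD i j : q i = 0 -> q j = 0 -> i = j.
    move=> qi qj; have : (i%:R - j%:R) * (2 * dform t b) = 0.
      by transitivity (q i - q j); [rewrite /q; ring | rewrite qi qj subrr].
    move/eqP; rewrite !mulf_eq0 (negPf tb0) pnatr_eq0 /= orbF subr_eq0 eqr_nat.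
    by move/eqP.
  have [q0|q0] := eqVneq (q 0%N) 0.
    exists 1%N; apply/eqP => /qD E1; by have := E1 _ q0.
  have [q3|q3] := eqVneq (q 3%N) 0; last by exists 0%N.
  by exists 1%N; apply/eqP => /qD E1; have := E1 _ q3.
have [n n0 nE] := nP _ qk; have [n' n'0 n'E] := nP _ qk3.
have q3E : q (k + 3)%N = q k + 3 * (2 * dform t b) by rewrite /q natrD; ring.
have : n' * (1 + 3 * n) = n.
  apply: (@intr_inj K); apply: (mulIf qk); rewrite nE -n'E q3E -nE !(intrM, intrD).
  by ring.
nia.
Qed.

Lemma core_lie_subalgebra : @lie_subalgebra R E ecore.
Proof.
split=> [S [[]]//|x y cx cy S HS|c x cx S HS|x y cx cy S HS].
- by have [[_ D _ _] _] := HS; apply: D; [apply: cx | apply: cy].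
- by have [[_ _ Z _] _] := HS; apply: Z; apply: cx.
- by have [[_ _ _ B] _] := HS; apply: B; [apply: cx | apply: cy].
Qed.

Lemma core_rs a x : noniso_roots a -> rs a x -> ecore x.
Proof. by move=> Na ax S [_]; apply; exists a. Qed.

Lemma core_min (S : set E) : lie_subalgebra S ->
  (forall a x, noniso_roots a -> rs a x -> S x) -> ecore `<=` S.
Proof.
by move=> HS HR x; apply; split=> // y [a Na ay]; apply: HR ay.
Qed.

(** Here tameness enters. If s is isolated, E_s and E_(-s) centralize the core, so E_s lies in the
    core. But a centralizing y in E_(-s) is orthogonal to the whole core, against nondegeneracy. *)
Lemma iso_nonisolated s : (exists a, noniso_roots a) -> iso_roots s ->
  exists2 a, noniso_roots a & noniso_roots (a + s).
Proof.
move=> [a0 Na0] Is; have [[x [x0 sx]] ss0] := Is.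
apply: contrapT => isolated.
have noroot a : noniso_roots a -> ~ root_system (a + s).
  move=> Na Ras; apply: isolated; exists a => //; apply: nonisoP => //.
  rewrite dformDl !dformDr ss0 (dform_sym a s) (iso_orth Na Is) !addr0.
  exact: noniso_neq0.
have noroot' a : noniso_roots a -> ~ root_system (a - s).
  move=> Na /root_N; rewrite opprB addrC.
  exact/noroot/noniso_N.
have central t z : rs t z -> (forall a, noniso_roots a -> ~ root_system (a + t)) ->
    forall u, ecore u -> [<z, u>] = 0.
  move=> tz notR; apply: core_min.
    split=> [|u v zu zv|c u zu|u v zu zv] /=.
    - by rewrite linear0r.
    - by rewrite linearDr zu zv addr0.
    - by rewrite ebrZr zu scaler0.
    - by rewrite ejacobi zu zv linear0l linear0r addr0.
  move=> a u Na au /=; apply/eqP/negPn/negP => n0; apply: (notR a Na).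
  by exists [<z, u>]; split=> //; rewrite addrC; apply: rs_br.
have cx : ecore x by apply: A4; apply: central sx noroot.
have [y [sy /eqP]] := form_rs_nondeg sx x0; apply.
have cy := central _ _ sy noroot'.
suff /(_ x cx)[_] : ecore `<=` [set u | ecore u /\ (u; y) = 0] by [].
have [c0 cD cZ cB] := core_lie_subalgebra.
apply: core_min.
  split=> [|u v [cu uy] [cv vy]|c u [cu uy]|u v [cu uy] [cv vy]] /=.
  - by rewrite linear0l.
  - by split; [apply: cD | rewrite linearDl uy vy addr0].
  - by split; [apply: cZ | rewrite eformZl uy mulr0].
  - by split; [apply: cB | rewrite eform_inv ebr_anti cy // oppr0 linear0r].
move=> a u Na au; split; first exact: core_rs au.
apply: (form_orth au sy); rewrite subr_eq0; apply/eqP => as_.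
by move: (noniso_neq0 Na); rewrite as_ ss0 eqxx.
Qed.

End EalaBasics.

(** * The roots of E modulo the isotropic directions *)

Section RootsModuloV0.
Variables (R : realType) (E : eala_data R) (l : nat) (dotR : set (HHdual E)).
Hypotheses (HE : is_eala E) (Hred : reduced_type E) (Hrank : eala_rank E l).
Hypotheses (l1 : (1 < l)%N) (Hfin : finite_part dotR).

Notation "[< x , y >]" := (bracket E x y).
Notation rs := (@root_space R E).
Notation ecore := (@core R E).
Notation K := (R[i]).
Notation root := (@root_system R E).
Notation noniso := (@noniso_roots R E).
Notation V0 := (@realV0 R E).
Notation V := (@Defs.realV R E).

Section RealSpan.
Variable W : lmodType K.
Implicit Types (A S : set W).

Lemma Rspan_incl A : A `<=` Rspan A.
Proof. exact: sub_gen_smallest. Qed.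

Lemma Rspan_min A S : real_subspace S -> A `<=` S -> Rspan A `<=` S.
Proof. by move=> HS AS; apply: smallest_sub. Qed.

Lemma Rspan_subspace A : real_subspace (Rspan A).
Proof.
split=> [S [[S0]]//|x y Sx Sy S HS|r x Sx S HS].
  by have [[_ D _] _] := HS; apply: D; [apply: Sx | apply: Sy].
by have [[_ _ Z] _] := HS; apply: Z; apply: Sx.
Qed.

Lemma subspaceB S x y : real_subspace S -> S x -> S y -> S (x - y).
Proof.
move=> [S0 SD SZ] Sx Sy; apply: SD => //.
by have := SZ (-1) y Sy; rewrite rmorphN rmorph1 scaleN1r.
Qed.

Lemma subspaceMz S x (n : int) : real_subspace S -> S x -> S (x *~ n).
Proof.
move=> [S0 SD SZ] Sx; have := SZ n%:~R x Sx.
by rewrite rmorph_int scaler_int.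
Qed.

Lemma subspace_sum S (J : Type) (s : seq J) (P : pred J) (F : J -> W) :
  real_subspace S -> (forall i, P i -> S (F i)) -> S (\sum_(i <- s | P i) F i).
Proof. by move=> [S0 SD _] SF; elim/big_ind: _. Qed.

End RealSpan.

Let V0s : real_subspace V0. Proof. exact: Rspan_subspace. Qed.
Let V00 : V0 0. Proof. by case: V0s. Qed.

Lemma V0_orth a s : noniso a -> V0 s -> dform s a = 0.
Proof.
move=> Na; move: s; apply: Rspan_min.
  split=> [|x y xa ya|r x xa] /=; first exact: dform0l.
    by rewrite dformDl // xa ya addr0.
  by rewrite dformZl // xa mulr0.
by move=> s Is; apply: iso_orth.
Qed.

Lemma noniso_notV0 a : noniso a -> ~ V0 a.
Proof.
by move=> Na /(V0_orth Na) /eqP; rewrite (negPf (noniso_neq0 Na)).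
Qed.

Lemma root_cases a : root a -> noniso a \/ iso_roots a.
Proof.
by move=> Ra; have [[]|nI] := pselect (iso_roots a); [right | left].
Qed.

Lemma iso_V0 a : iso_roots a -> V0 a.
Proof. exact: Rspan_incl. Qed.

Lemma exists_noniso : exists a, noniso a.
Proof.
apply: contrapT => noN; have sub : V `<=` V0.
  apply: Rspan_min => // a /root_cases[Na|/iso_V0//].
  by case: noN; exists a.
have [s [sz us free span]] := Hrank.
case: s sz us free span => [|x s]; first by move=> l0; move: l1; rewrite -l0.
move=> _ /andP[xs _] free span.
have Vx : V0 x.
  by apply: sub; rewrite -span; apply: Rspan_incl; left; rewrite /= inE eqxx.
have /free/(_ x) : V0 (\sum_(y <- x :: s) ((y == x)%:R)%:C *: y).
  rewrite big_cons eqxx scale1r big_seq big1 ?addr0 // => y ys.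
  by rewrite (negPf (memPn xs y ys)) scale0r.
by rewrite inE eqxx => /(_ isT) /eqP; rewrite oner_eq0.
Qed.

(** Pigeonhole: modulo V^0 every root is one of the finitely many elements of [dotR]. *)
Lemma noniso_finite (r : nat -> HHdual E) : (forall k, root (r k)) ->
  exists j k, (j < k)%N /\ V0 (r k - r j).
Proof.
move=> Rr; have [fin _ _ eqR] := Hfin.
have ex k : exists2 d, dotR d & V0 (r k - d).
  have : [set a + s | a in dotR & s in V0] (r k).
    by rewrite -eqR; exists (r k) => //; exists 0 => //; rewrite addr0.
  by case=> d Dd [s Vs <-]; exists d => //; rewrite addrC addKr.
pose d k := projT1 (cid2 (ex k)).
have dD k : dotR (d k) by rewrite /d; case: cid2.
have dV k : V0 (r k - d k) by rewrite /d; case: cid2.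
have [t tE] := (finite_seqP dotR).1 fin.
have : ~~ uniq (map d (iota 0 (size t).+1)).
  apply/negP => /uniq_leq_size le_size.
  have /le_size : {subset map d (iota 0 (size t).+1) <= t}.
    by move=> x /mapP[k _ ->]; have := dD k; rewrite tE.
  by rewrite size_map size_iota ltnn.
case/(uniqPn 0) => i [j [ij]]; rewrite size_map size_iota => js.
rewrite !(nth_map 0%N) ?size_iota ?(ltn_trans ij) // !nth_iota ?(ltn_trans ij) //.
rewrite !add0n => dij; exists i, j; split=> //.
have -> : r j - r i = (r j - d j) - (r i - d i) by rewrite dij; zmod_eq; ring.
exact: (subspaceB V0s).
Qed.

Lemma noniso_reduced a b (m : int) : noniso a -> noniso b ->
  V0 (a *+ 2 - b *~ m) -> m = 2 \/ m = -2.
Proof.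
move=> Na Nb Vab; have two0 : 2 != 0 :> R by rewrite pnatr_eq0.
have V1 : V0 (a - (m%:~R / 2 : R)%:C *: b).
  have -> : a - (m%:~R / 2 : R)%:C *: b = (2^-1 : R)%:C *: (a *+ 2 - b *~ m).
    have E1 : a *+ 2 = (2 : R)%:C *: a by rewrite rmorph_nat scaler_nat.
    have E2 : b *~ m = (m%:~R : R)%:C *: b by rewrite rmorph_int scaler_int.
    rewrite E1 E2 scalerBr !scalerA -!rmorphM.
    by rewrite (mulVf two0) rmorph1 scale1r mulrC.
  by case: V0s => _ _; apply.
have := Hred Nb.1 (noniso_notV0 Nb) Na.1 (noniso_notV0 Na) V1.
case=> E1; [left|right]; apply: (@intr_inj R).
  by rewrite -[LHS](divfK two0) E1 mul1r.
by rewrite -[LHS](divfK two0) E1 mulN1r rmorphN.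
Qed.

Lemma noniso_connected (Q : set (HHdual E)) : (exists2 a, noniso a & Q a) ->
  (forall a b, noniso a -> noniso b -> Q a -> dform a b != 0 -> Q b) ->
  forall a, noniso a -> Q a.
Proof.
move=> [a0 Na0 Qa0] step a Na; apply: contrapT => nQa.
have A6 : eala_A6 E by case: HE => _ [_ []].
have [||||b [c [[Nb Qb] [Nc nQc] bc]]] := A6 (noniso `&` Q) (noniso `&` ~` Q).
- by rewrite -setIUr setUv setIT.
- by rewrite setIACA setICr setI0.
- by exists a0.
- by exists a.
by apply: nQc; apply: step bc.
Qed.

(** If all nonisotropic roots were a or -a modulo V^0, the quotient V / V^0 would be spanned by a,
    and two members of a basis would be dependent. *)
Lemma noniso_rank2 a : noniso a -> exists b,
  [/\ noniso b, ~ V0 (b - a) & ~ V0 (b + a)].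
Proof.
move=> Na; apply: contrapT => nob.
have sub : V `<=` [set v | exists r : R, V0 (v - r%:C *: a)].
  apply: Rspan_min.
    split=> [|x y [r Vx] [t Vy]|t x [r Vx]].
    - by exists 0; rewrite scale0r subr0.
    - exists (r + t); case: V0s => _ VD _.
      by have := VD _ _ Vx Vy; congr V0; rewrite rmorphD scalerDl; zmod_eq; ring.
    - exists (t * r); case: V0s => _ _ VZ.
      by have := VZ t _ Vx; rewrite scalerBr scalerA -rmorphM.
  move=> b /root_cases[Nb|/iso_V0 Vb]; last by exists 0; rewrite scale0r subr0.
  have [V1|nV1] := pselect (V0 (b - a)); first by exists 1; rewrite scale1r.
  have [V2|nV2] := pselect (V0 (b + a)); last by case: nob; exists b.
  by exists (- 1); rewrite rmorphN scaleN1r opprK.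
have [s [sz us free span]] := Hrank.
case: s sz us free span => [|x [|y s]]; [by move=> l0; move: l1; rewrite -l0.. |].
move=> _ /andP[]; rewrite inE negb_or => /andP[xy xs] /andP[ys _] free span.
have coords z : z \in [:: x, y & s] -> exists r : R, V0 (z - r%:C *: a).
  by move=> zs; apply: sub; rewrite -span; apply: Rspan_incl; left.
have [|r Vr] := coords x; first by rewrite inE eqxx.
have [|t Vt] := coords y; first by rewrite !inE eqxx orbT.
have rel (p q : R) : V0 (p%:C *: x + q%:C *: y) -> p = 0 /\ q = 0.
  move=> Vpq.
  have /free H : V0 (\sum_(z <- [:: x, y & s])
      (if z == x then p else if z == y then q else 0)%:C *: z).
    rewrite !big_cons eqxx eq_sym (negPf xy) eqxx big_seq big1 ?addr0 // => z zs.
    by rewrite (negPf (memPn xs z zs)) (negPf (memPn ys z zs)) scale0r.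
  have := H x; have := H y; rewrite !inE !eqxx eq_sym (negPf xy) !orbT.
  by move=> /(_ isT) -> /(_ isT) ->.
have [VD VZ] : (forall u v, V0 u -> V0 v -> V0 (u + v)) /\
    (forall (c : R) u, V0 u -> V0 (c%:C *: u)) by case: V0s.
have [t0 r0] : t = 0 /\ - r = 0.
  apply: rel; have := subspaceB V0s (VZ t _ Vr) (VZ r _ Vt); congr V0.
  rewrite !scalerBr !scalerA [r%:C * _]mulrC opprB addrA rmorphN scaleNr.
  by zmod_eq; ring.
have [/eqP] : (1 : R) = 0 /\ (0 : R) = 0.
  apply: rel; move: Vr; rewrite -[r]opprK r0 oppr0 !scale0r subr0 addr0.
  by rewrite scale1r.
by rewrite oner_eq0.
Qed.

End RootsModuloV0.

(** The root lattice is replaced by Z^n, where a character can be prescribed on the standard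
    basis. *)
Lemma free_abelian_coords (W : zmodType) (S : set W) : free_abelian_of_finite_rank S ->
  exists n (iota : 'rV[int]_n -> W), [/\ forall u v, iota (u - v) = iota u - iota v,
    injective iota & forall x, S x <-> exists v, x = iota v].
Proof.
case=> s0 [free0 span0]; pose s := undup s0.
have ss0 : [set` s] = [set` s0].
  by apply/seteqP; split=> x /=; rewrite mem_undup.
rewrite -ss0 in free0 span0; pose n := size s.
pose iota (v : 'rV[int]_n) := \sum_(j < n) s`_j *~ v 0 j.
have iotaB u v : iota (u - v) = iota u - iota v.
  by rewrite -sumrB; apply: eq_bigr => j _; rewrite !mxE mulrzBr.
have iota_inj0 v : iota v = 0 -> v = 0.
  move=> v0; apply/rowP => j; rewrite mxE.
  pose k x := if insub (index x s) is Some i then v 0 i else 0.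
  have kj (i : 'I_n) : k s`_i = v 0 i.
    rewrite /k index_uniq ?undup_uniq //; case: insubP => [i' _ ii'|]; last by rewrite ltn_ord.
    by congr (v 0 _); apply: val_inj.
  rewrite -kj; apply: (free0 s k (undup_uniq _)) => //; last exact: mem_nth.
  rewrite (big_nth 0) big_mkord -[RHS]v0; apply: eq_bigr => i _.
  by rewrite kj.
exists n, iota; split=> // [u v uv|x].
  by apply/eqP; rewrite -subr_eq0; apply/eqP/iota_inj0; rewrite iotaB uv subrr.
split=> [Sx|[v ->]]; last first.
  rewrite -span0; have HZ := @Zspan_subgroup W [set` s].
  apply: (subgroup_sum _ HZ) => j _; apply: (subgroupMz _ HZ).
  by apply: Zspan_incl => /=; apply: mem_nth.
move: x Sx; rewrite -span0; apply: Zspan_min.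
  split; first by exists 0; rewrite /iota big1 // => j _; rewrite mxE mulr0z.
  by move=> _ _ [u ->] [v ->]; exists (u - v); rewrite iotaB.
move=> x /= xs; have xn : (index x s < n)%N by rewrite index_mem.
exists (delta_mx 0 (Ordinal xn)); rewrite /iota (bigD1 (Ordinal xn)) //= mxE !eqxx.
rewrite mulr1z nth_index // big1 ?addr0 // => j jn.
by rewrite mxE eqxx (negPf jn) mulr0z.
Qed.

(** * Transfer of E to the abstract root data on Z^n *)

Section Transfer.
Variables (R : realType) (E : eala_data R) (l : nat) (dotR : set (HHdual E)).
Hypotheses (HE : is_eala E) (Hred : reduced_type E) (Hrank : eala_rank E l).
Hypotheses (l1 : (1 < l)%N) (Hfin : finite_part dotR).

Notation "[< x , y >]" := (bracket E x y).
Notation rs := (@root_space R E).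
Notation ecore := (@core R E).
Notation K := (R[i]).
Notation root := (@root_system R E).
Notation noniso := (@noniso_roots R E).
Notation V0 := (@realV0 R E).

Variables (n : nat) (iota : 'rV[int]_n -> HHdual E).
Hypotheses (iotaB : forall u v, iota (u - v) = iota u - iota v)
  (iota_inj : injective iota)
  (iotaP : forall a, Zspan root a <-> exists v, a = iota v).

Let X := 'rV[int]_n.

Lemma iota0 : iota 0 = 0.
Proof. by rewrite -[in LHS](subrr 0) iotaB subrr. Qed.

Lemma iotaN v : iota (- v) = - iota v.
Proof. by rewrite -sub0r iotaB iota0 sub0r. Qed.

Lemma iotaD u v : iota (u + v) = iota u + iota v.
Proof. by rewrite -{1}[v]opprK iotaB iotaN opprK. Qed.

Lemma iotaMn v k : iota (v *+ k) = iota v *+ k.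
Proof. by elim: k => [|k IHk]; rewrite ?iota0 // !mulrS iotaD IHk. Qed.

Lemma iotaMz v (k : int) : iota (v *~ k) = iota v *~ k.
Proof.
case: k => k; first by rewrite -!pmulrn iotaMn.
by rewrite NegzE !mulrNz -!pmulrn iotaN iotaMn.
Qed.

Lemma root_iota a : root a -> exists v, a = iota v.
Proof. by move=> Ra; apply/iotaP; apply: Zspan_incl. Qed.

Definition XN : set X := [set v | noniso (iota v)].
Definition XI : set X := [set v | iso_roots (iota v)].
Definition XV0 : set X := [set v | V0 (iota v)].
Definition Xsq (v : X) : K := dform (iota v) (iota v).
(** The integer behind the complex number [ip]. It exists for every v in the lattice, by additivity
    from the roots; the value 0 for w outside of [XN] keeps additivity in v unconditional. *)
Definition Xcf (v w : X) : int :=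
  if `[< XN w >] then xget 0 [set k : int | ip (iota v) (iota w) = k%:~R] else 0.

Lemma XcfE v w : XN w -> (Xcf v w)%:~R = ip (iota v) (iota w) :> K.
Proof.
move=> Nw; rewrite /Xcf asboolT //.
have [k kE] : exists k : int, ip (iota v) (iota w) = k%:~R.
  have : Zspan root (iota v) by apply/iotaP; exists v.
  move: (iota v); apply: Zspan_min.
    split=> [|a b [i ai] [j bj]]; first by exists 0; rewrite -(scale0r 0) ipZl // mul0r.
    by exists (i - j); rewrite ipDl // ipNl // ai bj intrB.
  by move=> a Ra; apply: ip_int.
by case: xgetP => [y _ <- //|/(_ k)]; rewrite /= kE.
Qed.

Lemma Xcf_eq v w (k : int) : XN w -> ip (iota v) (iota w) = k%:~R -> Xcf v w = k.
Proof. by move=> Nw E1; apply: (@intr_inj K); rewrite XcfE. Qed.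

Lemma Xrt v : XN v \/ XI v <-> root (iota v).
Proof.
split=> [[[]//|[]//]|]; exact: root_cases.
Qed.

Lemma eala_affine_roots : affine_roots XN XI XV0 Xcf Xsq.
Proof.
have V0s : real_subspace V0 by apply: Rspan_subspace.
split.
- move=> a b c; have [Na|nNa] := pselect (XN a); last by rewrite /Xcf asboolF.
  by apply: Xcf_eq => //; rewrite iotaB ipDl // ipNl // intrB !XcfE.
- by move=> a Na; apply: Xcf_eq => //; rewrite ip_id.
- move=> a b Na; apply: Xcf_eq.
    by rewrite /XN /= iotaN; apply: noniso_N.
  by rewrite iotaN ipNr // mulrNz XcfE.
- by move=> a Na; rewrite /XN /= iotaN; apply: noniso_N.
- move=> a [Ra aa]; rewrite /XI /= iotaN; split; first exact: root_N.
  by rewrite dformNl // dformNr // opprK.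
- by rewrite /XV0 /= iota0; case: V0s.
- by move=> s t Vs Vt; rewrite /XV0 /= iotaB; apply: (subspaceB V0s).
- move=> s k k0; rewrite /XV0 /= iotaMz => Vs; case: V0s => _ _ VZ.
  have := VZ (k%:~R^-1) _ Vs.
  have -> : iota s *~ k = (k%:~R : R)%:C *: iota s by rewrite rmorph_int scaler_int.
  by rewrite scalerA -rmorphM mulVf ?intr_eq0 // rmorph1 scale1r.
- by move=> s Is; apply: iso_V0.
- move=> s a Vs Na; apply: Xcf_eq => //.
  by rewrite /ip (V0_orth HE Na Vs) mulr0 mul0r.
- move=> a b Na Nb E1; apply: Xcf_eq => //; rewrite /ip.
  have /eqP : ip (iota a) (iota b) = 0 by rewrite -XcfE // E1.
  rewrite /ip !mulf_eq0 invr_eq0 (negPf (noniso_neq0 Nb)) pnatr_eq0 /= orbF.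
  by rewrite (dform_sym HE) => /eqP ->; rewrite mulr0 mul0r.
- move=> a b j Na /Xrt Rb le_j; apply/Xrt; rewrite iotaB iotaMn.
  by apply: (root_string HE Na Rb _ le_j); rewrite XcfE.
- move=> a b Na Nb; rewrite /XN /= iotaB iotaMz.
  by apply: noniso_refl => //; rewrite XcfE.
- move=> r Nr; have [j [k [jk Vjk]]] := noniso_finite Hfin (fun k => (Nr k).1).
  by exists j, k; split=> //; rewrite /XV0 /= iotaB.
- move=> a b m Na Nb; rewrite /XV0 /= iotaB iotaMn iotaMz.
  exact: noniso_reduced.
- by move=> a Na; apply: noniso_neq0.
- move=> a b Na Nb; rewrite !XcfE // /ip /Xsq (dform_sym HE (iota b)).
  have a0 := noniso_neq0 Na; have b0 := noniso_neq0 Nb.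
  move: (dform _ _) (dform _ _) (dform _ _) a0 b0 => q p r a0 b0; field.
  by rewrite a0 b0.
- move=> a b k Na Nb; rewrite /Xsq XcfE // /ip iotaD iotaMz.
  rewrite dformDl // !dformDr // !dformMzl // !dformMzr // (dform_sym HE (iota a) (iota b)).
  have a0 := noniso_neq0 Na.
  by move: (dform _ _) (dform _ _) (dform _ _) a0 => q p r a0; field; rewrite ?a0.
Qed.

Lemma eala_irreducible_roots : irreducible_roots XN XV0 Xcf.
Proof.
split.
  move=> Q [a0 Na0 Qa0] step a Na.
  have [|b c Nb Nc [v vb Qv] bc|v va Qv] := noniso_connected HE
    (Q := [set b | exists2 v, b = iota v & Q v]) _ _ Na.
  - by exists (iota a0) => //; exists a0.
  - have [w wc] := root_iota Nc.1; exists w => //.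
    rewrite vb in Nb bc; rewrite wc in Nc bc; apply: (step _ _ Nb Nc Qv) => vw0.
    have : ip (iota v) (iota w) = 0 by rewrite -(XcfE v Nc) vw0.
    move/eqP; rewrite /ip !mulf_eq0 invr_eq0 (negPf (noniso_neq0 Nc)) pnatr_eq0 /=.
    by rewrite orbF (negPf bc).
  - by rewrite (iota_inj va).
move=> a Na; have [b [Nb nb nb']] := noniso_rank2 Hrank l1 Na.
have [w wb] := root_iota Nb.1; exists w.
by rewrite /XN /XV0 /= iotaB iotaD -wb.
Qed.

Lemma eala_graded_lie : graded_lie (fun v => XN v \/ XI v) (bracket E) (bform E)
  (fun v => rs (iota v)).
Proof.
split.
- by move=> x y z; rewrite linearDl.
- by move=> x y z; rewrite linearDr.
- exact: ebrZl.
- exact: ebrZr.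
- exact: ebrxx.
- exact: ejacobi.
- exact: eformZl.
- exact: eformZr.
- exact: eform_inv.
- by move=> a b x y ax by_; rewrite iotaD; apply: rs_br.
- move=> a x ax nR; apply/eqP/negPn/negP => x0; apply: nR; apply/Xrt.
  by exists x.
- move=> P P0 PD Prs x; have [_ _ _ dec _] : eala_A2 E by case: HE => -[_ []].
  have [r [f [fP ->]]] := dec x; elim/big_ind: _ => // a _.
  have [->//|f0] := eqVneq (f a) 0.
  have Ra : root a by exists (f a).
  by have [v va] := root_iota Ra; apply: (Prs v); rewrite -va.
Qed.

Definition Xsystem (x_ : HHdual E -> E) (v : X) : E :=
  if `[< XN v >] then x_ (iota v) else 0.

Lemma eala_chevalley_data (tau : E -> E) (x_ : HHdual E -> E) :
  chevalley_involution tau -> chevalley_system tau x_ ->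
  chevalley_data XN Xcf Xsq (bracket E) (bform E) (fun v => rs (iota v)) ecore tau
    (Xsystem x_).
Proof.
move=> [[_ tau_lin tau_br] _ _] sys; rewrite /Xsystem.
have [c0 cD cZ cB] := core_lie_subalgebra E.
have tau0 : tau 0 = 0.
  by have := tau_lin (-1) 0 0 c0 c0; rewrite scaler0 addr0 scaleN1r addNr.
have XNN v : XN (- v) -> XN v.
  by rewrite /XN /= iotaN => /(noniso_N HE); rewrite opprK.
have NX v : XN v -> XN (- v).
  by move=> Nv; rewrite -[v]opprK in Nv; apply: XNN.
have core_x v : ecore (if `[< XN v >] then x_ (iota v) else 0).
  by case: asboolP => // Nv; have [vx _ _] := sys _ Nv; apply: core_rs vx.
split=> //.
- by move=> a; case: asboolP => [/sys[]//|_]; apply: rs0.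
- by move=> a nNa; rewrite asboolF.
- move=> a y Na ay; rewrite asboolT //.
  have [ax xx _] := sys _ Na; apply: (root_space_line HE Na ax _ ay).
  apply/eqP => x0; have [e [e0 ae]] := Na.1.
  have := coroot_br HE (iota a) ae; rewrite -xx x0 linear0l linear0l ip_id // => /esym/eqP.
  by rewrite scaler_eq0 (negPf e0) pnatr_eq0.
- move=> a b y Na by_; rewrite !asboolT //; last exact: NX.
  by rewrite iotaN; have [_ -> _] := sys _ Na; rewrite (coroot_br HE _ by_) XcfE.
(* The equality (x_a, x_(-a)) t_a = h_a is paired with t_a and divided by (a, a). *)
- move=> a Na; rewrite !asboolT //; last exact: NX.
  have [ax xx _] := sys _ Na; have [ax' _ _] := sys _ (noniso_N HE Na).
  rewrite iotaN /Xsq; have d0 := noniso_neq0 Na.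
  have := congr1 (fun z => bform E z (cartan_incl E (t_ (iota a)))) xx.
  rewrite /= (br_rs_opp HE ax ax') eformZl /coroot linearZ eformZl.
  by move=> /(mulIf d0) ->; rewrite mulrC divfK.
- by move=> c y cy; have := tau_lin c y 0 cy c0; rewrite !addr0 tau0 addr0.
- move=> a; case: asboolP => Na.
    by rewrite asboolT; [rewrite iotaN; have [] := sys _ Na | apply: NX].
  by rewrite asboolF ?oppr0 // => /XNN.
Qed.

End Transfer.

(** * Automorphisms of E given by characters *)

Section GradingAutomorphism.
Variables (R : realType) (E : eala_data R).
Hypothesis HE : is_eala E.

Notation "[< x , y >]" := (bracket E x y).
Notation "( x ; y )" := (bform E x y) (at level 0).
Notation rs := (@root_space R E).
Notation K := (R[i]).
Notation root := (@root_system R E).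

Lemma eala_ind (P : set E) : P 0 -> (forall x y, P x -> P y -> P (x + y)) ->
  (forall a x, rs a x -> P x) -> forall x, P x.
Proof.
move=> P0 PD Prs x; have [_ _ _ dec _] : eala_A2 E by case: HE => -[_ []].
have [r [f [fP ->]]] := dec x; elim/big_ind: _ => // a _.
exact: (Prs a).
Qed.

(** f x is characterized through the form by its pairings with root vectors: y in E_c pairs only
    with E_(-c), on which f should be phi (-c). Nondegeneracy gives uniqueness, so no choice of a
    decomposition of x has to be made. *)
Lemma grading_automorphism (phi : HHdual E -> K) : (forall a, phi a != 0) ->
  (forall a b, root a -> root b -> phi (a + b) = phi a * phi b) ->
  exists f : E -> E, [/\ forall x y, f (x + y) = f x + f y,
    forall x y, f [<x, y>] = [<f x, f y>],
    injective f & forall a x, rs a x -> f x = phi a *: x].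
Proof.
move=> phi0 phiD.
pose G x z := forall c y, rs c y -> (z; y) = phi (- c) * (x; y).
have nondeg z : (forall c y, rs c y -> (z; y) = 0) -> z = 0.
  move=> zy; have [_ _ _ nd] : eala_A1 E by case: HE => -[].
  apply: nd; apply: eala_ind => [|x y zx zy'|a x /zy//].
    by rewrite linear0r.
  by rewrite linearDr zx zy' addr0.
have G_uniq x z z' : G x z -> G x z' -> z = z'.
  move=> Gz Gz'; apply/eqP; rewrite -subr_eq0; apply/eqP/nondeg => c y cy.
  by rewrite linearBl (Gz c y cy) (Gz' c y cy) subrr.
have G_rs a x : rs a x -> G x (phi a *: x).
  move=> ax c y cy; rewrite eformZl.
  have [ac|ac] := eqVneq (a + c) 0; last by rewrite (form_orth HE ax cy ac) !mulr0.
  by have -> : - c = a by apply/eqP; rewrite eq_sym -addr_eq0 ac.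
have G_D x y z t : G x z -> G y t -> G (x + y) (z + t).
  by move=> Gx Gy c u cu; rewrite !linearDl (Gx c u cu) (Gy c u cu) mulrDr.
have G_ex x : exists z, G x z.
  move: x; apply: eala_ind => [|x y [z Gz] [t Gt]|a x /G_rs Gx].
  - by exists 0 => c y cy; rewrite !linear0l mulr0.
  - by exists (z + t); apply: G_D.
  - by exists (phi a *: x).
pose f x := xget 0 (G x).
have fG x : G x (f x).
  by have [z Gz] := G_ex x; apply: (xgetPex 0 (P := G x)); exists z.
have fD x y : f (x + y) = f x + f y.
  by apply: (G_uniq (x + y)) => //; apply: G_D.
have f_rs a x : rs a x -> f x = phi a *: x by move=> ax; apply: (G_uniq x) => //; apply: G_rs.
have f0 : f 0 = 0 by rewrite (f_rs 0) ?scaler0 //; apply: rs0.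
have fB x y : f (x - y) = f x - f y by rewrite -[in RHS](subrK y x) [in RHS]fD addrK.
exists f; split=> // [x y|x y fxy].
  move: x; apply: eala_ind => [|x x' fx fx'|a x ax].
  - by rewrite f0 !linear0l f0.
  - by rewrite linearDl !fD fx fx' linearDl.
  move: y; apply: eala_ind => [|y y' fy fy'|b y by_].
  - by rewrite f0 !linear0r f0.
  - by rewrite linearDr !fD fy fy' linearDr.
  rewrite (f_rs _ _ ax) (f_rs _ _ by_) (f_rs _ _ (rs_br HE ax by_)).
  have [->|x0] := eqVneq x 0; first by rewrite scaler0 !linear0l scaler0.
  have [->|y0] := eqVneq y 0; first by rewrite scaler0 !linear0r scaler0.
  rewrite phiD; [|by exists x|by exists y].
  by rewrite ebrZl ebrZr scalerA.
apply/eqP; rewrite -subr_eq0; apply/eqP/nondeg => c u cu.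
have := fG (x - y) c u cu; rewrite fB fxy subrr linear0l => /esym/eqP.
by rewrite mulf_eq0 (negPf (phi0 _)) => /eqP.
Qed.

End GradingAutomorphism.

(** * The Z-span of a constructed integral structure *)

Section ConstructedSpan.
Variables (R : realType) (E : eala_data R) (dotR : set (HHdual E)).
Hypothesis HE : is_eala E.

Notation "[< x , y >]" := (bracket E x y).
Notation rs := (@root_space R E).
Notation ecore := (@core R E).
Notation K := (R[i]).
Notation root := (@root_system R E).
Notation noniso := (@noniso_roots R E).
Notation V0 := (@realV0 R E).

Lemma reflection_in_tildeV a b :
  reflection dotR a (in_tildeV b) = in_tildeV (b - ip b a *: a).
Proof.
rewrite /reflection.
have -> // : tilde_form dotR (in_tildeV b) (in_tildeV a) = dform b a.
by rewrite /tilde_form /= !addr0.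
Qed.

Lemma ip_refl a b : noniso a -> ip (b - ip b a *: a) a = - ip b a.
Proof.
move=> Na; rewrite ipDl // ipNl // ipZl // ip_id //; ring.
Qed.

(** Reflections preserve the copy of the dual Cartan in [tildeV] and act there by b - ip b a *: a,
    so the orbit condition becomes an induction principle for nonisotropic roots. *)
Lemma weyl_generated (P : set (HHdual E)) : P `<=` noniso ->
  generates_by_reflections dotR P -> forall Q : set (HHdual E), P `<=` Q ->
  (forall a b, P a -> noniso b -> Q b -> Q (b - ip b a *: a)) -> noniso `<=` Q.
Proof.
move=> PN gen Q PQ step b Nb.
pose Y (u : tildeV E) := exists2 c, u = in_tildeV c & noniso c /\ Q c.
have noniso_w a c : P a -> noniso c -> noniso (c - ip c a *: a).
  move=> Pa Nc; have [k kE] := ip_int HE (PN a Pa) Nc.1.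
  by rewrite kE scaler_int; apply: noniso_refl => //; apply: PN.
(* An equivalence, not an implication, so that G is closed under inverses. *)
pose G : set (tildeV E -> tildeV E) := [set g | forall u, Y (g u) <-> Y u].
have HG : group_of_maps G.
  split=> // [f g Gf Gg u|f g Gf fg gf u]; first by rewrite /= Gf Gg.
  by rewrite -[in Y u](gf u); split=> /Gf.
have weylG : weyl_group dotR P `<=` G.
  apply: smallest_sub => // _ [a Pa <-] u.
  have YW c : noniso c /\ Q c -> Y (in_tildeV (c - ip c a *: a)).
    by case=> Nc Qc; exists (c - ip c a *: a) => //; split; [apply: noniso_w | apply: step].
  split=> [[c uE Nc]|[c -> Nc]]; last by rewrite reflection_in_tildeV; apply: YW.
  have u2 : u.2 = zero_dualV0 E by have := congr1 snd uE.
  have uin : u = in_tildeV u.1 by rewrite /in_tildeV -u2 -surjective_pairing.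
  move: uE; rewrite uin reflection_in_tildeV => /(congr1 fst) /= cE.
  have := YW c Nc; rewrite -cE ip_refl; last exact: PN.
  by rewrite scaleNr opprK subrK.
have : [set w (in_tildeV a) | w in weyl_group dotR P & a in P] (in_tildeV b).
  by rewrite gen; exists b.
case=> w Ww [a Pa wab].
have : Y (w (in_tildeV a)) by apply/(weylG w Ww); exists a => //; split; [apply: PN | apply: PQ].
by rewrite wab => -[c /(congr1 fst) /= -> []].
Qed.

Variables (n : nat) (iota : 'rV[int]_n -> HHdual E).
Hypotheses (iotaB : forall u v, iota (u - v) = iota u - iota v)
  (iota_inj : injective iota)
  (iotaP : forall a, Zspan root a <-> exists v, a = iota v).

Local Notation XN := (XN iota).
Local Notation XI := (XI iota).
Local Notation XV0 := (XV0 iota).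
Local Notation Xcf := (Xcf iota).

Lemma weyl_generated_iota (P : set (HHdual E)) : P `<=` noniso ->
  generates_by_reflections dotR P -> forall Q : set 'rV[int]_n,
  (forall a, P (iota a) -> Q a) ->
  (forall a b, P (iota a) -> XN b -> Q b -> Q (refl Xcf a b)) -> XN `<=` Q.
Proof.
move=> PN gen Q PQ step b Nb.
suff : noniso `<=` [set c | exists2 v, c = iota v & Q v].
  by move=> /(_ _ Nb)[v /iota_inj ->].
apply: (weyl_generated PN gen).
  move=> c Pc; have [v cv] := root_iota iotaP (PN c Pc).1.
  by exists v => //; apply: PQ; rewrite -cv.
move=> a c Pa Nc [v cv Qv]; have [u au] := root_iota iotaP (PN a Pa).1.
have Na := PN a Pa; rewrite {}au {}cv in Pa Na Nc *.
exists (refl Xcf u v); last exact: step.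
rewrite /refl iotaB (iotaMz iotaB) -(XcfE HE iotaP v (w := u)) //.
by rewrite scaler_int.
Qed.

Variables (tau : E -> E) (x_ : HHdual E -> E).
Hypothesis (Hred : reduced_type E).
Variables (l : nat).
Hypotheses (Hrank : eala_rank E l) (l1 : (1 < l)%N) (Hfin : finite_part dotR).
Hypotheses (Htau : chevalley_involution tau) (Hx : chevalley_system tau x_).

Local Notation X_ := (Xsystem iota x_).
Local Notation Lam := (Zspan (lattice_gens XN XV0 (bracket E) X_)).

Let H := eala_affine_roots HE Hred Hfin iotaB iotaP.
Let H2 := eala_irreducible_roots HE Hrank l1 iotaB iota_inj iotaP.
Let G := eala_graded_lie HE iotaB iotaP.
Let C := eala_chevalley_data HE iotaB iotaP Htau Hx.

Local Notation yv := (yvec (bracket E) X_).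

Lemma Lam_x v : XN v -> Lam (X_ v).
Proof. by move=> Nv; apply: Zspan_incl; left; exists v. Qed.

Lemma Lam_y b s : XN b -> XV0 s -> Lam (yv b s).
Proof. by move=> Nb Vs; apply: Zspan_incl; right; exists b, s. Qed.

Lemma Xsystem_iota v : XN v -> X_ v = x_ (iota v).
Proof. by move=> Nv; rewrite /Xsystem asboolT. Qed.

Lemma yvec_iota b s : XN b -> XN (b + s) -> yv b s = [<x_ (iota b + iota s), x_ (- iota b)>].
Proof.
move=> Nb Nbs; rewrite /yvec !Xsystem_iota ?(iotaD iotaB) ?(iotaN iotaB) //.
exact: (ar_NN H).
Qed.

Lemma yvec_out b s : ~ XN (b + s) -> yv b s = 0.
Proof. by move=> nN; rewrite /yvec (cd_out C nN) linear0l. Qed.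

Lemma tau_yvec b s : tau (yv b s) = yv (- b) (- s).
Proof.
rewrite /yvec (cd_tau_br C (cd_core C _) (cd_core C _)) !(cd_tau C).
by rewrite linearNl linearNr !opprK opprD.
Qed.

Lemma core_yvec b s : ecore (yv b s).
Proof. exact: (cd_core_br C (cd_core C _) (cd_core C _)). Qed.

(** tau is additive on the core only, so membership in the core is carried along. *)
Lemma Zspan_core_tau (A S : set E) : additive_subgroup S ->
  (forall y, A y -> ecore y /\ S (tau y)) ->
  Zspan A `<=` [set y | ecore y /\ S (tau y)].
Proof.
move=> HS AS; have [c0 cD cZ _] := core_lie_subalgebra E.
have [[_ tau_lin _] _ _] := Htau.
have tau0 : tau 0 = 0 by rewrite -(scale0r (0 : E)) (cd_tauZ C 0 c0) !scale0r.
apply: Zspan_min => //; split=> [|y z [cy Sy] [cz Sz]].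
  by split=> //; rewrite tau0; apply: (subgroup0 HS).
have cN : ecore (- z) by rewrite -scaleN1r; apply: cZ.
split; first exact: cD.
rewrite addrC -scaleN1r tau_lin // scaleN1r addrC.
exact: HS.2.
Qed.

Lemma yvec_span (P : set (HHdual E)) (M : set E) s :
  P `<=` noniso -> generates_by_reflections dotR P -> XV0 s ->
  additive_subgroup M -> (forall a, P (iota a) -> M (yv a s)) ->
  forall b, XN b -> M (yv b s).
Proof.
move=> PN gen Vs HM MP.
apply: (yvec_generated H H2 G C (P := [set v | P (iota v)])) => //.
  by move=> a /PN.
by move=> Q PQ step; apply: (weyl_generated_iota PN gen) => // a b Pa; apply: step.
Qed.

(** [Lam] depends on x_ alone, which removes all auxiliary choices. For s in Rp or s = 0,
    reflections reach every [yvec b s] from the base; for s in Rm, tau maps [yvec (- b) (- s)] to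
    [yvec b s]. *)
Lemma constructed_span B : constructed_from dotR tau x_ B -> Zspan B = Lam.
Proof.
case=> P [Rp [Rm [m [B_ [[[PN gen _] _ _] [isoE _ RpE] HB HB0 BE]]]]].
have HLam : additive_subgroup Lam by apply: Zspan_subgroup.
have HZB : additive_subgroup (Zspan B) by apply: Zspan_subgroup.
have cor_yv a : P (iota a) -> coroot (iota a) = yv a 0.
  move=> /PN Na; rewrite yvec_iota ?addr0 // (iota0 iotaB) addr0.
  by have [_ ->] := Hx Na.
have Piota a : P a -> exists2 v, a = iota v & XN v.
  by move=> /PN Na; have [v va] := root_iota iotaP Na.1; exists v => //; rewrite /= /XN /= -va.
have V00 : XV0 0 by apply: (ar_V00 H).
have iso_iota s : iso_roots s -> exists2 v, s = iota v & XV0 v.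
  move=> Is; have [v va] := root_iota iotaP Is.1; exists v => //.
  by rewrite /XV0 /= -va; apply: iso_V0.
have Rp_iso s : Rp s -> iso_roots s.
  by move=> Rs; have : (@iso_roots R E `\ 0) s by [rewrite isoE; left]; case.
pose gens s := [set [<x_ (a + s), x_ (- a)>] | a in [set a | P a /\ root (a + s)]].
have gens_yv s y : XV0 s -> gens (iota s) y -> exists2 a, XN a & y = yv a s.
  move=> Vs [_ [/Piota[a -> Na] Ras] <-]; exists a => //.
  rewrite yvec_iota //; move: Ras; rewrite -(iotaD iotaB) => /(Xrt iota) Ras.
  apply: (Rt_notV0 H Ras) => Vas.
  by apply: (NV0 H Na); move: (ar_V0B H Vas Vs); rewrite addrK.
have yv_gens s a : XV0 s -> P (iota a) -> Zspan (gens (iota s)) (yv a s).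
  move=> Vs Pa; have [Nas|nN] := pselect (XN (a + s)); last first.
    by rewrite yvec_out //; apply: (subgroup0 (Zspan_subgroup _)).
  apply: Zspan_incl; exists (iota a); last by rewrite yvec_iota //; apply: PN.
  by split=> //; rewrite -(iotaD iotaB); case: Nas.
have core_gens s y : XV0 s -> gens (iota s) y -> ecore y.
  by move=> Vs /(gens_yv _ _ Vs)[a _ ->]; apply: core_yvec.
have core_span s : XV0 s -> Zspan (gens (iota s)) `<=` ecore.
  move=> Vs; have [c0 cD cZ _] := core_lie_subalgebra E; apply: Zspan_min.
    by split=> // y z cy cz; apply: cD => //; rewrite -scaleN1r; apply: cZ.
  by move=> y; apply: core_gens.
have span_Lam s : XV0 s -> Zspan (gens (iota s)) `<=` Lam.
  move=> Vs; apply: Zspan_min => // y /(gens_yv _ _ Vs)[a Na ->]; exact: Lam_y.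
have B_gens s : Rp (iota s) -> Zspan (B_ (iota s)) = Zspan (gens (iota s)).
  by move=> /HB[[_ ->]].
apply/seteqP; split.
  apply: Zspan_min => // y; rewrite BE => -[[B0y|[a Na <-]]|[s [Is s0] Bsy]].
  - have : Zspan ((@coroot R E) @` P) y by rewrite -HB0.2; apply: Zspan_incl.
    apply: Zspan_min => // _ [a Pa <-]; have [v av Nv] := Piota a Pa.
    by rewrite av cor_yv -?av //; apply: Lam_y.
  - have [v av] := root_iota iotaP Na.1; rewrite av in Na *.
    by rewrite -Xsystem_iota //; apply: Lam_x.
  have : (Rp `|` Rm) s by rewrite -isoE.
  case=> [Rs|Rs].
    have [v sv Vv] := iso_iota s Is; rewrite sv in Rs Bsy.
    by apply: (span_Lam v Vv); rewrite -B_gens //; apply: Zspan_incl.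
  have Rs' : Rp (- s) by rewrite RpE; exists s.
  have [v sv Vv] := iso_iota _ (Rp_iso _ Rs'); rewrite sv in Rs'.
  have [[_ _] Bs] := HB _ Rs'; rewrite -sv opprK in Bs.
  move: Bsy; rewrite Bs => -[z Bz <-]; apply: (subgroupN HLam).
  have : Zspan (gens (iota v)) z by rewrite -B_gens // -sv; apply: Zspan_incl.
  move=> /(Zspan_core_tau HLam) []// u gu; split; first exact: core_gens gu.
  have [a Na ->] := gens_yv _ _ Vv gu; rewrite tau_yvec.
  by apply: Lam_y; [apply: (ar_NN H) | apply: (V0N H)].
have yB s b : XN b -> XV0 s -> Zspan B (yv b s).
  move=> Nb Vs; have [->|y0] := eqVneq (yv b s) 0; first exact: (subgroup0 HZB).
  have Rs : root (iota s) by exists (yv b s); split=> //; apply: (rs_yvec G C).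
  have Is : iso_roots (iota s).
    by case: (root_cases Rs) => // Ns; case: (noniso_notV0 HE Ns).
  have [s0|s0] := eqVneq s 0.
    rewrite s0; apply: (yvec_span PN gen V00 HZB) => // a Pa; rewrite -cor_yv //.
    have : Zspan (B_ 0) (coroot (iota a)).
      by rewrite HB0.2; apply: Zspan_incl; exists (iota a).
    apply: Zspan_min => // y By; apply: Zspan_incl; rewrite BE; by left; left.
  have is0 : iota s <> 0 by rewrite -(iota0 iotaB) => /iota_inj/eqP; rewrite (negPf s0).
  have Bs_sub t : iso_roots t -> t <> 0 -> B_ t `<=` B.
    by move=> It t0 y By; rewrite BE; right; exists t.
  have : (Rp `|` Rm) (iota s) by rewrite -isoE.
  case=> Rs1.
    apply: (yvec_span PN gen Vs HZB) => // a Pa.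
    have := yv_gens s a Vs Pa; rewrite -B_gens //.
    by apply: Zspan_min => // y By; apply: Zspan_incl; apply: Bs_sub By.
  have Rs' : Rp (iota (- s)) by rewrite RpE; exists (iota s) => //; rewrite (iotaN iotaB).
  have VNs : XV0 (- s) by apply: (V0N H).
  have y' : Zspan (B_ (iota (- s))) (yv (- b) (- s)).
    rewrite B_gens //; apply: (yvec_span PN gen VNs (Zspan_subgroup _)) => //.
      by move=> a Pa; apply: yv_gens.
    exact: (ar_NN H).
  have [[_ _] BsE] := HB _ Rs'; rewrite (iotaN iotaB) opprK in BsE.
  have [_] : [set y | ecore y /\ Zspan B (tau y)] (yv (- b) (- s)).
    move: y'; apply: (Zspan_core_tau HZB) => z Bz; split.
      have : Zspan (gens (iota (- s))) z by rewrite -B_gens //; apply: Zspan_incl.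
      exact: core_span.
    rewrite -[tau z]opprK; apply: (subgroupN HZB); apply: Zspan_incl.
    by apply: (Bs_sub (iota s)) => //; rewrite BsE; exists z; rewrite // -(iotaN iotaB).
  by rewrite tau_yvec !opprK.
apply: Zspan_min => // u [[a Na ->]|[b [s [Nb Vs ->]]]]; last exact: yB.
apply: Zspan_incl; rewrite BE Xsystem_iota //; left; right.
by exists (iota a).
Qed.

End ConstructedSpan.

(** * Real families and dimension counts *)

Section RealFamilies.
Variables (R : realType) (W : lmodType R[i]).
Implicit Types (U : set W).

Definition rcomb m (e : 'I_m -> W) (c : 'rV[R]_m) : W :=
  \sum_(i < m) (c 0 i)%:C *: e i.

Lemma rcomb_lin m (e : 'I_m -> W) r c d :
  rcomb e (r *: c + d) = r%:C *: rcomb e c + rcomb e d.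
Proof.
rewrite /rcomb scaler_sumr -big_split; apply: eq_bigr => i _.
by rewrite !mxE rmorphD rmorphM scalerDl scalerA.
Qed.

Lemma rcomb0 m (e : 'I_m -> W) : rcomb e 0 = 0.
Proof. by rewrite /rcomb big1 // => i _; rewrite mxE scale0r. Qed.

Lemma rcomb_delta m (e : 'I_m -> W) i : rcomb e (delta_mx 0 i) = e i.
Proof.
rewrite /rcomb (bigD1 i) //= mxE !eqxx scale1r big1 ?addr0 // => j ji.
by rewrite mxE eqxx (negPf ji) scale0r.
Qed.

Lemma rcomb_mul l m (e : 'I_m -> W) (A : 'M[R]_(l, m)) u :
  rcomb e (u *m A) = rcomb (fun j => rcomb e (row j A)) u.
Proof.
rewrite /rcomb; under [RHS]eq_bigr do rewrite scaler_sumr.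
rewrite exchange_big; apply: eq_bigr => i _ /=; rewrite mxE rmorph_sum scaler_suml.
by apply: eq_bigr => j _; rewrite rmorphM scalerA mxE.
Qed.

Lemma rcomb_subspace m (e : 'I_m -> W) U : real_subspace U ->
  real_subspace [set v | exists c, U (v - rcomb e c)].
Proof.
move=> HU; have [U0 UD UZ] := HU; split=> [|x y [c Uc] [d Ud]|r x [c Uc]].
- by exists 0; rewrite rcomb0 subr0.
- exists (1 *: c + d); rewrite rcomb_lin scale1r opprD addrACA.
  exact: UD.
- exists (r *: c + 0); rewrite rcomb_lin rcomb0 addr0 -scalerBr.
  exact: UZ.
Qed.

(** Steinitz exchange in matrix form: A holds the coordinates of the t j, and a relation between its
    rows would be one between the t j modulo U. It yields l <= m, and invertibility when l = m. *)
Lemma rcomb_exchange l m (t : 'I_l -> W) (e : 'I_m -> W) U : real_subspace U ->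
  (forall c, U (rcomb t c) -> c = 0) -> (forall j, exists c, U (t j - rcomb e c)) ->
  exists A : 'M[R]_(l, m), (forall u, U (rcomb t u - rcomb e (u *m A))) /\ row_free A.
Proof.
move=> HU free coords; have [U0 UD UZ] := HU.
pose c j := projT1 (cid (coords j)).
have cP j : U (t j - rcomb e (c j)) by rewrite /c; case: cid.
pose A := \matrix_j c j.
have AP u : U (rcomb t u - rcomb e (u *m A)).
  rewrite rcomb_mul /rcomb -sumrB; apply: (subspace_sum _ HU) => j _.
  by rewrite -scalerBr rowK; apply: UZ; apply: cP.
exists A; split=> //; apply: inj_row_free => u uA0; apply: free.
by have := AP u; rewrite uA0 rcomb0 subr0.
Qed.

Lemma dim_quotient_family S U n : real_subspace U -> dim_quotient S U n ->
  exists t : 'I_n -> W, [/\ forall j, S (t j), forall c, U (rcomb t c) -> c = 0 &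
    forall v, S v -> exists c, U (v - rcomb t c)].
Proof.
move=> HU [s [sz us free span]]; have [U0 UD UZ] := HU; subst n.
exists (fun j => s`_j); split.
- by move=> j; rewrite -span; apply: Rspan_incl; left; apply: mem_nth.
- move=> c Uc; apply/rowP => j; rewrite mxE.
  pose k x := if insub (index x s) is Some i then c 0 i else 0.
  have kj (i : 'I_(size s)) : k s`_i = c 0 i.
    rewrite /k index_uniq //; case: insubP => [i' _ ii'|]; last by rewrite ltn_ord.
    by congr (c 0 _); apply: val_inj.
  rewrite -kj; apply: (free k); last exact: mem_nth.
  rewrite (big_nth 0) big_mkord; move: Uc; congr U; apply: eq_bigr => i _.
  by rewrite kj.
move=> v; rewrite -span; move: v; apply: Rspan_min; first exact: rcomb_subspace.
move=> v [/= vs|Uv]; last by exists 0; rewrite rcomb0 subr0.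
have vn : (index v s < size s)%N by rewrite index_mem.
exists (delta_mx 0 (Ordinal vn)); rewrite rcomb_delta /= nth_index // subrr.
exact: U0.
Qed.

End RealFamilies.

(** * Independent bases and the recognition of type B *)

Section EalaTypes.
Variables (R : realType) (E : eala_data R) (l : nat) (dotR : set (HHdual E)).
Hypotheses (HE : is_eala E) (Hred : reduced_type E) (Hrank : eala_rank E l).
Hypotheses (l1 : (1 < l)%N) (Hfin : finite_part dotR).

Notation "[< x , y >]" := (bracket E x y).
Notation rs := (@root_space R E).
Notation K := (R[i]).
Notation root := (@root_system R E).
Notation noniso := (@noniso_roots R E).
Notation V0 := (@realV0 R E).
Notation V := (@Defs.realV R E).

Variables (n : nat) (iota : 'rV[int]_n -> HHdual E).
Hypotheses (iotaB : forall u v, iota (u - v) = iota u - iota v)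
  (iota_inj : injective iota)
  (iotaP : forall a, Zspan root a <-> exists v, a = iota v).

Local Notation X := ('rV[int]_n).
Local Notation XN := (XN iota).
Local Notation XI := (XI iota).
Local Notation XV0 := (XV0 iota).
Local Notation Xcf := (Xcf iota).

Let H := eala_affine_roots HE Hred Hfin iotaB iotaP.
Let H2 := eala_irreducible_roots HE Hrank l1 iotaB iota_inj iotaP.

Lemma real_subspace0 (W : lmodType K) : @real_subspace R W [set 0].
Proof.
split=> [//|x y -> ->|r x ->]; first by rewrite addr0.
by rewrite scaler0.
Qed.

(** Index 0 gives a base with dim V members. It spans V over R, reflections reaching all
    nonisotropic roots, so it is linearly independent. *)
Lemma independent_base : is_ind dotR 0 -> exists p : seq X, [/\ uniq p,
  forall a, a \in p -> XN a,
  forall k : X -> int, \sum_(a <- p) a *~ k a = 0 -> forall a, a \in p -> k a = 0 &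
  forall Q : set X, (forall a, a \in p -> Q a) ->
    (forall a b, a \in p -> XN b -> Q b -> Q (refl Xcf a b)) -> XN `<=` Q].
Proof.
case=> m [d [[[P [PN gen _] Pm] _] dimV md]].
have {}md : d = m by apply/eqP; rewrite -eqz_nat eq_sym -subr_eq0 -md.
subst d; have /card_set_bijP[g [gfun ginj gsurj]] := Pm.
have exP (i : 'I_m) : exists v, P (iota v) /\ g (iota v) = i.
  have [a Pa gai] := gsurj i (ltn_ord i).
  by have [v av] := root_iota iotaP (PN a Pa).1; exists v; rewrite -av.
pose e i := projT1 (cid (exP i)).
have eP i : P (iota (e i)) /\ g (iota (e i)) = i by rewrite /e; case: cid.
have e_inj : injective e.
  by move=> i j eij; apply: val_inj; have [_ /= <-] := eP i; have [_ /= <-] := eP j; rewrite eij.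
have Pe a : P (iota a) -> exists i, a = e i.
  move=> Pa; have lt_g : (g (iota a) < m)%N by apply: gfun.
  exists (Ordinal lt_g); apply: iota_inj; have [Pe ge] := eP (Ordinal lt_g).
  by apply: ginj; rewrite ?inE // ge.
pose p := [seq e i | i <- enum 'I_m].
have mem_p a : a \in p <-> P (iota a).
  split=> [/mapP[i _ ->]|/Pe[i ->]]; first by have [] := eP i.
  by apply: map_f; rewrite mem_enum.
exists p; split.
- by rewrite map_inj_uniq ?enum_uniq.
- by move=> a /mem_p /PN.
- move=> k sum0.
  have HU := real_subspace0 (HHdual E).
  have [t [tV tfree tcoords]] := dim_quotient_family HU dimV.
  pose ie i := iota (e i).
  have HS := rcomb_subspace ie HU.
  have [S0 SD SZ] := HS.
  have eS i : exists c, [set 0] (ie i - rcomb ie c).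
    by exists (delta_mx 0 i); rewrite rcomb_delta subrr.
  have XS v : (forall v, XN v -> exists c, [set 0] (iota v - rcomb ie c)) ->
    V v -> exists c, [set 0] (v - rcomb ie c).
    move=> NS; move: v; apply: Rspan_min => // a Ra.
    case: (root_cases Ra) => [Na|Ia].
      by have [v va] := root_iota iotaP Ra; rewrite va; apply: NS; rewrite /XN /= -va.
    (* An isotropic root is a difference of two nonisotropic ones, so it lies in the span as
       well. *)
    have [b Nb Nba] := iso_nonisolated HE (exists_noniso Hrank l1) Ia.
    have [u ub] := root_iota iotaP Nb.1; have [w wba] := root_iota iotaP Nba.1.
    have -> : a = iota w - iota u by rewrite -wba -ub addrC addKr.
    by apply: (subspaceB HS); apply: NS; rewrite /XN /= -?wba -?ub.
  have NS : forall v, XN v -> exists c, [set 0] (iota v - rcomb ie c).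
    apply: (weyl_generated_iota HE iotaB iota_inj iotaP PN gen).
      by move=> a /Pe[i ->]; apply: eS.
    move=> a b /Pe[i ->] Nb Sb; rewrite /refl iotaB (iotaMz iotaB).
    by apply: (subspaceB HS) => //; apply: (subspaceMz _ HS); apply: eS.
  have [A [AP Afree]] := rcomb_exchange HU tfree (fun j => XS (t j) NS (tV j)).
  pose c : 'rV[R]_m := \row_i (k (e i))%:~R.
  have c0 : rcomb ie c = 0.
    have : iota (\sum_(a <- p) a *~ k a) = 0 by rewrite sum0 (iota0 iotaB).
    rewrite (big_morph iota (iotaD iotaB) (iota0 iotaB)) big_map big_enum /= => <-.
    by apply: eq_bigr => i _; rewrite mxE rmorph_int scaler_int (iotaMz iotaB).
  have Aunit : A \in unitmx by rewrite -row_free_unit.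
  have := AP (c *m invmx A); rewrite mulmxKV // c0 subr0 => /tfree uc.
  have c00 : c = 0 by rewrite -(mulmxKV Aunit c) uc mul0mx.
  move=> a /mapP[i _ ->]; have := congr1 (fun M : 'rV[R]_m => M 0 i) c00.
  by rewrite !mxE => /eqP; rewrite intr_eq0 => /eqP.
- move=> Q PQ step; apply: (weyl_generated_iota HE iotaB iota_inj iotaP PN gen).
    by move=> a /mem_p; apply: PQ.
  by move=> a b /mem_p pa; apply: step.
Qed.

Local Notation short := (short_root XN XV0 Xcf).
Local Notation par := (parallel XV0).

Lemma ip_V0 a v w : noniso a -> V0 (v - w) -> ip v a = ip w a.
Proof.
move=> Na Vvw; apply/eqP; rewrite -subr_eq0 -ipNl // -ipDl //.
by rewrite /ip (V0_orth HE Na Vvw) mulr0 mul0r.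
Qed.

Lemma Re_ofrealM (r : R) (z : K) : complex.Re (r%:C * z) = r * complex.Re z.
Proof. by case: z => x y; rewrite /= mul0r subr0. Qed.

Section OrthogonalShortRoots.
Hypothesis orth : forall a b, short a -> short b -> par a b \/ Xcf a b = 0.

Let short_family m (e : 'I_m -> X) :=
  (forall i, short (e i)) /\ forall i j, i != j -> ~ par (e i) (e j).

(** Orthogonality makes the pairing with e k read off the k-th coordinate; such a family is
    therefore free modulo V^0 and has at most l members. *)
Let ip_family m (e : 'I_m -> X) (c : 'rV[R]_m) k : short_family e ->
  ip (rcomb (fun i => iota (e i)) c) (iota (e k)) = 2 * (c 0 k)%:C.
Proof.
move=> [Se npe]; have Ne i : noniso (iota (e i)) by case: (Se i).
have ip_sum (J : finType) (F : J -> HHdual E) a : ip (\sum_i F i) a = \sum_i ip (F i) a.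
  have ip0 : ip 0 a = 0 by rewrite /ip (dform0l HE) mulr0 mul0r.
  exact: (big_morph (fun b => ip b a) (fun b c => ipDl HE a b c) ip0).
rewrite /rcomb ip_sum (bigD1 k) //= ipZl // ip_id // mulrC big1 ?addr0 // => j jk.
rewrite ipZl //; case: (orth (Se j) (Se k)) => [/(npe j k jk)//|z].
by rewrite -(XcfE HE iotaP (e j) (Ne k)) z mulr0.
Qed.

Let ip_ofreal_inj (x : R) : 2 * x%:C = 0 :> K -> x = 0.
Proof.
by move/eqP; rewrite mulf_eq0 pnatr_eq0 /= fmorph_eq0 => /eqP.
Qed.

Let family_free m (e : 'I_m -> X) (c : 'rV[R]_m) : short_family e ->
  V0 (rcomb (fun i => iota (e i)) c) -> c = 0.
Proof.
move=> Fe Vc; apply/rowP => k; rewrite mxE; apply: ip_ofreal_inj.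
have Nk : noniso (iota (e k)) by case: Fe => /(_ k)[].
by rewrite -(ip_family c k Fe) /ip (V0_orth HE Nk Vc) mulr0 mul0r.
Qed.

Let V0s : real_subspace V0. Proof. exact: Rspan_subspace. Qed.

Let family_bound m (e : 'I_m -> X) : short_family e -> (m <= l)%N.
Proof.
move=> Fe; have [t [_ _ tc]] := dim_quotient_family V0s Hrank.
have [||A [_ /eqP rA]] := rcomb_exchange (t := fun i => iota (e i)) (e := t) V0s _ _.
- by move=> c; apply: family_free.
- by move=> i; apply: tc; apply: Rspan_incl; case: Fe => /(_ i)[[]].
by rewrite -[X in (X <= _)%N]rA rank_leq_col.
Qed.

Let max_family : exists m (e : 'I_m -> X), short_family e /\
  forall a, short a -> exists i, par (e i) a.
Proof.
have ex : exists m, `[< exists e : 'I_m -> X, short_family e >].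
  exists 0%N; apply/asboolP; have e0 : 'I_0 -> X by case.
  by exists e0; split=> -[].
have bnd m : `[< exists e : 'I_m -> X, short_family e >] -> (m <= l)%N.
  by move=> /asboolP[e Fe]; apply: family_bound Fe.
case: (ex_maxnP ex bnd) => m /asboolP[e Fe] max; exists m, e; split=> // a Sa.
apply: contrapT => noi; have : (m.+1 <= m)%N; last by rewrite ltnn.
apply: max; apply/asboolP.
exists (fun i => if unlift ord0 i is Some j then e j else a); have [Se npe] := Fe.
split=> [i|i j]; first by case: unliftP.
case: unliftP => [i' ->|->]; case: unliftP => [j' ->|->] //.
- by rewrite (inj_eq lift_inj); apply: npe.
- by move=> _ p; apply: noi; exists i'.
- by move=> _ /(parallel_sym H) p; apply: noi; exists j'.
Qed.

(** The image required by [type_B] contains 0; the root space of 0 is the nonzero Cartan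
    subalgebra. *)
Let root0 : root 0.
Proof.
have [_ [h h0] _ _ _] : eala_A2 E by case: HE => -[_ []].
exists (cartan_incl E h); split; last exact: incl0.
have [inj _ _ _ _] : eala_A2 E by case: HE => -[_ []].
by apply: contra_neq h0 => h0; apply: inj; rewrite h0 linear0.
Qed.

(** A maximal family of nonparallel short roots spans V modulo V^0 by [short_or_sum], so it has l
    members and can play the standard basis of R^l. [sum_root] supplies all the vectors ± e_i ±
    e_j. *)
Lemma orthogonal_short_type_B : type_B E l.
Proof.
have [m [e [Fe emax]]] := max_family; have [Se npe] := Fe.
pose ie i := iota (e i).
have Ne i : noniso (ie i) by case: (Se i).
have [V0_0 V0_D V0_Z] := V0s.
have HS := rcomb_subspace ie V0s; have [S0 SD SZ] := HS.
pose S := [set v | exists c, V0 (v - rcomb ie c)].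
have V0S v : V0 v -> S v by move=> Vv; exists 0; rewrite rcomb0 subr0.
have eS i : S (ie i) by exists (delta_mx 0 i); rewrite rcomb_delta subrr.
have shortS a : short a -> S (iota a).
  move=> /emax[i [Va|Va]].
    have -> : iota a = (iota a - ie i) + ie i by rewrite subrK.
    by apply: SD; [apply: V0S; rewrite /ie -iotaB | apply: eS].
  have -> : iota a = (iota a + ie i) - ie i by rewrite addrK.
  by apply: (subspaceB HS); [apply: V0S; rewrite /ie -(iotaD iotaB) | apply: eS].
have VS v : V v -> S v.
  move: v; apply: Rspan_min => // a Ra.
  have [Na|/iso_V0/V0S//] := root_cases Ra.
  have [v va] := root_iota iotaP Ra; rewrite va in Na *.
  have [Sv|[b [c [Sb Sc _ ->]]]] := short_or_sum H orth Na; first exact: shortS.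
  by rewrite (iotaD iotaB); apply: SD; apply: shortS.
have ml : m = l.
  apply/eqP; rewrite eqn_leq (family_bound Fe).
  have [t [tV tfree _]] := dim_quotient_family V0s Hrank.
  have [A [_ /eqP rA]] := rcomb_exchange V0s tfree (fun j => VS _ (tV j)).
  by rewrite -[X in (X <= _)%N]rA rank_leq_col.
subst m.
(* [complex.Re] brings pairings, which are real on V, from K to R; the division by 2 compensates
   <e_i, e_i^vee> = 2. *)
pose f (v : HHdual E) : 'rV[R]_l := \row_i (complex.Re (ip v (ie i)) / 2).
have fD u v : f (u + v) = f u + f v.
  apply/rowP => i; rewrite !mxE ipDl //.
  have -> : complex.Re (ip u (ie i) + ip v (ie i)) =
      complex.Re (ip u (ie i)) + complex.Re (ip v (ie i)).
    by case: (ip u _) (ip v _) => ? ? [].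
  by rewrite mulrDl.
have fZ (r : R) v : f (r%:C *: v) = r *: f v.
  by apply/rowP => i; rewrite !mxE ipZl // Re_ofrealM mulrA.
have fV0 u v : V0 (u - v) -> f u = f v.
  by move=> Vuv; apply/rowP => i; rewrite !mxE (ip_V0 (Ne i) Vuv).
have f_rcomb c : f (rcomb ie c) = c.
  apply/rowP => i; rewrite mxE (ip_family c i Fe) [2 * _]mulrC Re_ofrealM.
  have -> : complex.Re (2 : K) = 2 by [].
  by rewrite -mulrA divff ?mulr1 // pnatr_eq0.
have fe i : f (ie i) = delta_mx 0 i by rewrite -(rcomb_delta ie i) f_rcomb.
have fS v c : V0 (v - rcomb ie c) -> f v = c by move=> /fV0 ->; rewrite f_rcomb.
have fN v : f (- v) = - f v.
  by have := fZ (-1) v; rewrite rmorphN rmorph1 !scaleN1r.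
have f_short a : short a -> exists (s : bool) i, f (iota a) = (-1) ^+ s *: delta_mx 0 i
    /\ par (e i) a.
  move=> Sa; have [i pa] := emax a Sa; case: (pa) => Va.
    by exists false, i; rewrite expr0 scale1r -fe; split=> //; apply: fV0; rewrite /ie -iotaB.
  exists true, i; rewrite expr1 scaleN1r -fe -fN; split=> //; apply: fV0.
  by rewrite opprK /ie -(iotaD iotaB).
exists f; split.
- by move=> r x y _ _; rewrite fD fZ.
- move=> v Vv; have [c Vc] := VS v Vv; rewrite (fS _ _ Vc); split=> [c0|Vv0].
    by move: Vc; rewrite c0 rcomb0 subr0.
  rewrite -(fS _ _ Vc) (fV0 v 0) ?subr0 //.
  by apply/rowP => i; rewrite !mxE /ip (dform0l HE) mulr0 mul0r mul0r.
apply/seteqP; split=> [_ [a Ra <-]|v].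
  have [Na|Ia] := root_cases Ra; last first.
    left; rewrite /= (fV0 a 0) ?subr0; last exact: iso_V0.
    by apply/rowP => i; rewrite !mxE /ip (dform0l HE) mulr0 mul0r mul0r.
  right; have [v va] := root_iota iotaP Ra; rewrite va in Na *.
  have [Sv|[b [c [Sb Sc npbc ->]]]] := short_or_sum H orth Na.
    by left; have [s [i [-> _]]] := f_short v Sv; exists s, i.
  right; have [s [i [fb pb]]] := f_short b Sb; have [t [j [fc pc]]] := f_short c Sc.
  exists s, t, i, j; rewrite (iotaD iotaB) fD fb fc; split=> //.
  apply/negP => /eqP ij; apply: npbc; rewrite ij in pb.
  exact: (parallel_trans H (parallel_sym H pb) pc).
have f0 : f 0 = 0 by rewrite -(scale0r (0 : HHdual E)) (fZ 0) scale0r.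
pose es (s : bool) i := if s then - e i else e i.
have Ses s i : short (es s i) by case: s; [apply: shortN H _ (Se i) | apply: Se].
have fes s i : f (iota (es s i)) = (-1) ^+ s *: delta_mx 0 i.
  by case: s; rewrite /es ?(iotaN iotaB) ?fN fe ?expr1 ?expr0 ?scaleN1r ?scale1r.
case=> [->|[[s [i ->]]|[s [t [i [j [ij ->]]]]]]].
- by exists 0.
- by exists (iota (es s i)); [case: (Ses s i) => -[] | apply: fes].
have np : ~ par (es s i) (es t j).
  rewrite /es; case: s; case: t => p; apply: (npe i j ij) => //.
  - by apply/(parallelNl H)/(parallelNr H).
  - by apply/(parallelNl H).
  - by apply/(parallelNr H).
have [a Na Va] := sum_root H H2 orth (Ses s i) (Ses t j) np.
exists (iota a); first by case: Na.
by rewrite (fV0 _ (iota (es s i + es t j))) -?iotaB // (iotaD iotaB) fD !fes.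
Qed.

End OrthogonalShortRoots.

End EalaTypes.

(** * The isomorphism of lattices *)

Lemma lattice_isomorphic (K : numFieldType) (X : zmodType) (N V0 : set X)
    (L : lmodType K) (br : L -> L -> L) (x x' : X -> L) (f : L -> L) :
  (forall y z, f (y + z) = f y + f z) -> (forall y z, f (br y z) = br (f y) (f z)) ->
  injective f ->
  (forall c y z, br (c *: y) z = c *: br y z) ->
  (forall c y z, br y (c *: z) = c *: br y z) ->
  (forall a, exists s : bool, f (x a) = (-1) ^+ s *: x' a) ->
  set_bij (Zspan (lattice_gens N V0 br x)) (Zspan (lattice_gens N V0 br x')) f.
Proof.
move=> fD f_br f_inj brZl brZr fx.
have f0 : f 0 = 0 by apply: (addrI (f 0)); rewrite -fD !addr0.
have fB y z : f (y - z) = f y - f z by rewrite -[in RHS](subrK z y) [in RHS]fD addrK.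
have signZ_in M (s : bool) (u : L) : additive_subgroup M -> M u -> M ((-1) ^+ s *: u).
  move=> HM Mu; case: s; rewrite ?expr1 ?scaleN1r ?expr0 ?scale1r //.
  exact: (subgroupN HM).
have f_gen u : lattice_gens N V0 br x u -> exists s (v : L),
    lattice_gens N V0 br x' v /\ f u = (-1) ^+ (s : bool) *: v.
  case=> [[a Na ->]|[b [s [Nb Vs ->]]]].
    by have [s fs] := fx a; exists s, (x' a); split=> //; left; exists a.
  have [s1 E1] := fx (b + s); have [s2 E2] := fx (- b).
  exists (s1 (+) s2), (yvec br x' b s); split; first by right; exists b, s.
  by rewrite /yvec f_br E1 E2 brZl brZr scalerA signr_addb.
have gen_f v : lattice_gens N V0 br x' v -> exists s (u : L),
    lattice_gens N V0 br x u /\ v = (-1) ^+ (s : bool) *: f u.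
  case=> [[a Na ->]|[b [s [Nb Vs ->]]]].
    have [s fs] := fx a; exists s, (x a); split; first by left; exists a.
    by rewrite fs signrZK.
  have [s1 E1] := fx (b + s); have [s2 E2] := fx (- b).
  exists (s1 (+) s2), (yvec br x b s); split; first by right; exists b, s.
  by rewrite /yvec f_br E1 E2 brZl brZr [(-1) ^+ s1 *: _]scalerA -signr_addb signrZK.
split.
- move=> u Lu; move: u Lu; apply: Zspan_min.
    have HM := Zspan_subgroup (lattice_gens N V0 br x').
    split=> [|u v fu fv] /=; first by rewrite f0; apply: subgroup0 HM.
    by rewrite fB; apply: HM.2.
  move=> u /f_gen[s [v [gv E1]]]; rewrite /= E1.
  by apply: (signZ_in _ _ _ (Zspan_subgroup _)); apply: Zspan_incl.
- by move=> u v _ _; apply: f_inj.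
move=> v Lv; move: v Lv; apply: Zspan_min.
  have HM := Zspan_subgroup (lattice_gens N V0 br x).
  split=> [|_ _ [u Lu <-] [v Lv <-]] /=; first by exists 0 => //; apply: subgroup0 HM.
  by exists (u - v); rewrite ?fB //; apply: HM.2.
move=> v /gen_f[s [u [gu ->]]]; have HM := Zspan_subgroup (lattice_gens N V0 br x).
exists ((-1) ^+ s *: u); first by apply: (signZ_in _ _ _ HM); apply: Zspan_incl.
case: s; rewrite ?expr1 ?scaleN1r ?expr0 ?scale1r //.
by rewrite -sub0r fB f0 sub0r.
Qed.

Theorem theorem3p2p5 (R : realType) (E : eala_data R) (l : nat)
    (dotR : set (HHdual E)) (tau taub : E -> E) (x_ xb_ : HHdual E -> E)
    (B Bb : set E) :
  is_eala E ->
  reduced_type E ->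
  eala_rank E l -> (1 < l)%N ->
  finite_part dotR ->
  (type_B E l -> is_ind dotR 0%R) ->
  chevalley_involution tau -> chevalley_system tau x_ ->
  chevalley_involution taub -> chevalley_system taub xb_ ->
  constructed_from dotR tau x_ B ->
  constructed_from dotR taub xb_ Bb ->
  Z_lie_isomorphic (Zspan B) (Zspan Bb).
Proof.
move=> HE Hred Hrank l1 Hfin HB Htau Hx Htaub Hxb consB consBb.
have A5 : eala_A5 E by case: HE => _ [_ []].
have [n [iota [iotaB iota_inj iotaP]]] := free_abelian_coords A5.
have H := eala_affine_roots HE Hred Hfin iotaB iotaP.
have H2 := eala_irreducible_roots HE Hrank l1 iotaB iota_inj iotaP.
have G := eala_graded_lie HE iotaB iotaP.
have C := eala_chevalley_data HE iotaB iotaP Htau Hx.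
have Cb := eala_chevalley_data HE iotaB iotaP Htaub Hxb.
have [c [xbE Rc]] := chevalley_ratio H G C Cb.
have rel (m : seq 'rV[int]_n) : (forall a, a \in m -> XN iota a) ->
    \sum_(a <- m) a = 0 -> \prod_(a <- m) c a ^+ 2 = 1.
  have [[a [b [Sa Sb np n0]]]|orth] := pselect (exists a b,
      [/\ short_root (XN iota) (XV0 iota) (Xcf iota) a,
          short_root (XN iota) (XV0 iota) (Xcf iota) b,
          ~ parallel (XV0 iota) a b & Xcf iota a b <> 0]).
    exact: (chi_relation_short H H2 Rc Sa Sb np n0).
  have [|p [Up pN free gen]] := independent_base HE Hrank l1 iotaB iota_inj iotaP (dotR := dotR).
  - apply: HB; apply: (orthogonal_short_type_B HE Hred Hrank l1 Hfin iotaB iota_inj iotaP).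
    move=> a b Sa Sb; have [|np] := pselect (parallel (XV0 iota) a b); first by left.
    by right; apply: contrapT => n0; apply: orth; exists a, b.
  exact: (chi_relation_independent Rc Up pN free gen).
have Nprop a : XN iota a -> [/\ XN iota (- a), c a ^+ 2 != 0 & c (- a) ^+ 2 = (c a ^+ 2)^-1].
  by move=> Na; split; [apply: (ar_NN H) | apply: (rc_neq0 Rc) | apply: (rc_opp Rc)].
(* Nonisotropic roots alone generate the lattice: an isotropic s is (b + s) - b for some b, by
   [iso_nonisolated]. *)
have span v : exists2 m : seq 'rV[int]_n,
    forall a, a \in m -> XN iota a & \sum_(a <- m) a = v.
  suff [m mN mv] : exists2 m : seq 'rV[int]_n,
      forall a, a \in m -> XN iota a & iota v = iota (\sum_(a <- m) a).
    by exists m => //; rewrite (iota_inj _ _ mv).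
  have : Zspan (@root_system R E) (iota v) by apply/iotaP; exists v.
  move: (iota v); apply: Zspan_min.
    split; first by exists [::]; rewrite // big_nil (iota0 iotaB).
    move=> _ _ [m1 N1 ->] [m2 N2 ->]; exists (m1 ++ map -%R m2).
      move=> a; rewrite mem_cat => /orP[/N1//|/mapP[b /N2 Nb ->]].
      exact: (ar_NN H).
    by rewrite -iotaB big_cat big_map sumrN.
  move=> a Ra; have [w aw] := root_iota iotaP Ra.
  have [Na|Ia] := root_cases Ra.
    exists [:: w]; last by rewrite big_seq1.
    by move=> b; rewrite inE => /eqP ->; rewrite /XN /= -aw.
  have [b Nb Nba] := iso_nonisolated HE (exists_noniso Hrank l1) Ia.
  have [u bu] := root_iota iotaP Nb.1; have [t bat] := root_iota iotaP Nba.1.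
  exists [:: t; - u].
    move=> d; rewrite !inE => /orP[]/eqP ->; first by rewrite /XN /= -bat.
    by apply: (ar_NN H); rewrite /XN /= -bu.
  by rewrite !big_cons big_nil addr0 iotaB -bat -bu addrC addKr.
have [phi [phi0 phiD phi2]] := character_sqrt Nprop span rel.
(* The default 1 off the lattice keeps psi nonzero everywhere, as [grading_automorphism] demands. *)
pose psi a := if pselect (exists v, a = iota v) is left ex then phi (projT1 (cid ex)) else 1.
have psi_iota v : psi (iota v) = phi v.
  rewrite /psi; case: pselect => [ex|]; last by case; exists v.
  by congr phi; apply: iota_inj; case: (cid ex).
have psi0 a : psi a != 0.
  by rewrite /psi; case: pselect => // _; apply: oner_neq0.
have psiD a b : root_system a -> root_system b -> psi (a + b) = psi a * psi b.
  move=> /(root_iota iotaP)[v ->] /(root_iota iotaP)[w ->].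
  by rewrite -(iotaD iotaB) !psi_iota phiD.
have [f [fD f_br f_inj f_rs]] := grading_automorphism HE psi0 psiD.
rewrite (constructed_span HE iotaB iota_inj iotaP Hred Hrank l1 Hfin Htau Hx consB).
rewrite (constructed_span HE iotaB iota_inj iotaP Hred Hrank l1 Hfin Htaub Hxb consBb).
split.
- by split; [apply: Zspan_subgroup | move=> u v; apply: (lattice_br H H2 G C)].
- by split; [apply: Zspan_subgroup | move=> u v; apply: (lattice_br H H2 G Cb)].
exists f; split=> [|u v _ _|u v _ _]; [|exact: fD|exact: f_br].
apply: lattice_isomorphic => //; [exact: ebrZl|exact: ebrZr|move=> a].
have [Na|nNa] := pselect (XN iota a); last first.
  exists false; rewrite (cd_out C nNa) (cd_out Cb nNa) scaler0.
  by rewrite (f_rs 0) ?scaler0 //; apply: rs0.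
rewrite (f_rs _ _ (cd_rs C a)) psi_iota xbE //.
(* phi a and c a have the same square, and the remaining sign is the one allowed by
   [lattice_isomorphic]. *)
have /eqP := phi2 a Na; rewrite eqf_sqr => /orP[]/eqP ->.
  by exists false; rewrite scale1r.
by exists true; rewrite expr1 scaleN1r scaleNr.
Qed.
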